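(* Let $G$ be a graph on a linearly ordered set of edges $E$, and let $\vec G$ be an orientation of $G$ (reference orientation). (1) The mapping $-_A\vec G\mapsto\alpha_{\vec G}(A)$, $A\subseteq E$, yields a bijection between all reorientations of $\vec G$ and all subsets of $E$. It maps activity classes of orientations of $G$ onto intervals of spanning trees of $G$, and these restrictions are boolean lattice isomorphisms. (2) For all $A\subseteq E$, with $T=\alpha(-_A\vec G)$, $P=A\cap\mathrm{Int}(T)=A\cap O^*(-_A\vec G)$, $Q=A\cap\mathrm{Ext}(T)=A\cap O(-_A\vec G)$ (so $\alpha_{\vec G}(A)=(T\setminus P)\cup Q$), one has $$\mathrm{Int}_G(\alpha_{\vec G}(A))=\mathrm{Int}_G(T)\setminus P=O^*(-_A\vec G)\setminus P=\Theta^*_{\vec G}(A),\qquad P_G(\alpha_{\vec G}(A))=P=\bar\Theta^*_{\vec G}(A),$$ $$\mathrm{Ext}_G(\alpha_{\vec G}(A))=\mathrm{Ext}_G(T)\setminus Q=O(-_A\vec G)\setminus Q=\Theta_{\vec G}(A),\qquad Q_G(\alpha_{\vec G}(A))=Q=\bar\Theta_{\vec G}(A).$$ (3) In particular, $\alpha_{\vec G}(A)=\alpha(-_A\vec G)$ if and only if $-_A\vec G$ is active-fixed and dual-active-fixed w.r.t. $\vec G$. Similarly, restrictions of $\alpha_{\vec G}$ yield the following bijections between types of orientations $-_A\vec G$ and types of subsets of $E$, each with the indicated cardinality (active-fixed and dual-active-fixed being w.r.t. $\vec G$ unless otherwise specified): - orientations and subsets: $t(G;2,2)$; - acyclic orientations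 and subsets of internal spanning trees (or no-broken-circuit subsets): $t(G;2,0)$; - strongly connected orientations and supersets of external spanning trees: $t(G;0,2)$; - dual-active-fixed acyclic orientations and internal spanning trees: $t(G;1,0)$; - acyclic orientations that are dual-active-fixed w.r.t. $-_E\vec G$ and minimal subsets of intervals of internal spanning trees: $t(G;1,0)$; - active-fixed strongly connected orientations and external spanning trees: $t(G;0,1)$; - strongly connected orientations that are active-fixed w.r.t. $-_E\vec G$ and maximal subsets of intervals of external spanning trees: $t(G;0,1)$; - active-fixed orientations and subsets of spanning trees (forests): $t(G;2,1)$; - dual-active-fixed orientations and supersets of spanning trees (connected spanning subgraphs): $t(G;1,2)$; - active-fixed and dual-active-fixed orientations and spanning trees: $t(G;1,1)$.
   Context: Graphs are finite, may have loops and multiple edges, and are connected unless they arise as minors (isolated vertices are ignored, and for a disconnected graph ''spanning tree'' means maximal spanning forest). For $F\subseteq E$, $G(F)$ is the restriction of $G$ to $F$ (deletion of $E\setminus F$) and $G/F$ is the contraction of $F$; similarly for digraphs. Cycles and cocycles (inclusion-minimal non-empty edge cuts) are edge subsets. Minors inherit the linear order. $-_A\vec G$ is obtained from $\vec G$ by reversing the edges in $A$. A cycle is directed if its edges are consistently oriented along it; a cocycle is directed if all its edges go from one side of the cut to the other. Acyclic means no directed cycle; strongly connected means every edge is in a directed cycle. $\subset$ is strict inclusion, $\uplus$ disjoint union, $\triangle$ symmetric difference. Spanning trees. For a spanning tree $T$, $b\in T$, $e\notin T$: $C^*(T;b)$ is the unique cocycle contained in $(E\setminus T)\cup\{b\}$,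 $C(T;e)$ the unique cycle contained in $T\cup\{e\}$. $\mathrm{Int}(T)=\mathrm{Int}_G(T)=\{b\in T: b=\min C^*(T;b)\}$, $\mathrm{Ext}(T)=\mathrm{Ext}_G(T)=\{e\in E\setminus T: e=\min C(T;e)\}$. $T$ is internal if $\mathrm{Ext}(T)=\emptyset$, external if $\mathrm{Int}(T)=\emptyset$. The interval of $T$ is $[T\setminus\mathrm{Int}(T),T\cup\mathrm{Ext}(T)]$, consisting of all $(T\setminus P)\cup Q$ with $P\subseteq\mathrm{Int}(T)$, $Q\subseteq\mathrm{Ext}(T)$; it is a boolean lattice isomorphic to the power set of $\mathrm{Int}(T)\cup\mathrm{Ext}(T)$ via $P\cup Q$. It is classical that these intervals partition $2^E$. For $B\subseteq E$ in the interval of $T$: $\mathrm{Int}_G(B)=\mathrm{Int}_G(T)\cap B$, $P_G(B)=\mathrm{Int}_G(T)\setminus B$, $\mathrm{Ext}_G(B)=\mathrm{Ext}_G(T)\setminus B$, $Q_G(B)=\mathrm{Ext}_G(T)\cap B$. The Tutte polynomial is $t(G;x,y)=\sum t_{\iota,\varepsilon}x^\iota y^\varepsilon$ with $t_{\iota,\varepsilon}$ the number of spanning trees with $|\mathrm{Int}(T)|=\iota$, $|\mathrm{Ext}(T)|=\varepsilon$. A no-broken-circuit subset is one containing no set $C\setminus\{\min C\}$ with $C$ a cycle. Orientations. $O(\vec H)$ (active edges) is the set of smallest edges of directed cycles of $\vec H$, $O^*(\vec H)$ (dual-active edges) the set of smallest edges of directed cocycles. $\Theta_{\vec G}(A)=O(-_A\vec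 G)\setminus A$, $\bar\Theta_{\vec G}(A)=O(-_A\vec G)\cap A$, $\Theta^*_{\vec G}(A)=O^*(-_A\vec G)\setminus A$, $\bar\Theta^*_{\vec G}(A)=O^*(-_A\vec G)\cap A$. $-_A\vec G$ is active-fixed (dual-active-fixed) w.r.t. a reference orientation if the directions of all active (dual-active) edges of $-_A\vec G$ agree with their directions in the reference orientation; w.r.t. $\vec G$ this means $O(-_A\vec G)\cap A=\emptyset$ (resp. $O^*(-_A\vec G)\cap A=\emptyset$). Let $\vec H$ be an ordered digraph with edge set $E$, dual-active edges $a_1<\cdots<a_\iota$ and active edges $a'_1<\cdots<a'_\varepsilon$. Its active filtration is $\emptyset=F'_\varepsilon\subset\cdots\subset F'_0=F_c=F_0\subset\cdots\subset F_\iota=E$, where $F_c$ is the union of all directed cycles, $F_k=E\setminus\bigcup\{D\text{ directed cocycle}:\min(D)\ge a_{k+1}\}$ for $0\le k\le\iota-1$, $F'_k=\bigcup\{C\text{ directed cycle}:\min(C)\ge a'_{k+1}\}$ for $0\le k\le\varepsilon-1$. Its active partition has parts $F_k\setminus F_{k-1}$ ($1\le k\le\iota$, smallest element $a_k$) and $F'_{k-1}\setminus F'_k$ ($1\le k\le\varepsilon$, smallest element $a'_k$). The activity class of $\vec H$ is the set of orientations obtained from $\vec H$ by reversing any union of parts of its active partition; all members have the same active partition. Each class contains exactly one orientation that is active-fixed and dual-active-fixed w.r.t. $\vec G$; the class is a boolean lattice isomorphic to the power set of the set of (dual-)active edges, an orientation corresponding to the set of smallest elements of the parts in which it differs from this representative.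 The mapping $\alpha$. $\vec H$ is bipolar w.r.t. $p$ if every edge is in a directed cocycle and every directed cocycle contains $p$; cyclic-bipolar w.r.t. $p$ if every edge is in a directed cycle and every directed cycle contains $p$. Two edges of a cycle have opposite directions in it if oriented opposite ways along it; two edges of a cocycle have opposite directions in it if they cross the cut in opposite ways. If $\vec H$ is bipolar w.r.t. $p=\min(E)$, $\alpha(\vec H)$ is the unique spanning tree $T$ (existence and uniqueness is a known theorem) such that every $b\in T\setminus\{p\}$ and $\min C^*(T;b)$ have opposite directions in $C^*(T;b)$, and every $e\in E\setminus T$ and $\min C(T;e)$ have opposite directions in $C(T;e)$. If $\vec H$ is cyclic-bipolar w.r.t. $p=\min(E)$, the definition is the same with ''every $b\in T$'' and ''every $e\in(E\setminus T)\setminus\{p\}$''. In general, with the active filtration of $\vec H$, $\alpha(\vec H)=\biguplus_{1\le k\le\iota}\alpha(\vec H(F_k)/F_{k-1})\uplus\biguplus_{1\le k\le\varepsilon}\alpha(\vec H(F'_{k-1})/F'_k)$ (these minors are bipolar, resp. cyclic-bipolar, w.r.t. their smallest edge). It is a spanning tree with $\mathrm{Int}(\alpha(\vec H))=O^*(\vec H)$ and $\mathrm{Ext}(\alpha(\vec H))=O(\vec H)$. The refined mapping is, for $A\subseteq E$: $\alpha_{\vec G}(A)=\bigl(\alpha(-_A\vec G)\setminus(A\cap O^*(-_A\vec G))\bigr)\cup\bigl(A\cap O(-_A\vec G)\bigr)$. *)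

(* Defs.v *)
From HB Require Import structures.
From mathcomp Require Import all_boot all_order all_algebra.

Set Implicit Arguments.
Unset Strict Implicit.
Unset Printing Implicit Defensive.

(* An edge e has two half-edges, e with false and e with true, attached at     *)
(* [endpoint G e false] and [endpoint G e true].  An orientation w says from   *)
(* which half-edge each edge starts: e goes from [endpoint G e (w e)] to       *)
(* [endpoint G e (~~ w e)].  In this way a loop has two distinct orientations. *)
(* A minor keeps the types V and E: only the set of edges and the attachment   *)
(* of the half-edges change, vertices that are merged or abandoned become      *)
(* isolated, and orientations and the order on E are inherited as they are.    *)
Record multigraph (V E : finType) := MGraph {
  edges : {set E};
  endpoint : E -> bool -> V
}.

Definition orientation (E : finType) := {ffun E -> bool}.

Definition reorient (E : finType) (A : {set E}) (w : orientation E) :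
  orientation E := [ffun e => w e (+) (e \in A)].

Section Minors.
Variables V E : finType.
Implicit Types (G : multigraph V E) (F : {set E}).

Definition adjacent G : rel V := fun u v =>
  [exists e in edges G, exists b : bool,
     (endpoint G e b == u) && (endpoint G e (~~ b) == v)].

Definition connected_graph G := forall u v : V, connect (adjacent G) u v.

Definition restrict G F := MGraph (edges G :&: F) (endpoint G).

Definition contract G F :=
  MGraph (edges G :\: F)
    (fun e b => fingraph.root (adjacent (restrict G F)) (endpoint G e b)).

End Minors.

Section CyclesCocycles.
Variables V E : finType.
Implicit Types (G : multigraph V E) (w : orientation E).
Implicit Types (C D F T : {set E}) (U : {set V}) (e f : E).

(* The pair (e, b) stands for e traversed from its half-edge b to its          *)
(* half-edge ~~ b; it agrees with w when b = w e.  The bound on the length of  *)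
(* closed paths is harmless since their edges are distinct.                    *)
Definition dart := (E * bool)%type.
Definition source G (x : dart) := endpoint G x.1 x.2.
Definition target G (x : dart) := endpoint G x.1 (~~ x.2).

Definition closed_path_along G C (s : seq dart) :=
  [&& s != [::], cycle (fun x y => target G x == source G y) s,
      uniq (map fst s), uniq (map (source G) s),
      C == [set e in map fst s] & C \subset edges G].

Definition is_cycle G C :=
  [exists s : #|E|.-bseq dart, closed_path_along G C s].

Definition directed_cycle G w C :=
  [exists s : #|E|.-bseq dart,
     closed_path_along G C s && all (fun x : dart => x.2 == w x.1) s].

Definition opposite_in_cycle G w C e f :=
  [exists s : #|E|.-bseq dart, exists b : bool, exists c : bool,
     [&& closed_path_along G C s, (e, b) \in s, (f, c) \in s
       & (b == w e) != (c == w f)]].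

Definition cut G U :=
  [set e in edges G | (endpoint G e false \in U) != (endpoint G e true \in U)].

Definition is_cocycle G D :=
  minset (fun D' => (D' != set0) && [exists U, D' == cut G U]) D.

Definition directed_cocycle G w D :=
  is_cocycle G D &&
  [exists U, (D == cut G U) && [forall e in D, endpoint G e (w e) \in U]].

Definition opposite_in_cocycle G w D e f :=
  [&& is_cocycle G D, e \in D, f \in D &
    [exists U, (D == cut G U) &&
       ((endpoint G e (w e) \in U) != (endpoint G f (w f) \in U))]].

Definition acyclic G w := [forall C, ~~ directed_cycle G w C].

Definition strongly_connected G w :=
  [forall e in edges G, exists C, directed_cycle G w C && (e \in C)].

Definition forest G F :=
  (F \subset edges G) && [forall C, is_cycle G C ==> ~~ (C \subset F)].

Definition spanning G F :=
  [forall u, forall v,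
     connect (adjacent G) u v ==> connect (adjacent (restrict G F)) u v].

(* On a disconnected graph these are the maximal spanning forests.             *)
Definition spanning_tree G T := forest G T && spanning G T.

Definition fund_cocycle G T b :=
  odflt set0
    [pick D | is_cocycle G D && (D \subset (edges G :\: T) :|: [set b])].

Definition fund_cycle G T e :=
  odflt set0 [pick C | is_cycle G C && (C \subset T :|: [set e])].

End CyclesCocycles.

Section Activities.
Variables (d : Order.disp_t) (V : finType) (E : finOrderType d).
Implicit Types (G : multigraph V E) (w : orientation E).
Implicit Types (A B C D S T X : {set E}) (e f a b m p : E).

Definition is_min m X := (m \in X) && [forall e in X, (m <= e)%O].

Definition min_ge a X := [exists m, is_min m X && (a <= m)%O].

Definition Int G T := [set b in T | is_min b (fund_cocycle G T b)].
Definition Ext G T := [set e in edges G :\: T | is_min e (fund_cycle G T e)].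

Definition internal_tree G T := spanning_tree G T && (Ext G T == set0).
Definition external_tree G T := spanning_tree G T && (Int G T == set0).

Definition tree_interval G T :=
  [set B : {set E} | (T :\: Int G T \subset B) && (B \subset T :|: Ext G T)].

(* The spanning tree whose interval contains B.                                *)
Definition tree_of G B :=
  odflt set0 [pick T | spanning_tree G T && (B \in tree_interval G T)].

Definition Int_sub G B := Int G (tree_of G B) :&: B.
Definition P_sub G B := Int G (tree_of G B) :\: B.
Definition Ext_sub G B := Ext G (tree_of G B) :\: B.
Definition Q_sub G B := Ext G (tree_of G B) :&: B.

Definition tutte_coef G (i j : nat) :=
  #|[set T : {set E} | [&& spanning_tree G T, #|Int G T| == i & #|Ext G T| == j]]|.

(* The outer variable is x and the inner one is y.                             *)
Definition tutte G : {poly {poly nat}} :=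
  (\sum_(i < #|E|.+1) \sum_(j < #|E|.+1)
     ('X^j *+ tutte_coef G i j)%:P * 'X^i)%R.

Definition tutte_at G (x y : nat) : nat := ((tutte G).[x%:P].[y])%R.

Definition no_broken_circuit G B :=
  [forall C, forall m,
     is_cycle G C && is_min m C ==> ~~ (C :\ m \subset B)].

Definition active G w :=
  [set e : E | [exists C, directed_cycle G w C && is_min e C]].
Definition dual_active G w :=
  [set e : E | [exists D, directed_cocycle G w D && is_min e D]].

Definition Theta G w A := active G (reorient A w) :\: A.
Definition Theta_bar G w A := active G (reorient A w) :&: A.
Definition Theta_star G w A := dual_active G (reorient A w) :\: A.
Definition Theta_star_bar G w A := dual_active G (reorient A w) :&: A.

Definition active_fixed G w0 w := [forall e in active G w, w e == w0 e].
Definition dual_active_fixed G w0 w :=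
  [forall e in dual_active G w, w e == w0 e].

(* [onth s k] below is a_(k+1), resp. a'_(k+1), and is None when k is at       *)
(* least the number of dual-active, resp. active, edges.                       *)
Definition filtration_up G w (k : nat) :=
  if onth (sort <=%O (enum (dual_active G w))) k is Some a then
    edges G :\: \bigcup_(D | directed_cocycle G w D && min_ge a D) D
  else edges G.

Definition filtration_down G w (k : nat) :=
  if onth (sort <=%O (enum (active G w))) k is Some a then
    \bigcup_(C | directed_cycle G w C && min_ge a C) C
  else set0.

Definition active_partition G w : {set {set E}} :=
  [set filtration_up G w k.+1 :\: filtration_up G w k
     | k : 'I_#|dual_active G w|] :|:
  [set filtration_down G w k :\: filtration_down G w k.+1
     | k : 'I_#|active G w|].

Definition activity_class G w : {set orientation E} :=
  [set reorient (cover S) w | S in powerset (active_partition G w)].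

Definition bipolar G w p :=
  [forall e in edges G, exists D, directed_cocycle G w D && (e \in D)] &&
  [forall D, directed_cocycle G w D ==> (p \in D)].

Definition cyclic_bipolar G w p :=
  [forall e in edges G, exists C, directed_cycle G w C && (e \in C)] &&
  [forall C, directed_cycle G w C ==> (p \in C)].

Definition opposite_to_min_cocycle G w T b :=
  [exists m, is_min m (fund_cocycle G T b) &&
     opposite_in_cocycle G w (fund_cocycle G T b) b m].

Definition opposite_to_min_cycle G w T e :=
  [exists m, is_min m (fund_cycle G T e) &&
     opposite_in_cycle G w (fund_cycle G T e) e m].

Definition bipolar_criterion G w p T :=
  [forall b in T :\ p, opposite_to_min_cocycle G w T b] &&
  [forall e in edges G :\: T, opposite_to_min_cycle G w T e].

Definition cyclic_bipolar_criterion G w p T :=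
  [forall b in T, opposite_to_min_cocycle G w T b] &&
  [forall e in (edges G :\: T) :\ p, opposite_to_min_cycle G w T e].

(* The map alpha on orientations that are bipolar or cyclic-bipolar with       *)
(* respect to the smallest edge.                                               *)
Definition alpha_bipolar G w :=
  odflt set0
    [pick T | spanning_tree G T &&
       [exists p, is_min p (edges G) &&
          ((bipolar G w p && bipolar_criterion G w p T) ||
           (cyclic_bipolar G w p && cyclic_bipolar_criterion G w p T))]].

Definition alpha G w :=
  (\bigcup_(k < #|dual_active G w|)
     alpha_bipolar (contract (restrict G (filtration_up G w k.+1))
                             (filtration_up G w k)) w) :|:
  (\bigcup_(k < #|active G w|)
     alpha_bipolar (contract (restrict G (filtration_down G w k))
                             (filtration_down G w k.+1)) w).

Definition alpha_refined G w A :=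
  (alpha G (reorient A w) :\: (A :&: dual_active G (reorient A w))) :|:
  (A :&: active G (reorient A w)).

(* The orientation in the activity class of w that is fixed with respect to    *)
(* the reference w0.                                                           *)
Definition representative G w0 w :=
  odflt w [pick r in activity_class G w
             | active_fixed G w0 r && dual_active_fixed G w0 r].

(* Smallest elements of the parts in which w differs from its representative.  *)
Definition class_code G w0 w :=
  [set a : E | [exists X in active_partition G w,
     is_min a X && [exists e in X, w e != representative G w0 w e]]].

(* The boolean lattice orders.  An interval is ordered through its             *)
(* identification with the power set of Int T :|: Ext T sending                *)
(* (T :\: P) :|: Q to P :|: Q, whose least element is T; this is not the       *)
(* inclusion of edge sets.                                                     *)
Definition class_le G w0 w1 w2 := class_code G w0 w1 \subset class_code G w0 w2.
Definition interval_le G B1 B2 :=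
  P_sub G B1 :|: Q_sub G B1 \subset P_sub G B2 :|: Q_sub G B2.

End Activities.

Definition order_isomorphism (aT rT : finType) (f : aT -> rT)
    (X : {set aT}) (leX : rel aT) (Y : {set rT}) (leY : rel rT) :=
  [/\ {in X &, injective f}, f @: X = Y
    & {in X &, forall x y, leX x y = leY (f x) (f y)}].

Definition restricts_to_bijection (aT rT : finType) (f : aT -> rT)
    (X : {set aT}) (Y : {set rT}) (n : nat) :=
  [/\ {in X &, injective f}, f @: X = Y, #|X| = n & #|Y| = n].

(* Main.v *)
Require Import Defs.
From HB Require Import structures.
From mathcomp Require Import all_boot all_order all_algebra.
From mathcomp Require Import zify lra ring.

Set Implicit Arguments.
Unset Strict Implicit.
Unset Printing Implicit Defensive.

Import Order.TTheory GRing.Theory Num.Theory.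

(** Read as vectors on the edges, with coordinates taken along the orientation,
the flows and the tensions of a digraph form two orthogonal spaces, and the
directed cycles and cocycles are the minimal supports of their nonnegative
vectors.  A spanning tree [T] gives every edge [x] one fundamental vector
[F x], the tension of C*(T;x) if [x] is in [T] and the flow of C(T;x) otherwise;
orthogonality makes [F] antisymmetric off the diagonal ([fr_anti]).  Activities
and the criterion defining [alpha] can be read on [F], and [F] is unchanged when
the two spaces are exchanged and [T] is complemented ([frameC]).  So an
argument about cocycles also proves its dual about cycles.

From trees to orientations.  Give each internally active edge its rank as level
and each externally active edge the opposite of its rank.  Then, in increasing
order, a passive edge of [T] takes the lowest level of the smaller edges of its
fundamental cocycle, and a passive edge outside [T] the highest level of the
smaller edges of its fundamental cycle ([levelling_exists]).  Whatever the
directions of the active edges, there is a way to direct the passive ones so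
that each is opposite, in its fundamental cycle or cocycle restricted to its
level, to the smallest edge of this restriction ([fitted_exists]).  Composing
fundamental vectors lexicographically, one finds nonnegative tensions whose
supports are the sets of edges of level at least [j], for positive [j], and
dually ([upper_level_vector]).  It follows that the levels are the parts of the
active partition of the orientation, and that its active and dual-active edges
are those of [T] ([directed_is_min], [directed_cover]).  Each level induces a
minor in which the edges of [T] satisfy the criterion for [alpha].

Uniqueness.  No other tree of this minor satisfies the criterion
([opposed_frames_eq]): for two such trees, sums of products of fundamental
coefficients over the symmetric difference vanish by orthogonality, whereas one
of them, chosen lexicographically, has only nonnegative terms and a positive one.
Hence [alpha] maps the orientation to [T] ([coherent_alpha]).

Counting.  Consider pairs of a tree [T] and a set [S] of active edges of [T].
Each pair comes from an orientation that [alpha] maps to [T] and that disagrees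
with the reference on [S] among the active edges; its image under the refined
mapping is the symmetric difference of [T] and [S].  Every subset of the edges
has this form: take a tree whose symmetric difference with it is
lexicographically smallest ([frame_near]).  So the refined mapping is onto
between two sets of the same size, hence bijective ([phi_bijective]), and every
orientation is obtained from its tree.  In particular the existence of the tree
defining [alpha] on bipolar digraphs is a consequence of this count.  Activity
classes are the fibres of [alpha] ([activity_classE]), and all the
restrictions are obtained by constraining the set [S]. *)

(** * Recursion along a finite linear order *)

Section Rank.
Local Open Scope ring_scope.
Variables (d : Order.disp_t) (E : finOrderType d).
Implicit Types x y : E.

Definition rank x := #|[set y | (y <= x)%O]|.

Lemma rank_lt x y : (x < y)%O -> (rank x < rank y)%N.
Proof.
move=> xy; apply: proper_card; apply/properP; split.
  by apply/subsetP=> z; rewrite !inE => /le_trans; apply; apply: ltW.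
by exists y; rewrite inE // -ltNge.
Qed.

Lemma rank_le x y : (rank x <= rank y)%N = (x <= y)%O.
Proof.
case: (leP x y) => [|/rank_lt]; last by rewrite ltnNge => /negbTE.
by rewrite le_eqVlt => /orP[/eqP->|/rank_lt/ltnW] //; rewrite leqnn.
Qed.

Lemma rank_gt0 x : (0 < rank x)%N.
Proof. by apply/card_gt0P; exists x; rewrite inE. Qed.

Lemma rank_inj : injective rank.
Proof. by move=> x y xy; apply/le_anti; rewrite -!rank_le xy leqnn. Qed.

Lemma min_exists (P : pred E) x :
  P x -> exists m, P m /\ forall y, P y -> (m <= y)%O.
Proof.
by move=> Px; case: (arg_minP id Px) => m Pm le_m; exists m.
Qed.

Lemma rank_ind (P : E -> Prop) :
  (forall x, (forall y, (y < x)%O -> P y) -> P x) -> forall x, P x.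
Proof.
move=> IH x; have [n] := ubnP (rank x); elim: n x => // n IHn x /ltnSE rx.
by apply: IH => y /rank_lt yx; apply: IHn; apply: leq_trans yx rx.
Qed.

(** Constraints [Q x f] that only look at the values of [f] up to [x] can be met
one element after the other.  Both the level of an edge and its direction are
chosen in this way. *)
Lemma greedy (A : Type) (a0 : A) (Q : E -> (E -> A) -> Prop) :
  (forall x f g, (forall y, (y <= x)%O -> f y = g y) -> Q x f -> Q x g) ->
  (forall x f, exists v, Q x (fun y => if y == x then v else f y)) ->
  exists f, forall x, Q x f.
Proof.
move=> Qext Qstep.
suff [f Qf] : exists f, forall x, (rank x < #|E|.+1)%N -> Q x f.
  by exists f => x; apply: Qf; rewrite ltnS max_card.
elim: #|E|.+1 => [|n [f Qf]]; first by exists (fun=> a0).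
case: (pickP (fun x => rank x == n)) => [x /eqP rx|no_x]; last first.
  by exists f => x; rewrite ltnS leq_eqVlt no_x; apply: Qf.
have [v Qv] := Qstep x f; exists (fun y => if y == x then v else f y) => y.
rewrite ltnS leq_eqVlt => /orP[/eqP ry|ry].
  by have -> : y = x by apply: rank_inj; rewrite ry rx.
apply: Qext (Qf y ry) => z zy; case: eqP => // zx.
by move: zy ry; rewrite -rank_le zx rx => /leq_ltn_trans h /h; rewrite ltnn.
Qed.

End Rank.

(** * Orthogonal spaces of vectors and fundamental vectors *)

Section Vectors.
Local Open Scope ring_scope.
Variables (d : Order.disp_t) (E : finOrderType d).
Implicit Types (x y : E) (u v : E -> rat) (K L : (E -> rat) -> Prop).
Implicit Types (T A B gr : {set E}) (F : E -> E -> rat).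

(** Closure is up to pointwise equality, so that [K] is a set of vectors although
its elements are functions. *)
Definition linear_space K := K (fun=> 0) /\
  forall a u v w, K u -> K v -> (forall e, w e = a * u e + v e) -> K w.

Definition orthogonal_spaces K L :=
  forall u v, K u -> L v -> \sum_e u e * v e = 0.

Definition supported gr K := forall u e, K u -> e \notin gr -> u e = 0.

Lemma linear_ext K u v :
  linear_space K -> K u -> u =1 v -> K v.
Proof.
by move=> [K0 linK] Ku uv; apply: (linK 1 _ _ _ Ku K0) => e; rewrite uv mul1r addr0.
Qed.

Lemma orthogonalC K L : orthogonal_spaces K L -> orthogonal_spaces L K.
Proof.
move=> KL u v Lu Kv; rewrite -[RHS](KL v u Kv Lu).
by apply: eq_bigr => e _; rewrite mulrC.
Qed.

Record dual_pair gr K L : Prop := DualPair {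
  dp_linl : linear_space K;
  dp_linr : linear_space L;
  dp_supl : supported gr K;
  dp_supr : supported gr L;
  dp_orth : orthogonal_spaces K L }.

Lemma dual_pairC gr K L : dual_pair gr K L -> dual_pair gr L K.
Proof. by case=> *; split=> //; apply: orthogonalC. Qed.

(** The composition of sign vectors: [u] decides wherever it does not vanish.  It
is realized by [N u + v] with [N] large. *)
Lemma compose_vectors K u v : linear_space K -> K u -> K v ->
  exists z, K z /\ forall e,
    (u e != 0 -> 0 < z e * u e) /\ (u e = 0 -> z e = v e).
Proof.
move=> linK Ku Kv; pose N := 1 + \sum_e `|v e / u e|.
exists (fun e => N * u e + v e); split; first exact: linK.2 Ku Kv _.
move=> e; split=> [ue|->]; last by rewrite mulr0 add0r.
have lt_N : `|v e / u e| < N.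
  rewrite /N (bigD1 e) //= addrA addrAC ltr_pwDl //.
    by rewrite ltr_pwDl // sumr_ge0.
have -> : (N * u e + v e) * u e = (N + v e / u e) * (u e ^+ 2).
  by rewrite expr2 mulrA [in RHS]mulrDl divfK.
rewrite mulr_gt0 ?exprn_even_gt0 // -[X in 0 < N + X]opprK subr_gt0.
by apply: le_lt_trans lt_N; rewrite -normrN ler_norm.
Qed.

(** Iterated composition: each coordinate takes the sign of the first vector of
the list, in the order [le], that does not vanish there. *)
Lemma lexicographic_vector K (le : rel E) (s : seq E) (X : E -> E -> rat) :
  linear_space K -> transitive le -> sorted le s ->
  {in s, forall i, K (X i)} ->
  exists z, K z /\ forall e,
    (z e = 0 /\ {in s, forall i, X i e = 0}) \/
    (exists i, [/\ i \in s, 0 < z e * X i e &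
       {in s, forall j, j != i -> X j e != 0 -> le i j}]).
Proof.
move=> linK le_tr; elim: s => [|i s IH] /= s_sort KX.
  by exists (fun=> 0); split=> [|e]; [apply: linK.1 | left].
have [z [Kz zP]] : exists z, K z /\ forall e,
    (z e = 0 /\ {in s, forall i, X i e = 0}) \/
    (exists i, [/\ i \in s, 0 < z e * X i e &
       {in s, forall j, j != i -> X j e != 0 -> le i j}]).
  apply: IH; first exact: path_sorted s_sort.
  by move=> j js; apply: KX; rewrite inE js orbT.
have KXi : K (X i) by apply: KX; rewrite inE eqxx.
have [z' [Kz' z'P]] := compose_vectors linK KXi Kz.
exists z'; split=> // e; have [z'N z'0] := z'P e.
have [Xie|Xie] := eqVneq (X i e) 0.
  rewrite z'0 //; case: (zP e) => [[ze sP]|[j [js zj jP]]]; [left|right].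
    by split=> // j; rewrite inE => /orP[/eqP->|/sP].
  exists j; split=> //; first by rewrite inE js orbT.
  by move=> k; rewrite inE => /orP[/eqP-> _|/jP //]; rewrite Xie eqxx.
right; exists i; split; [by rewrite inE eqxx | exact: z'N |].
move=> j; rewrite inE => /orP[/eqP->|js _ _]; first by rewrite eqxx.
by have /allP := order_path_min le_tr s_sort; apply.
Qed.

(** For [K] the tensions, [L] the flows and [T] a spanning tree, [F x] is the
vector of the fundamental cocycle of [x] when [x] is in [T] and of its
fundamental cycle otherwise, normalized at [x].  Indexing both kinds by the
edges makes the whole theory self-dual. *)
Record frame gr K L T F : Prop := Frame {
  fr_dual : dual_pair gr K L;
  fr_in : forall x, x \in gr -> if x \in T then K (F x) else L (F x);
  fr_diag : forall x, x \in gr -> F x x = 1;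
  fr_off : forall x y, x \in gr -> y \in gr -> x != y ->
     (x \in T) = (y \in T) -> F x y = 0 }.

(** Matroid duality: the same [F] serves for the complementary basis once the two
spaces are exchanged. *)
Lemma frameC gr K L T F : frame gr K L T F -> frame gr L K (~: T) F.
Proof.
case=> dKL inF diF ofF; split=> // [|x xg|x y xg yg xy].
- exact: dual_pairC.
- by rewrite inE; have := inF x xg; case: (x \in T).
- by rewrite !inE => /(can_inj negbK); apply: ofF.
Qed.

Lemma fr_supp gr K L T F x y :
  frame gr K L T F -> x \in gr -> F x y != 0 -> y \in gr.
Proof.
case=> dKL inF _ _ xg; apply: contraR => yg; apply/eqP.
have := inF x xg; case: ifP => _ h.
  exact: (dp_supl dKL) h yg.
exact: (dp_supr dKL) h yg.
Qed.

Lemma fr_side gr K L T F x y : frame gr K L T F -> x \in gr ->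
  y != x -> F x y != 0 -> (y \in T) = (x \notin T).
Proof.
move=> fr xg yx Fxy; have yg := fr_supp fr xg Fxy.
have := fr_off fr xg yg; rewrite eq_sym yx => /(_ isT).
case: (x \in T); case: (y \in T) => //= h; move: Fxy; rewrite h ?eqxx //.
Qed.

(** The tension [F x] and the flow [F y] have no common support besides [x] and
[y], so their scalar product has just two terms. *)
Lemma fr_anti_half gr K L T F x y : frame gr K L T F ->
  x \in gr -> y \in gr -> x \in T -> y \notin T -> F x y = - F y x.
Proof.
move=> fr xg yg xT yT; have xy : x != y by apply: contraNneq yT => <-.
have Kx := fr_in fr xg; have Ly := fr_in fr yg.
rewrite xT in Kx; rewrite (negbTE yT) in Ly.
have := dp_orth (fr_dual fr) Kx Ly.
rewrite (bigD1 x) //= (bigD1 y) /=; last by rewrite eq_sym.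
rewrite (fr_diag fr xg) (fr_diag fr yg) mul1r mulr1 big1 ?addr0.
  by move/eqP; rewrite addrC addr_eq0 => /eqP.
move=> z /andP[zx zy]; apply/eqP; rewrite mulf_eq0.
apply/norP=> -[Fxz Fyz].
have := fr_side fr xg zx Fxz; have := fr_side fr yg zy Fyz.
by rewrite xT yT => ->.
Qed.

Lemma fr_anti gr K L T F x y : frame gr K L T F ->
  x \in gr -> y \in gr -> x != y -> F x y = - F y x.
Proof.
move=> fr xg yg xy.
have yx : y != x by rewrite eq_sym.
have [same|diff] := eqVneq (x \in T) (y \in T).
  by rewrite (fr_off fr xg yg xy same) (fr_off fr yg xg yx (esym same)) oppr0.
have [xT|xT] := boolP (x \in T).
  by apply: (fr_anti_half fr) => //; move: diff; rewrite xT; case: (y \in T).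
rewrite (fr_anti_half fr yg xg) ?opprK //.
by move: diff; rewrite (negbTE xT); case: (y \in T).
Qed.

Lemma fr_neq0C gr K L T F x y : frame gr K L T F ->
  x \in gr -> y \in gr -> (F x y != 0) = (F y x != 0).
Proof.
move=> fr xg yg; have [->//|xy] := eqVneq x y.
by rewrite (fr_anti fr) // oppr_eq0.
Qed.

(** Orthogonality to [F x] determines the coordinate of [v] at each [x] of [T]
from its coordinates outside [T]; here [e] is the only one of these that may be
nonzero. *)
Lemma fr_coord gr K L T F v : frame gr K L T F -> L v ->
  forall e, e \in gr -> e \notin T ->
  (forall x, x \in gr -> x \notin T -> x != e -> v x = 0) ->
  forall x, v x = v e * F e x.
Proof.
move=> fr Lv e eg eT v0 x.
have [xg|xg] := boolP (x \in gr); last first.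
  have Le := fr_in fr eg; rewrite (negbTE eT) in Le.
  by rewrite (dp_supr (fr_dual fr) Lv xg) (dp_supr (fr_dual fr) Le xg) mulr0.
have [xe|xe] := eqVneq x e; first by rewrite xe (fr_diag fr eg) mulr1.
have [xT|xT] := boolP (x \in T); last first.
  by rewrite v0 // (fr_off fr) ?mulr0 // 1?eq_sym // (negbTE xT) (negbTE eT).
have Kx := fr_in fr xg; rewrite xT in Kx.
have := dp_orth (fr_dual fr) Kx Lv.
rewrite (bigD1 x) //= (bigD1 e) /=; last by rewrite eq_sym.
rewrite (fr_diag fr xg) mul1r big1 ?addr0.
  move/eqP; rewrite addr_eq0 => /eqP->.
  by rewrite (fr_anti fr xg eg xe) mulNr opprK mulrC.
move=> z /andP[zx ze]; apply/eqP; rewrite mulf_eq0.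
apply/norP=> -[Fxz vz]; have zg := fr_supp fr xg Fxz.
have := fr_side fr xg zx Fxz; rewrite xT /= => /negbT zT.
by move: vz; rewrite v0 ?eqxx.
Qed.

Lemma fr_coord0 gr K L T F v : frame gr K L T F -> L v ->
  (forall x, x \in gr -> x \notin T -> v x = 0) -> forall x, v x = 0.
Proof.
move=> fr Lv v0 x.
have [xg|xg] := boolP (x \in gr); last exact: (dp_supr (fr_dual fr) Lv xg).
have [xT|xT] := boolP (x \in T); last exact: v0.
have Kx := fr_in fr xg; rewrite xT in Kx.
have := dp_orth (fr_dual fr) Kx Lv.
rewrite (bigD1 x) //= (fr_diag fr xg) mul1r big1 ?addr0 //.
move=> z zx; apply/eqP; rewrite mulf_eq0; apply/norP=> -[Fxz vz].
have zg := fr_supp fr xg Fxz.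
have := fr_side fr xg zx Fxz; rewrite xT /= => /negbT zT.
by move: vz; rewrite v0 ?eqxx.
Qed.

Lemma frame_eq gr K L T T' F :
  {in gr, T =i T'} -> frame gr K L T F -> frame gr K L T' F.
Proof.
move=> TT' [dKL inF diF ofF]; split=> // [x xg|x y xg yg].
  by rewrite -TT' //; apply: inF.
by rewrite -!TT' //; apply: ofF.
Qed.

End Vectors.

(** * Levels of a basis and directed supports *)

Section Levels.
Local Open Scope ring_scope.
Variables (d : Order.disp_t) (E : finOrderType d).
Implicit Types (x y a e : E) (u v : E -> rat) (K L : (E -> rat) -> Prop).
Implicit Types (T gr : {set E}) (F : E -> E -> rat) (pos : E -> int).

(** Internal activity for [x] in the basis and external activity for the others,
at once. *)
Definition active_in F x := [forall y, (F x y != 0) ==> (x <= y)%O].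

(** The active filtration lists the externally active edges from the largest to
the smallest and then the internally active ones from the smallest to the
largest; signed ranks put them in this order. *)
Definition level T x : int := if x \in T then (rank x)%:Z else - (rank x)%:Z.

(** The parts of the active partition are encoded by the level [pos] of each edge.
The last clause says that the edges of level at most [k] contain the
fundamental cycles of those among them outside [T], so that [T] induces a basis
of the restriction to them.  The middle one keeps a passive edge passive inside its
level. *)
Record levelling gr T F pos : Prop := Levelling {
  lv_active : forall x, x \in gr -> active_in F x -> pos x = level T x;
  lv_passive : forall x, x \in gr -> ~~ active_in F x ->
    exists y, [/\ (y < x)%O, F x y != 0 & pos y = pos x];
  lv_le : forall x y, x \in gr -> y \in gr -> x \in T -> y \notin T ->
    F x y != 0 -> pos x <= pos y }.

(** The sign criterion defining [alpha], read inside each level: in its fundamental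
cycle or cocycle cut down to its level, a passive edge is opposite to the
smallest edge. *)
Definition fitted gr F pos := forall x, x \in gr -> ~~ active_in F x ->
  exists m, [/\ F x m < 0, pos m = pos x &
    forall y, F x y != 0 -> pos y = pos x -> (m <= y)%O].

Lemma level_neq0 T x : level T x != 0.
Proof.
rewrite /level; have := rank_gt0 x; case: ifP => _ h; lia.
Qed.

Lemma levelC T x : level (~: T) x = - level T x.
Proof. by rewrite /level inE; case: (x \in T); rewrite ?opprK. Qed.

Lemma fittedC gr F pos : fitted gr F pos -> fitted gr F (fun x => - pos x).
Proof.
move=> fit x xg xa; have [m [Fm pm mP]] := fit x xg xa.
exists m; split=> //; first by rewrite pm.
by move=> y Fy /oppr_inj; apply: mP.
Qed.

Lemma levellingC gr K L T F pos : frame gr K L T F ->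
  levelling gr T F pos -> levelling gr (~: T) F (fun x => - pos x).
Proof.
move=> fr [act pas le]; split=> [x xg xa|x xg xa|x y xg yg].
- by rewrite levelC act.
- by have [y [yx Fxy <-]] := pas x xg xa; exists y.
rewrite !inE negbK lerN2 => xT yT Fxy; apply: le => //.
by rewrite -(fr_neq0C fr).
Qed.

Lemma levelling_eq gr T T' F pos :
  {in gr, T =i T'} -> levelling gr T F pos -> levelling gr T' F pos.
Proof.
move=> TT' [act pas le]; split=> // [x xg xa|x y xg yg].
  by rewrite act // /level TT'.
by rewrite -!TT' //; apply: le.
Qed.

(** A passive edge has a smaller edge in its level, so descending must stop at an
active edge. *)
Lemma level_active gr K L T F pos x : frame gr K L T F ->
  levelling gr T F pos -> x \in gr ->
  exists a, [/\ a \in gr, active_in F a, (a <= x)%O & pos a = pos x].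
Proof.
move=> fr lv; elim/rank_ind: x => x IH xg.
have [xa|xa] := boolP (active_in F x); first by exists x.
have [y [yx Fxy <-]] := lv_passive lv xg xa.
have [a [ag aa ay pa]] := IH y yx (fr_supp fr xg Fxy).
by exists a; split=> //; apply: le_trans ay (ltW yx).
Qed.

Lemma level_inj gr T F pos a b : levelling gr T F pos ->
  a \in gr -> active_in F a -> b \in gr -> active_in F b ->
  pos a = pos b -> a = b.
Proof.
move=> lv ag aa bg ba; rewrite !(lv_active lv) // /level => ab.
apply: rank_inj; move: ab; have := rank_gt0 a; have := rank_gt0 b.
by do 2 case: ifP => _; lia.
Qed.

Lemma fitted_min gr K L T F pos x : frame gr K L T F -> fitted gr F pos ->
  x \in gr -> ~~ active_in F x ->
  exists m, [/\ m \in gr, m != x, (m \in T) = (x \notin T) &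
    [/\ F x m < 0, pos m = pos x &
    forall y, F x y != 0 -> pos y = pos x -> (m <= y)%O]].
Proof.
move=> fr fit xg xa; have [m [Fm pm mP]] := fit x xg xa.
have mx : m != x by apply: contraTneq Fm => ->; rewrite (fr_diag fr xg).
have Fm0 : F x m != 0 by rewrite lt_eqF.
by exists m; split=> //; [apply: (fr_supp fr xg Fm0) | apply: (fr_side fr xg)].
Qed.

Section Side.
Variables (gr : {set E}) (K L : (E -> rat) -> Prop) (T : {set E}).
Variables (F : E -> E -> rat) (pos : E -> int).
Hypotheses (fr : frame gr K L T F) (lv : levelling gr T F pos).
Hypothesis (fit : fitted gr F pos).


Lemma pos_gt0 a : a \in gr -> active_in F a -> (0 < pos a) = (a \in T).
Proof.
move=> ag aa; rewrite (lv_active lv ag aa) /level; have := rank_gt0 a.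
by case: ifP => _; lia.
Qed.

(** Compose the fundamental vectors of the basis elements of level at least [j],
higher levels first and then smaller elements first.  At [e] outside the
basis, the first one that counts belongs to the smallest element of the
fundamental vector of [e] within the level of [e], where the criterion makes
the sign positive. *)
Lemma upper_level_vector (j : int) : 0 < j ->
  exists u, K u /\ forall e,
    if (e \in gr) && (j <= pos e) then 0 < u e else u e == 0.
Proof.
move=> j0.
pose le : rel E := fun x y => (pos y < pos x) || (pos x == pos y) && (x <= y)%O.
pose S := [pred x | [&& x \in gr, x \in T & j <= pos x]].
pose s := sort le (enum S).
have le_tr : transitive le.
  move=> y x z; rewrite /le => /orP[xy|/andP[/eqP-> xy]] /orP[yz|/andP[/eqP yz' yz]].
  - by rewrite (lt_trans yz xy).
  - by rewrite -yz' xy.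
  - by rewrite yz.
  - by rewrite yz' eqxx (le_trans xy yz) orbT.
have le_tot : total le.
  by move=> x y; rewrite /le; case: ltgtP => //= _; apply: le_total.
have sS x : (x \in s) = S x by rewrite mem_sort mem_enum.
have KF : {in s, forall x, K (F x)}.
  move=> x; rewrite sS /= => /and3P[xg xT _].
  by have := fr_in fr xg; rewrite xT.
have [u [Ku uP]] := lexicographic_vector (dp_linl (fr_dual fr)) le_tr
  (sort_sorted le_tot _) KF.
exists u; split=> // e; have {uP} := uP e.
case: (boolP (e \in gr)) => /= [eg|eg _]; last by rewrite (dp_supl (fr_dual fr) Ku eg).
case: (leP j (pos e)) => je; last first.
  case=> [[-> _]|[i [si ui _]]]; first by rewrite eqxx.
  move: si; rewrite sS => /and3P[ig iT ji].
  have Fie : F i e != 0 by apply: contraTneq ui => ->; rewrite mulr0 ltxx.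
  have ei : e != i by apply: contraTneq je => ->; rewrite -leNgt.
  have eT := fr_side fr ig ei Fie; rewrite iT in eT.
  have := lv_le lv ig eg iT (negbT eT) Fie.
  by move=> /(le_trans ji); rewrite leNgt je.
have [eT|eT] := boolP (e \in T).
  case=> [[_ /(_ e)]|[i [si ui _]]].
    by rewrite sS /= eg eT je (fr_diag fr eg) => /(_ isT)/eqP; rewrite oner_eq0.
  move: si; rewrite sS => /and3P[ig iT ji].
  have Fie : F i e != 0 by apply: contraTneq ui => ->; rewrite mulr0 ltxx.
  suff ie : e = i by move: ui; rewrite -ie (fr_diag fr eg) mulr1.
  apply/eqP; apply: contraTT iT => ei.
  by have := fr_side fr ig ei Fie; rewrite eT => /esym.
have ea : ~~ active_in F e.
  by apply: contra eT => ea; rewrite -(pos_gt0 eg ea) (lt_le_trans j0 je).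
have [m [mg me mT [Fm pm mP]]] := fitted_min fr fit eg ea.
rewrite eT in mT.
have Fme : 0 < F m e by rewrite (fr_anti fr mg eg me) oppr_gt0.
have sm : m \in s by rewrite sS /= mg mT pm je.
case=> [[_ /(_ m sm) Fme0]|[i [si ui iP]]]; first by rewrite Fme0 ltxx in Fme.
suff im : i = m by move: ui; rewrite im pmulr_lgt0.
move: si; rewrite sS => /and3P[ig iT ji].
have Fie : F i e != 0 by apply: contraTneq ui => ->; rewrite mulr0 ltxx.
have pie := lv_le lv ig eg iT eT Fie.
apply: contraTeq Fme => mi; rewrite -leNgt.
have Fme0 : F m e != 0 by rewrite gt_eqF // (fr_anti fr mg eg me) oppr_gt0.
have := iP m sm; rewrite eq_sym => /(_ mi Fme0).
rewrite /le pm ltNge pie /= => /andP[/eqP pi im].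
have /le_anti im' : (i <= m <= i)%O.
  by rewrite im mP // -(fr_neq0C fr ig eg).
by rewrite im' eqxx in mi.
Qed.

(** This vector is the obstruction to directed cocycles: a nonnegative [u] of [K]
whose lowest level is that of [a] must be nonzero at [a], since otherwise
all terms of its product with [v] would be nonnegative and one positive. *)
Lemma nearly_directed_vector a : a \in gr -> active_in F a -> a \in T ->
  exists v, L v /\ forall e, e \in gr ->
    (pos a < pos e -> v e = 0) /\ (pos e = pos a -> e != a -> 0 < v e).
Proof.
move=> ag aa aT.
have pa0 : 0 < pos a by rewrite pos_gt0.
pose S := [pred x | [&& x \in gr, x \notin T & pos x == pos a]].
pose s := sort <=%O (enum S).
have sS x : (x \in s) = S x by rewrite mem_sort mem_enum.
have LF : {in s, forall x, L (F x)}.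
  move=> x; rewrite sS /= => /and3P[xg xT _].
  by have := fr_in fr xg; rewrite (negbTE xT).
have [v [Lv vP]] := lexicographic_vector (dp_linr (fr_dual fr)) le_trans
  (sort_sorted le_total _) LF.
exists v; split=> // e eg; have {vP} H := vP e; split=> pe.
  case: H => [[]//|[i [si vi _]]].
  move: si; rewrite sS => /and3P[ig iT /eqP pi].
  have Fie : F i e != 0 by apply: contraTneq vi => ->; rewrite mulr0 ltxx.
  have ei : e != i by apply: contraTneq pe => ->; rewrite pi ltxx.
  have eT := fr_side fr ig ei Fie; rewrite iT in eT.
  have := lv_le lv eg ig eT iT; rewrite (fr_neq0C fr eg ig) => /(_ Fie).
  by rewrite pi leNgt pe.
move=> ea.
have ena : ~~ active_in F e.
  by apply: contra ea => ea'; apply/eqP; apply: (level_inj lv).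
have [eT|eT] := boolP (e \in T); last first.
  case: H => [[_ /(_ e)]|[i [si vi _]]].
    rewrite sS /= eg eT pe eqxx (fr_diag fr eg) => /(_ isT)/eqP.
    by rewrite oner_eq0.
  move: si; rewrite sS => /and3P[ig iT pi].
  have Fie : F i e != 0 by apply: contraTneq vi => ->; rewrite mulr0 ltxx.
  suff ie : e = i by move: vi; rewrite -ie (fr_diag fr eg) mulr1.
  apply/eqP; apply: contraNT eT => ei.
  by rewrite (fr_side fr ig ei Fie).
have [m [mg me mT [Fm pm mP]]] := fitted_min fr fit eg ena.
rewrite eT in mT.
have Fme : 0 < F m e by rewrite (fr_anti fr mg eg me) oppr_gt0.
have sm : m \in s by rewrite sS /= mg mT pm pe eqxx.
case: H => [[_ /(_ m sm) Fme0]|[i [si vi iP]]]; first by rewrite Fme0 ltxx in Fme.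
suff im : i = m by move: vi; rewrite im pmulr_lgt0.
move: si; rewrite sS => /and3P[ig iT /eqP pi].
have Fie : F i e != 0 by apply: contraTneq vi => ->; rewrite mulr0 ltxx.
apply: contraTeq Fme => mi; rewrite -leNgt.
have Fme0 : F m e != 0 by rewrite gt_eqF // (fr_anti fr mg eg me) oppr_gt0.
have := iP m sm; rewrite eq_sym => /(_ mi Fme0) im.
have /le_anti im' : (i <= m <= i)%O.
  by rewrite im mP // ?pi ?pe // (fr_neq0C fr eg ig).
by rewrite im' eqxx in mi.
Qed.

End Side.

Lemma orth_term0 gr K L u v : dual_pair gr K L -> K u -> L v ->
  (forall f, 0 <= u f * v f) -> forall e, u e * v e == 0.
Proof.
move=> KL Ku Lv uv0 e; have /eqP := dp_orth KL Ku Lv.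
by rewrite psumr_eq0 // => /allP/(_ e); apply; rewrite mem_index_enum.
Qed.

(** What links directed cycles to flows, and directed cocycles to tensions: each
supports a nonnegative vector, and the support of any nonnegative vector is
covered by them. *)
Definition directed_supports K (D : pred {set E}) :=
  (forall C, D C -> exists u, [/\ K u,
      forall e, if e \in C then 0 < u e else u e == 0 & exists e, e \in C]) /\
  (forall u e, K u -> (forall f, 0 <= u f) -> 0 < u e ->
     exists C, [/\ D C, e \in C & forall f, f \in C -> 0 < u f]).

(** At a common edge, the product of the two nonnegative vectors would be
positive. *)
Lemma directed_supports_disjoint gr K L DK DL C D e : dual_pair gr K L ->
  directed_supports K DK -> directed_supports L DL -> DK C -> DL D ->
  e \in C -> e \in D -> False.
Proof.
move=> KL [DKP _] [DLP _] /DKP[u [Ku uP _]] /DLP[v [Lv vP _]] eC eD.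
suff uv0 f : 0 <= u f * v f.
  have := orth_term0 KL Ku Lv uv0 e; apply/negP.
  have := uP e; have := vP e; rewrite eC eD => ve ue.
  by rewrite mulf_neq0 // gt_eqF.
rewrite mulr_ge0 //.
  by have := uP f; case: ifP => _ => [/ltW|/eqP->].
by have := vP f; case: ifP => _ => [/ltW|/eqP->].
Qed.

Section DirectedSide.
Variables (gr : {set E}) (K L : (E -> rat) -> Prop) (T : {set E}).
Variables (F : E -> E -> rat) (pos : E -> int) (DK : pred {set E}).
Hypotheses (fr : frame gr K L T F) (lv : levelling gr T F pos).
Hypotheses (fit : fitted gr F pos) (dirK : directed_supports K DK).

Lemma level_le a b : a \in gr -> active_in F a -> a \in T ->
  b \in gr -> active_in F b -> (pos a <= pos b) = (b \in T) && (a <= b)%O.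
Proof.
move=> ag aa aT bg ba; rewrite !(lv_active lv) // /level aT -rank_le.
have := rank_gt0 a; have := rank_gt0 b; case: ifP => _ /=; lia.
Qed.

Lemma pos_neq0 e : e \in gr -> pos e != 0.
Proof.
move=> eg; have [a [ag aa _ <-]] := level_active fr lv eg.
by rewrite (lv_active lv) // level_neq0.
Qed.

(** Elements of negative level are excluded by the nonnegative vector of [L]
supported there, obtained from the dual frame.  In the lowest level met by [C],
the active element [a] belongs to [C], and it is smaller than everything of
higher level. *)
Lemma directed_min C : DK C -> exists a,
  [/\ a \in gr, a \in T, active_in F a, a \in C &
   forall e, e \in C -> [/\ e \in gr, pos a <= pos e & (a <= e)%O]].
Proof.
move=> /dirK.1[u [Ku uP [e0 e0C]]].
have u0 f : 0 <= u f by have := uP f; case: ifP => _ => [/ltW|/eqP->].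
have uC f : (f \in C) = (u f != 0).
  by have := uP f; case: ifP => _ => [/lt0r_neq0->|/eqP->]; rewrite ?eqxx.
have Cg f : f \in C -> f \in gr.
  by rewrite uC; apply: contraR => fg; rewrite (dp_supl (fr_dual fr) Ku fg).
have posC f : f \in C -> 0 < pos f.
  move=> fC; rewrite ltNge; apply/negP => pf.
  have pf' : 1 <= - pos f by have := pos_neq0 (Cg f fC); lia.
  have [v [Lv vP]] := upper_level_vector (frameC fr) (levellingC fr lv)
    (fittedC fit) (ltr01 : (0 < 1 :> int)).
  have v0 g : 0 <= v g.
    by have := vP g; case: ifP => _ => [/ltW|/eqP->].
  have uv0 g : 0 <= u g * v g by rewrite mulr_ge0.
  have := orth_term0 (fr_dual fr) Ku Lv uv0 f; apply/negP.
  by rewrite mulf_neq0 -?uC //; have := vP f; rewrite (Cg f fC) pf' => /lt0r_neq0.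
case: (arg_minP (pos : E -> int) e0C) => e eC eP {e0 e0C}.
have [a [ag aa ae pa]] := level_active fr lv (Cg e eC).
have aT : a \in T by rewrite -(pos_gt0 lv ag aa) pa posC.
exists a; split=> // [|f fC].
  have [v [Lv vP]] := nearly_directed_vector fr lv fit ag aa aT.
  apply: contraT => aC; have ua : u a = 0 by apply/eqP; move: aC; rewrite uC negbK.
  have ea : e != a by apply: contraNneq aC => <-.
  suff uv0 g : 0 <= u g * v g.
    have := orth_term0 (fr_dual fr) Ku Lv uv0 e; apply: contraLR => _.
    by rewrite mulf_neq0 -?uC // gt_eqF // (vP e (Cg e eC)).2.
  have [gC|] := boolP (g \in C); last first.
      by rewrite uC negbK => /eqP->; rewrite mul0r.
    have [->|ga] := eqVneq g a; first by rewrite ua mul0r.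
    have := eP g gC; rewrite le_eqVlt => /orP[/eqP pg|pg].
      by rewrite mulr_ge0 // ltW // (vP g (Cg g gC)).2 // pa.
    by rewrite (vP g (Cg g gC)).1 ?mulr0 // pa.
have pf : pos a <= pos f by rewrite pa; apply: eP.
split=> //; first exact: Cg.
have [b [bg ba bf pb]] := level_active fr lv (Cg f fC).
by apply: le_trans bf; move: pf; rewrite -pb level_le // => /andP[].
Qed.

(** For tensions this equates dual-activity with internal activity; for flows, by
way of the dual frame, activity with external activity. *)
Lemma directed_is_min a :
  (exists2 C, DK C & is_min a C) <-> [&& a \in gr, a \in T & active_in F a].
Proof.
split=> [[C DC /andP[aC /'forall_implyP aP]]|/and3P[ag aT aa]].
  have [b [bg bT ba bC bP]] := directed_min DC.
  have -> : a = b; last by rewrite bg bT ba.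
  by apply/le_anti; rewrite aP //; case: (bP a aC).
have pa : 0 < pos a by rewrite (pos_gt0 lv ag aa).
have [u [Ku uP]] := upper_level_vector fr lv fit pa.
have [|||C [DC aC CP]] := dirK.2 u a; rewrite //.
- by move=> f; have := uP f; case: ifP => _ => [/ltW|/eqP->].
- by have := uP a; rewrite ag lexx.
exists C => //; rewrite /is_min aC; apply/'forall_implyP => f /CP uf.
have := uP f; case: ifP => [/andP[fg pf] _|_ /eqP uf0]; last first.
  by rewrite uf0 ltxx in uf.
have [b [bg ba bf pb]] := level_active fr lv fg.
by apply: le_trans bf; move: pf; rewrite -pb level_le // => /andP[].
Qed.

(** This identifies the sets of the active filtration with unions of levels. *)
Lemma directed_cover a e : a \in gr -> a \in T -> active_in F a ->
  (exists C, [/\ DK C, e \in C & min_ge a C]) <-> (e \in gr) && (pos a <= pos e).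
Proof.
move=> ag aT aa; split=> [[C [DC eC]]|/andP[eg pe]].
  case/existsP=> m /andP[/andP[mC /'forall_implyP mP] am].
  have [b [bg bT ba bC bP]] := directed_min DC.
  have [-> pbe _] := bP e eC; apply: le_trans pbe.
  by rewrite level_le // bT (le_trans am) // mP.
have pa : 0 < pos a by rewrite (pos_gt0 lv ag aa).
have [u [Ku uP]] := upper_level_vector fr lv fit pa.
have [|||C [DC eC CP]] := dirK.2 u e; rewrite //.
- by move=> f; have := uP f; case: ifP => _ => [/ltW|/eqP->].
- by have := uP e; rewrite eg pe.
exists C; split=> //; have [b [bg bT ba bC bP]] := directed_min DC.
apply/existsP; exists b; rewrite /is_min bC; apply/andP; split.
  by apply/'forall_implyP => f /bP[].
have := uP b; case: ifP => [/andP[_ pb] _|_ /eqP ub0]; last first.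
  by have := CP b bC; rewrite ub0 ltxx.
by move: pb; rewrite level_le // => /andP[].
Qed.

End DirectedSide.
End Levels.

(** * Uniqueness of the fully optimal basis *)

Section Frames.
Local Open Scope ring_scope.
Variables (d : Order.disp_t) (E : finOrderType d).
Implicit Types (x y a e : E) (u v : E -> rat) (K L : (E -> rat) -> Prop).
Implicit Types (T A B S gr : {set E}) (F : E -> E -> rat) (pos : E -> int).

Definition opposed F x :=
  exists m, F x m < 0 /\ forall y, F x y != 0 -> (m <= y)%O.

Lemma opposed_leading gr K L T F x (m := [arg min_(y < x | F x y != 0) y]%O) :
  frame gr K L T F -> x \in gr -> opposed F x ->
  [/\ F x m < 0, (m < x)%O, m \in gr, (m \in T) = (x \notin T) &
      forall y, F x y != 0 -> (m <= y)%O].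
Proof.
move=> fr xg [z [Fz zP]].
have Fxx : F x x != 0 by rewrite (fr_diag fr xg) oner_eq0.
rewrite /m; case: arg_minP => // y Fy yP {m}.
have yz : y = z by apply/le_anti; rewrite yP ?zP // lt_eqF.
have yx : y != x.
  by apply: contraTneq Fz => yx; rewrite -yz yx (fr_diag fr xg) ltr10.
split=> //; first by rewrite yz.
- by rewrite lt_neqAle yx yP.
- exact: (fr_supp fr xg Fy).
exact: (fr_side fr xg yx Fy).
Qed.

Section TwoFrames.
Variables (gr : {set E}) (K L : (E -> rat) -> Prop).
Variables (T T' : {set E}) (F F' : E -> E -> rat).
Hypotheses (fr : frame gr K L T F) (fr' : frame gr K L T' F').

Let delta f := (f \in gr) && ((f \in T) != (f \in T')).
Let U f := if f \in T then F f else F' f.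
Let W f := if f \in T then F' f else F f.

(** For edges [e], [b] on which the two bases agree, expand
[<F' b, F e> + <F b, F' e> = 0].  The terms at [e] and at [b] cancel by
antisymmetry, and the others live on the symmetric difference of the bases. *)
Lemma difference_sum_eq0 e b : e \in gr -> b \in gr ->
  e \notin T -> e \notin T' -> b \in T -> b \in T' ->
  \sum_(f | delta f) U f e * W f b = 0.
Proof.
move=> eg bg eT eT' bT bT'.
have eb : e != b by apply: contraNneq eT => ->.
have be : b != e by rewrite eq_sym.
have KFb := fr_in fr bg; rewrite bT in KFb.
have KF'b := fr_in fr' bg; rewrite bT' in KF'b.
have LFe := fr_in fr eg; rewrite (negbTE eT) in LFe.
have LF'e := fr_in fr' eg; rewrite (negbTE eT') in LF'e.
have := congr2 +%R (dp_orth (fr_dual fr) KF'b LFe) (dp_orth (fr_dual fr) KFb LF'e).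
rewrite addr0 -big_split /= (bigD1 b) //= (bigD1 e) //=.
rewrite !(fr_diag fr, fr_diag fr') // !mul1r !mulr1.
rewrite (fr_anti fr bg eg be) (fr_anti fr' bg eg be).
rewrite (_ : forall r : rat, F e b + F' e b + (- F' e b + - F e b + r) = r);
  last by move=> r; ring.
move=> sum0; rewrite -[RHS]sum0; rewrite big_mkcond [RHS]big_mkcond /=.
apply: eq_bigr => y _; rewrite /delta.
have [->|yb] := eqVneq y b; first by rewrite bT bT' andbF.
have [->|ye] := eqVneq y e; first by rewrite (negbTE eT) (negbTE eT') andbF.
have [yg|yg] := boolP (y \in gr); last first.
  by rewrite /= (dp_supl (fr_dual fr) KF'b yg) (dp_supl (fr_dual fr) KFb yg) !mul0r addr0.
rewrite /U /W; have by' : b != y by rewrite eq_sym.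
have ey' : e != y by rewrite eq_sym.
have off := fr_off fr; have off' := fr_off fr'.
case yT: (y \in T); case yT': (y \in T') => /=.
- by rewrite (off b y) ?(off' b y) ?mul0r ?addr0 // ?bT ?bT' ?yT ?yT'.
- rewrite (off b y) ?bT ?yT // mul0r addr0.
  by rewrite (fr_anti fr' bg yg by') (fr_anti fr eg yg ey') mulrNN mulrC.
- rewrite (off' b y) ?bT' ?yT' // mul0r add0r.
  by rewrite (fr_anti fr bg yg by') (fr_anti fr' eg yg ey') mulrNN mulrC.
by rewrite (off e y) ?(off' e y) ?mulr0 ?addr0 // ?yT ?yT' ?(negbTE eT) ?(negbTE eT').
Qed.

Hypotheses (opp : forall f, delta f -> opposed F f).
Hypotheses (opp' : forall f, delta f -> opposed F' f).

(** Let [g] be the smallest element of the symmetric difference.  Each [f] in it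
has a vector in each space; call [n f] and [m f] their first elements, where
the vectors are negative.  Among the [f] with [n f, m f < g], of which [g] is
one, take the smallest [n f] and then the smallest [m f]: at this pair, the
sum of [difference_sum_eq0] has nonnegative terms and a positive one. *)
Lemma opposed_frames_eq x : x \in gr -> (x \in T) = (x \in T').
Proof.
move=> xg; apply/eqP; apply: contraT => xTT'.
have dx : delta x by rewrite /delta xg.
case: (arg_minP id dx) => g dg gP {x xg xTT' dx}.
have side f : (f < g)%O -> f \in gr -> (f \in T) = (f \in T').
  move=> fg fgr; apply/eqP; apply: contraTT fg => fTT'.
  by rewrite -leNgt gP // /delta fgr.
have dgr f : delta f -> f \in gr by case/andP.
have dT f : delta f -> (f \in T') = (f \notin T).
  by case/andP=> _; case: (f \in T); case: (f \in T').
pose n f := [arg min_(y < f | U f y != 0) y]%O.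
pose m f := [arg min_(y < f | W f y != 0) y]%O.
have nP f : delta f -> [/\ U f (n f) < 0, (n f < f)%O,
    (n f \in gr), (n f < g -> n f \notin T)%O &
    forall y, U f y != 0 -> (n f <= y)%O].
  move=> df; have fg := dgr f df; rewrite /n /U; case: ifP => fT.
    have [Fn nf ng nT nle] := opposed_leading fr fg (opp df).
    by split=> // _; rewrite nT fT.
  have [Fn nf ng nT nle] := opposed_leading fr' fg (opp' df).
  by split=> // nlg; rewrite side // nT dT // fT.
have mP f : delta f -> [/\ W f (m f) < 0, (m f < f)%O,
    (m f \in gr), (m f < g -> m f \in T)%O &
    forall y, W f y != 0 -> (m f <= y)%O].
  move=> df; have fg := dgr f df; rewrite /m /W; case: ifP => fT.
    have [Fm mf mg mT mle] := opposed_leading fr' fg (opp' df).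
    by split=> // mlg; rewrite side // mT dT // fT.
  have [Fm mf mg mT mle] := opposed_leading fr fg (opp df).
  by split=> // _; rewrite mT fT.
pose S f := [&& delta f, (n f < g)%O & (m f < g)%O].
have Sg : S g by have [_ h _ _ _] := nP g dg; have [_ h' _ _ _] := mP g dg; apply/and3P.
case: (arg_minP n Sg) => f1 Sf1 f1P.
have S1 : S f1 && (n f1 == n f1) by rewrite Sf1 eqxx.
case: (@arg_minP _ _ _ f1 (fun f => S f && (n f == n f1)) m S1).
move=> f /andP[/and3P[df nfg mfg] /eqP nf] fP.
have [Un _ ng nT nle] := nP f df; have [Wm _ mg mT mle] := mP f df.
have nT' : n f \notin T' by rewrite -side // nT.
have mT' : m f \in T' by rewrite -side // mT.
have /eqP := difference_sum_eq0 ng mg (nT nfg) nT' (mT mfg) mT'.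
rewrite psumr_eq0 => [/allP/(_ f)|h dh].
  by rewrite mem_index_enum df implyTb mulf_eq0 !lt_eqF // => /(_ isT).
have [->|Uh] := eqVneq (U h (n f)) 0; first by rewrite mul0r.
have [->|Wh] := eqVneq (W h (m f)) 0; first by rewrite mulr0.
have [Unh _ _ _ nleh] := nP h dh; have [Wmh _ _ _ mleh] := mP h dh.
have Sh : S h by rewrite /S dh (le_lt_trans (nleh _ Uh)) // (le_lt_trans (mleh _ Wh)).
have nh : n h = n f.
  by apply/le_anti; rewrite nleh // nf f1P.
have mh : m h = m f.
  by apply/le_anti; rewrite mleh // fP // Sh nh nf eqxx.
by rewrite -nh -mh ltW // nmulr_rgt0.
Qed.

End TwoFrames.

(** * Existence of bases, levels and fitted directions *)

(** Pivoting on the entry [(x, y)]: the new vectors of [x] and [y] are rescaled old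
ones, and each other vector is corrected by the pivot vector of its own
space. *)
Lemma frame_exchange gr K L T F x y : frame gr K L T F ->
  x \in gr -> y \in gr -> x \in T -> y \notin T -> F x y != 0 ->
  exists F', frame gr K L (y |: T :\ x) F'.
Proof.
move=> fr xg yg xT yT Fxy.
have xy : x != y by apply: contraNneq yT => <-.
have Fyx : F y x != 0 by rewrite -(fr_neq0C fr).
exists (fun z t => if z == y then (F x y)^-1 * F x t else
  if z == x then (F y x)^-1 * F y t else
  if z \in T then - (F z y / F x y) * F x t + F z t
  else - (F z x / F y x) * F y t + F z t).
have [K0 linK] := dp_linl (fr_dual fr).
have [L0 linL] := dp_linr (fr_dual fr).
have KFx := fr_in fr xg; rewrite xT in KFx.
have LFy := fr_in fr yg; rewrite (negbTE yT) in LFy.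
split=> [|z zg|z zg|z t zg tg zt].
- exact: fr_dual fr.
- rewrite !inE; have [zy|zy] /= := eqVneq z y.
    by apply: linK KFx K0 _ => e; rewrite addr0.
  have [zx|zx] /= := eqVneq z x.
    by apply: linL LFy L0 _ => e; rewrite addr0.
  have := fr_in fr zg; case: ifP => _ h; first exact: linK KFx h _.
  exact: linL LFy h _.
- have [->|zy] /= := eqVneq z y; first by rewrite mulVf.
  have [->|zx] /= := eqVneq z x; first by rewrite mulVf.
  rewrite (fr_diag fr zg); case: ifP => zT.
    by rewrite (fr_off fr xg zg) ?mulr0 ?add0r // ?zT ?xT // eq_sym.
  by rewrite (fr_off fr yg zg) ?mulr0 ?add0r // ?zT ?(negbTE yT) // eq_sym.
rewrite !inE; have off := fr_off fr.
have [zy|zy] /= := eqVneq z y.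
  rewrite -zy (eq_sym t z) (negbTE zt) /= => /esym/andP[tx tT].
  by rewrite (off x t) ?mulr0 ?xT ?tT // eq_sym.
have [zx|zx] /= := eqVneq z x.
  rewrite -zx (eq_sym t z) zt /= => /esym/negbT/norP[ty tT].
  by rewrite (off y t) ?mulr0 ?(negbTE tT) ?(negbTE yT) // eq_sym.
have [ty|ty] /= := eqVneq t y.
  move=> zT; rewrite zT ty mulNr divfK // addNr //.
have [tx|tx] /= := eqVneq t x.
  by move=> zT; rewrite zT tx mulNr divfK // addNr.
move=> zT; case: ifP => zT'; rewrite zT' in zT.
  by rewrite (off x t) ?(off z t) ?mulr0 ?addr0 ?zT' // 1?eq_sym // xT.
by rewrite (off y t) ?(off z t) ?mulr0 ?addr0 ?zT' // 1?eq_sym // (negbTE yT).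
Qed.

(** Binary encoding of the lexicographic comparison of the sets where [T] and [B]
differ, larger elements weighing more. *)
Definition defect gr T (B : {set E}) :=
  (\sum_x [&& x \in gr & (x \in T) != (x \in B)] * 2 ^ rank x)%N.

Lemma defect_decreases gr T T' B x y : x \in gr -> (x \in T) != (x \in B) ->
  (y < x)%O -> (x \in T') = ~~ (x \in T) ->
  (forall z, z != x -> z != y -> (z \in T') = (z \in T)) ->
  (defect gr T' B < defect gr T B)%N.
Proof.
move=> xg xTB yx xT' same; rewrite /defect.
have yx' : y != x by rewrite lt_eqF.
rewrite (bigD1 x) // (bigD1 y) //= [X in (_ < X)%N](bigD1 x) // (bigD1 y) //=.
rewrite (eq_bigr (fun z => [&& z \in gr & (z \in T) != (z \in B)] * 2 ^ rank z)%N);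
  last by move=> z /andP[zx zy]; rewrite same.
have -> : (x \in T') != (x \in B) = false.
  by rewrite xT'; move: xTB; case: (x \in T); case: (x \in B).
rewrite xg xTB andbF mul0n mul1n add0n !addnA ltn_add2r.
apply: leq_ltn_trans (_ : 2 ^ rank y < _)%N; first by case: andb; rewrite ?mul1n.
by apply: ltn_addr; rewrite ltn_exp2l // rank_lt.
Qed.

(** Every [B] lies in the interval of some basis.  If a basis [T] differs from [B]
at a passive [x], then exchanging [x] with a smaller [y] repairs [x] and
disturbs only [y], which decreases the defect. *)
Lemma frame_near gr K L T0 F0 B : frame gr K L T0 F0 -> T0 \subset gr ->
  exists T F, [/\ frame gr K L T F, T \subset gr &
    forall x, x \in gr -> (x \in T) != (x \in B) -> active_in F x].
Proof.
have [n] := ubnP (defect gr T0 B); elim: n T0 F0 => // n IH T F /ltnSE dn fr Tg.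
case: (pickP (fun x => [&& x \in gr, (x \in T) != (x \in B) & ~~ active_in F x])).
  move=> x /and3P[xg xTB]; rewrite negb_forall => /existsP[y].
  rewrite negb_imply -ltNge => /andP[Fxy yx].
  have yg := fr_supp fr xg Fxy; have yx' : y != x by rewrite lt_eqF.
  have yT := fr_side fr xg yx' Fxy.
  have [xT|xT] := boolP (x \in T); rewrite ?xT ?(negbTE xT) /= in yT.
    have [F' fr'] := frame_exchange fr xg yg xT (negbT yT) Fxy.
    apply: (IH _ _ _ fr').
      apply: leq_trans dn; apply: (defect_decreases xg xTB yx).
        by rewrite !inE eqxx xT eq_sym (negbTE yx').
      by move=> z zx zy; rewrite !inE (negbTE zx) (negbTE zy).
    apply/subsetP=> z; rewrite !inE => /orP[/eqP->//|/andP[_]].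
    exact: (subsetP Tg).
  have Fyx : F y x != 0 by rewrite -(fr_neq0C fr).
  have [F' fr'] := frame_exchange fr yg xg yT xT Fyx.
  apply: (IH _ _ _ fr').
    apply: leq_trans dn; apply: (defect_decreases xg xTB yx).
      by rewrite !inE eqxx xT.
    by move=> z zx zy; rewrite !inE (negbTE zx) (negbTE zy).
  apply/subsetP=> z; rewrite !inE => /orP[/eqP->//|/andP[_]].
  exact: (subsetP Tg).
move=> none; exists T, F; split=> // x xg xTB.
by have := none x; rewrite xg xTB => /negbFE.
Qed.

(** A passive element of the basis takes the lowest level found among the smaller
elements of its vector, and a passive element outside takes the highest.  The
inequality between [x] and [y] then holds by construction at the larger of the two, which
is passive as its vector contains the smaller one. *)
Lemma levelling_exists gr K L T F : frame gr K L T F ->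
  exists pos, levelling gr T F pos.
Proof.
move=> fr.
pose Q x (pos : E -> int) := x \in gr ->
  (active_in F x -> pos x = level T x) /\
  (~~ active_in F x -> (exists y, [/\ (y < x)%O, F x y != 0 & pos y = pos x]) /\
     forall y, (y < x)%O -> F x y != 0 ->
       if x \in T then pos x <= pos y else pos y <= pos x).
have [||pos posP] := greedy (0 : int) (Q := Q).
- move=> x f g fg Qf xg; have [act pas] := Qf xg; split=> [/act <-|/pas].
    by rewrite (fg x (lexx x)).
  case=> -[y [yx Fy py]] yP; split; last first.
    by move=> z zx Fz; rewrite -(fg x (lexx x)) -(fg z (ltW zx)); apply: yP.
  by exists y; rewrite -(fg x (lexx x)) -(fg y (ltW yx)).
- move=> x pos; have [xa|xa] := boolP (active_in F x).
    by exists (level T x) => _; rewrite eqxx xa; split.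
  have := xa; rewrite negb_forall => /existsP[y0].
  rewrite negb_imply -ltNge => /andP[Fy0 y0x].
  have [y1 [y1x Fy1 y1P]] : exists y1, [/\ (y1 < x)%O, F x y1 != 0 &
      forall y, (y < x)%O -> F x y != 0 ->
        if x \in T then pos y1 <= pos y else pos y <= pos y1].
    have P0 : (y0 < x)%O && (F x y0 != 0) by rewrite y0x.
    case: (x \in T).
      case: (@arg_minP _ _ _ y0 (fun y => (y < x)%O && (F x y != 0)) pos P0).
      by move=> y1 /andP[? ?] h; exists y1; split=> // y ? ?; apply: h; apply/andP.
    case: (@arg_maxP _ _ _ y0 (fun y => (y < x)%O && (F x y != 0)) pos P0).
    by move=> y1 /andP[? ?] h; exists y1; split=> // y ? ?; apply: h; apply/andP.
  exists (pos y1) => _; rewrite (negbTE xa) eqxx; split=> // _; split.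
    by exists y1; rewrite (lt_eqF y1x).
  by move=> y yx Fy; rewrite (lt_eqF yx); apply: y1P.
exists pos; split=> [x xg xa|x xg xa|x y xg yg xT yT Fxy].
- exact: (posP x xg).1.
- exact: ((posP x xg).2 xa).1.
have xy : x != y by apply: contraNneq yT => <-.
have Fyx : F y x != 0 by rewrite -(fr_neq0C fr).
case: (ltgtP x y) xy => // xy _.
  have ya : ~~ active_in F y.
    by rewrite negb_forall; apply/existsP; exists x; rewrite Fyx -ltNge.
  by have := ((posP y yg).2 ya).2 x xy Fyx; rewrite (negbTE yT).
have xa : ~~ active_in F x.
  by rewrite negb_forall; apply/existsP; exists y; rewrite Fxy -ltNge.
by have := ((posP x xg).2 xa).2 y xy Fxy; rewrite xT.
Qed.

Definition flip (A : {set E}) x : rat := if x \in A then -1 else 1.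
(** The effect on the fundamental vectors of reversing the edges of [A]. *)
Definition twist (A : {set E}) F x y := flip A x * flip A y * F x y.

Lemma flip_mulxx A x : flip A x * flip A x = 1.
Proof. by rewrite /flip; case: ifP; rewrite ?mulrNN mulr1. Qed.

Lemma flip_neq0 A x : flip A x != 0.
Proof. by rewrite /flip; case: ifP; rewrite ?oppr_eq0 oner_eq0. Qed.

Lemma twist_neq0 A F x y : (twist A F x y != 0) = (F x y != 0).
Proof. by rewrite /twist !mulf_eq0 !(negbTE (flip_neq0 _ _)). Qed.

Lemma active_twist A F x : active_in (twist A F) x = active_in F x.
Proof. by apply: eq_forallb => y; rewrite twist_neq0. Qed.

Lemma levelling_twist A gr T F pos :
  levelling gr T F pos -> levelling gr T (twist A F) pos.
Proof.
case=> act pas le; split=> [x|x xg|x y xg yg xT yT]; rewrite ?active_twist.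
- exact: act.
- by move=> /(pas x xg)[y yP]; exists y; rewrite twist_neq0.
by rewrite twist_neq0; apply: le.
Qed.

Lemma frame_twist A gr K L K' L' T F : dual_pair gr K' L' ->
  (forall u, K u -> K' (fun e => flip A e * u e)) ->
  (forall u, L u -> L' (fun e => flip A e * u e)) ->
  frame gr K L T F -> frame gr K' L' T (twist A F).
Proof.
move=> dp KK' LL' fr; have [K0 linK] := dp_linl dp; have [L0 linL] := dp_linr dp.
split=> // [x xg|x xg|x y xg yg xy same].
- have := fr_in fr xg; case: ifP => _ => [/KK' Kx|/LL' Lx].
    by apply: linK Kx K0 _ => e; rewrite /twist addr0 mulrA.
  by apply: linL Lx L0 _ => e; rewrite /twist addr0 mulrA.
- by rewrite /twist flip_mulxx (fr_diag fr xg) mulr1.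
by rewrite /twist (fr_off fr xg yg xy same) mulr0.
Qed.

(** The element to which a passive [x] must be opposed is smaller than [x], so its
direction is known when that of [x] is chosen; active elements are free. *)
Lemma fitted_exists gr K L T F pos (S : {set E}) : frame gr K L T F ->
  levelling gr T F pos -> exists A : {set E},
   fitted gr (twist A F) pos /\
   forall x, x \in gr -> active_in F x -> (x \in A) = (x \in S).
Proof.
move=> fr lv.
pose sg (b : bool) : rat := if b then -1 else 1.
pose Q x (s : E -> bool) := x \in gr ->
  (active_in F x -> s x = (x \in S)) /\
  (~~ active_in F x -> exists m, [/\ (m < x)%O, sg (s x) * sg (s m) * F x m < 0,
    pos m = pos x & forall y, F x y != 0 -> pos y = pos x -> (m <= y)%O]).
have [||s sP] := greedy false (Q := Q).
- move=> x f g fg Qf xg; have [act pas] := Qf xg; split=> [/act <-|/pas].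
    by rewrite (fg x (lexx x)).
  by case=> m [mx Fm pm mP]; exists m; rewrite -(fg x (lexx x)) -(fg m (ltW mx)).
- move=> x s; have [xg|xg] := boolP (x \in gr); last by exists false => xg'; rewrite xg' in xg.
  have [xa|xa] := boolP (active_in F x).
    by exists (x \in S) => _; rewrite eqxx xa; split.
  have [y0 [y0x Fy0 py0]] := lv_passive lv xg xa.
  have P0 : (F x y0 != 0) && (pos y0 == pos x) by rewrite Fy0 py0 eqxx.
  case: (@arg_minP _ _ _ y0 (fun y => (F x y != 0) && (pos y == pos x)) id P0).
  move=> m /andP[Fm /eqP pm] mP; have mx : (m < x)%O.
    by apply: le_lt_trans y0x; apply: mP.
  exists (s m (+) (0 < F x m)) => _; rewrite (negbTE xa); split=> // _.
  exists m; rewrite eqxx (lt_eqF mx); split=> //; last first.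
    by move=> y Fy py; apply: mP; rewrite Fy py eqxx.
  rewrite /sg; case: (ltgtP (F x m) 0) Fm => // Fm _; case: (s m) => /=; lra.
exists [set x | s x]; split=> [x xg xa|x xg xa]; last first.
  by rewrite inE; apply: (sP x xg).1.
rewrite active_twist in xa; have [m [mx Fm pm mP]] := (sP x xg).2 xa.
exists m; split=> //; first by rewrite /twist /flip !inE.
by move=> y; rewrite twist_neq0; apply: mP.
Qed.

(** * The frame induced on one level *)

Section OneLevel.
Variables (gr : {set E}) (K L K' L' : (E -> rat) -> Prop) (T : {set E}).
Variables (F : E -> E -> rat) (pos : E -> int) (k : int).
Hypotheses (fr : frame gr K L T F) (lv : levelling gr T F pos).
Hypothesis (fit : fitted gr F pos).

Definition level_set := [set e in gr | pos e == k].
Definition cutoff (u : E -> rat) e := if e \in level_set then u e else 0.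
Let X := level_set.
Let FX x := cutoff (F x).

Hypothesis dpX : dual_pair X K' L'.
Hypothesis (KX : forall x, x \in X -> x \in T -> K' (FX x)).
Hypothesis (LX : forall x, x \in X -> x \notin T -> L' (FX x)).

Lemma level_setP x : x \in X -> x \in gr /\ pos x = k.
Proof. by rewrite inE => /andP[-> /eqP]. Qed.

Lemma frame_level : frame X K' L' T FX.
Proof.
split=> // [x xX|x xX|x y xX yX xy same].
- by case: ifPn; [apply: KX | apply: LX].
- by rewrite /FX /cutoff xX (fr_diag fr) //; case: (level_setP xX).
rewrite /FX /cutoff; case: ifP => // _.
by rewrite (fr_off fr) //; [case: (level_setP xX) | case: (level_setP yX)].
Qed.

Lemma FX_neq0 x y : (FX x y != 0) = (y \in X) && (F x y != 0).
Proof. by rewrite /FX /cutoff; case: (y \in level_set); rewrite ?eqxx. Qed.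

Lemma active_level x : x \in X -> active_in FX x = active_in F x.
Proof.
move=> xX; have [xg px] := level_setP xX; apply/idP/idP => /forallP xa.
  apply: contraT => /(lv_passive lv xg)[y [yx Fy py]].
  have := xa y; rewrite FX_neq0 Fy andbT inE (fr_supp fr xg Fy) py px eqxx /=.
  by rewrite leNgt yx.
by apply/forallP=> y; apply/implyP; rewrite FX_neq0 => /andP[_]; apply/implyP.
Qed.

Lemma levelling_level : levelling X T FX pos.
Proof.
split=> [x xX|x xX|x y xX yX xT yT _]; last first.
- by have [_ ->] := level_setP xX; have [_ ->] := level_setP yX.
- have [xg px] := level_setP xX; rewrite active_level // => xa.
  have [y [yx Fy py]] := lv_passive lv xg xa; exists y; split=> //.
  by rewrite FX_neq0 Fy inE (fr_supp fr xg Fy) py px eqxx.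
rewrite active_level //; apply: (lv_active lv); by case: (level_setP xX).
Qed.

Lemma fitted_level : fitted X FX pos.
Proof.
move=> x xX; have [xg px] := level_setP xX; rewrite active_level // => xa.
have [m [mg mx mT [Fm pm mP]]] := fitted_min fr fit xg xa.
exists m; split=> //; last first.
  by move=> y; rewrite FX_neq0 => /andP[_]; apply: mP.
by rewrite /FX /cutoff inE mg pm px eqxx.
Qed.

Lemma opposed_level x : x \in X -> ~~ active_in F x -> opposed FX x.
Proof.
move=> xX; rewrite -active_level // => /(fitted_level xX)[m [Fm _ mP]].
exists m; split=> // y Fy; apply: mP => //.
move: Fy; rewrite FX_neq0 => /andP[yX _].
by have [_ ->] := level_setP xX; have [_ ->] := level_setP yX.
Qed.

End OneLevel.

End Frames.

(** * Flows and tensions of a digraph *)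

Section FlowsTensions.
Local Open Scope ring_scope.
Variables (d : Order.disp_t) (V : finType) (E : finOrderType d).
Implicit Types (G : multigraph V E) (w : orientation E).
Implicit Types (C D S T A X : {set E}) (U : {set V}) (e f : E) (u : E -> rat).

Definition origin G w e := endpoint G e (w e).
Definition terminus G w e := endpoint G e (~~ w e).

(** Coordinates are taken along [w], so that directed cycles give nonnegative
vectors. *)
Definition flow G w u := (forall e, e \notin edges G -> u e = 0) /\
  forall v, \sum_e u e * ((origin G w e == v)%:R - (terminus G w e == v)%:R) = 0.

Definition tension G w u := exists h : V -> rat, forall e,
  u e = if e \in edges G then h (origin G w e) - h (terminus G w e) else 0.

Lemma flow_linear G w : linear_space (flow G w).
Proof.
split; first by split=> // v; rewrite big1 // => e _; rewrite mul0r.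
move=> a u v z [u0 us] [v0 vs] zE; split=> [e eG|x].
  by rewrite zE u0 ?v0 // mulr0 addr0.
pose D e : rat := (origin G w e == x)%:R - (terminus G w e == x)%:R.
transitivity (a * (\sum_e u e * D e) + \sum_e v e * D e).
  rewrite mulr_sumr -big_split /=; apply: eq_bigr => e _.
  by rewrite zE mulrDl mulrA.
by rewrite us vs mulr0 addr0.
Qed.

Lemma tension_linear G w : linear_space (tension G w).
Proof.
split; first by exists (fun=> 0) => e; rewrite subrr if_same.
move=> a u v z [h hE] [k kE] zE; exists (fun x => a * h x + k x) => e.
rewrite zE hE kE; case: ifP => _; ring.
Qed.

Lemma tension_flow_orthogonal G w : orthogonal_spaces (tension G w) (flow G w).
Proof.
move=> u v [h hE] [v0 vs].
rewrite (eq_bigr (fun e => \sum_x h x * (v e *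
   ((origin G w e == x)%:R - (terminus G w e == x)%:R)))).
  rewrite exchange_big big1 //= => x _.
  by rewrite -mulr_sumr vs mulr0.
move=> e _; rewrite hE; case: ifPn => eG; last first.
  by rewrite mul0r big1 // => x _; rewrite v0 // mul0r mulr0.
have pick_h y : h y = \sum_x h x * (y == x)%:R.
  rewrite (bigD1 y) //= eqxx mulr1 big1 ?addr0 // => x xy.
  by rewrite eq_sym (negbTE xy) mulr0.
rewrite {1}(pick_h (origin G w e)) {1}(pick_h (terminus G w e)) -sumrB mulr_suml.
by apply: eq_bigr => x _; ring.
Qed.

Lemma graph_dual_pair G w : dual_pair (edges G) (tension G w) (flow G w).
Proof.
split.
- exact: tension_linear.
- exact: flow_linear.
- by move=> u e [h ->] /negbTE->.
- by move=> u e [u0 _] /u0.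
- exact: tension_flow_orthogonal.
Qed.

Definition disagree w w' : {set E} := [set e | w e != w' e].

Lemma origin_disagree G w w' e : origin G w' e =
  if e \in disagree w w' then terminus G w e else origin G w e.
Proof. by rewrite inE /origin /terminus; case: (w e); case: (w' e). Qed.

Lemma terminus_disagree G w w' e : terminus G w' e =
  if e \in disagree w w' then origin G w e else terminus G w e.
Proof. by rewrite inE /origin /terminus; case: (w e); case: (w' e). Qed.

Lemma flow_disagree G w w' u : flow G w u ->
  flow G w' (fun e => flip (disagree w w') e * u e).
Proof.
case=> u0 us; split=> [e /u0->|v]; first by rewrite mulr0.
rewrite -[RHS](us v); apply: eq_bigr => e _.
rewrite (origin_disagree G w w') (terminus_disagree G w w') /flip; case: ifP => _; ring.
Qed.

Lemma tension_disagree G w w' u : tension G w u ->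
  tension G w' (fun e => flip (disagree w w') e * u e).
Proof.
case=> h hE; exists h => e.
rewrite hE (origin_disagree G w w') (terminus_disagree G w w') /flip; case: ifP => _; case: ifP => _; ring.
Qed.

Lemma disagree_reorient A w : disagree w (reorient A w) = A.
Proof.
by apply/setP=> e; rewrite inE ffunE; case: (w e); case: (e \in A).
Qed.

Lemma cycle_perm G (s : seq (dart E)) :
  cycle (fun x y => target G x == source G y) s ->
  perm_eq (map (target G) s) (map (source G) s).
Proof.
have path_eq x s' : path (fun x y => target G x == source G y) x s' ->
    map (target G) (belast x s') = map (source G) s'.
  by elim: s' x => //= y s' IH x /andP[/eqP-> /IH->].
case: s => // x s /path_eq; rewrite belast_rcons map_rcons => ->.
by rewrite perm_rcons.
Qed.

Lemma closed_path_sum G C (s : seq (dart E)) v :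
  closed_path_along G C s ->
  \sum_(x <- s) ((source G x == v)%:R - (target G x == v)%:R) = 0 :> rat.
Proof.
case/and5P=> _ /cycle_perm st _ _ _.
rewrite sumrB -(big_map (source G) xpredT (fun y => (y == v)%:R)).
rewrite -(big_map (target G) xpredT (fun y => (y == v)%:R)).
by rewrite (perm_big _ st) subrr.
Qed.

Lemma closed_path_mem G C s e : closed_path_along G C s ->
  (e \in C) = (e \in map fst s).
Proof. by case/and5P=> _ _ _ _ /andP[/eqP-> _]; rewrite inE. Qed.

Lemma closed_path_uniq G C s e b c : closed_path_along G C s ->
  (e, b) \in s -> (e, c) \in s -> b = c.
Proof.
case/and5P=> _ _ us _ _; elim: s us => // -[f a] s IH /= /andP[fs us].
have notin x : (f, x) \in s -> False by move=> /(map_f fst)/= h; rewrite h in fs.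
rewrite !inE => /orP[/eqP[-> ->]|eb] /orP[/eqP[]|ec].
- by move=> ->.
- by case: (notin c).
- by move=> ef ca; rewrite ef in eb; case: (notin b).
exact: IH.
Qed.

(** Each edge of a closed path enters its vector with the sign of its traversal,
and conservation holds because the targets of the successive darts are their
sources up to rotation. *)
Lemma closed_path_flow G w C s : closed_path_along G C s ->
  exists u, [/\ flow G w u, (forall e, (u e != 0) = (e \in C)) &
    forall e b, (e, b) \in s -> u e = if b == w e then 1 else -1].
Proof.
move=> Cs; pose sg (x : dart E) : rat := if x.2 == w x.1 then 1 else -1.
pose u e : rat := if (e, w e) \in s then 1 else if (e, ~~ w e) \in s then -1 else 0.
have us e b : (e, b) \in s -> u e = if b == w e then 1 else -1.
  move=> ebs; rewrite /u; have uq := closed_path_uniq Cs.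
  case: ifP => [/(uq _ _ _ ebs)->|h]; first by rewrite eqxx.
  case: ifP => [/(uq _ _ _ ebs)->|h']; first by case: (w e).
  have [bw|bw] := eqVneq b (w e); first by rewrite -bw ebs in h.
  by move: h'; rewrite -[~~ w e](_ : b = _) ?ebs //; case: b (w e) bw {ebs} => -[].
have memC e : (e \in C) = ((e, true) \in s) || ((e, false) \in s).
  rewrite (closed_path_mem _ Cs); apply/idP/idP => [/mapP[[f b] fs /= ->]|].
    by case: b fs => ->; rewrite ?orbT.
  by case/orP=> /(map_f fst).
have u0 e : (u e != 0) = (e \in C).
  rewrite memC /u; case: (w e); case: (_ \in s); case: (_ \in s);
    by rewrite ?oppr_eq0 ?oner_eq0 ?eqxx.
exists u; split=> //; split=> [e eG|v].
  apply/eqP; apply: contraNT eG; rewrite u0.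
  by case/and5P: Cs => _ _ _ _ /andP[_ /subsetP]; apply.
rewrite -[RHS](closed_path_sum v Cs).
rewrite (bigID (mem C)) /= [X in _ + X]big1 ?addr0; last first.
  by move=> e; rewrite -u0 negbK => /eqP->; rewrite mul0r.
have uqs : uniq (map fst s) by case/and5P: Cs.
rewrite (eq_bigl (fun e => e \in map fst s)); last first.
  by move=> e; exact: (closed_path_mem e Cs).
rewrite -big_uniq // big_map big_seq [RHS]big_seq.
apply: eq_bigr => -[e b] ebs /=; rewrite (us _ _ ebs).
rewrite /origin /terminus /source /target /=.
by case: (w e); case: b {ebs}; rewrite /=; ring.
Qed.

End FlowsTensions.

(** * Directed cycles and cocycles as supports of nonnegative vectors *)

Section Directed.
Local Open Scope ring_scope.
Variables (d : Order.disp_t) (V : finType) (E : finOrderType d).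
Implicit Types (G : multigraph V E) (w : orientation E).
Implicit Types (C D S T A X : {set E}) (U : {set V}) (e f : E) (u : E -> rat).

Lemma directed_cycle_flow G w C : directed_cycle G w C ->
  exists2 u, flow G w u & forall e, u e = (e \in C)%:R.
Proof.
case/existsP=> s /andP[Cs /allP sw].
have [u [fu uC us]] := closed_path_flow w Cs; exists u => // e.
have [eC|eC] := boolP (e \in C); last by apply/eqP; rewrite -[_ == _]negbK uC.
move: eC; rewrite (closed_path_mem _ Cs) => /mapP[[f b] fs /= ->].
by rewrite (us _ _ fs) (sw _ fs).
Qed.

Lemma closed_path_size G C s : closed_path_along G C s -> (size s <= #|E|)%N.
Proof.
case/and5P=> _ _ us _ _; rewrite -(size_map fst) -(card_uniqP us).
exact: max_card.
Qed.

Lemma directed_cycle_of_seq G w (s : seq E) :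
  s != [::] -> uniq (map (origin G w) s) ->
  cycle (fun x y => terminus G w x == origin G w y) s -> {subset s <= edges G} ->
  directed_cycle G w [set e in s].
Proof.
move=> s0 us cs sG; pose t := [seq (e, w e) | e <- s].
have mt : map fst t = s by rewrite -map_comp map_id_in.
have tP : closed_path_along G [set e in s] t.
  apply/and5P; split; first by rewrite /t; case: (s) s0.
  - by rewrite /t cycle_map.
  - by rewrite mt (map_uniq us).
  - by rewrite -map_comp (eq_map (_ : _ =1 origin G w)).
  apply/andP; split; first by rewrite mt.
  by apply/subsetP=> e; rewrite inE; apply: sG.
have tS := closed_path_size tP.
apply/existsP; exists (Bseq tS); rewrite tP /=.
by apply/allP=> x /mapP[e _ ->] /=.
Qed.

(** Follow edges of positive flow from the end of [e].  If its origin is reached, a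
simple path closes a directed cycle.  Otherwise nothing leaves the set of
vertices reached while [e] enters it, against conservation. *)
Lemma flow_directed_cycle G w u e : flow G w u -> (forall f, 0 <= u f) ->
  0 < u e -> exists C, [/\ directed_cycle G w C, e \in C & forall f, f \in C -> 0 < u f].
Proof.
move=> [u0 us] pos_u ue.
have uG f : 0 < u f -> f \in edges G.
  by apply: contraTT => /u0->; rewrite ltxx.
pose step : rel V := fun x y => [exists f, [&& 0 < u f, origin G w f == x & terminus G w f == y]].
have [conn|nconn] := boolP (connect step (terminus G w e) (origin G w e)).
  have /connectP[p0 p0P] := conn; case/shortenP: p0P => p pP up _ plast {p0 conn}.
  have [s [sp st sh]] : exists s : seq E, [/\ {in s, forall f, 0 < u f},
      map (origin G w) s = belast (terminus G w e) p & map (terminus G w) s = p].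
    elim: p (terminus G w e) pP {up plast} => [|y p IH] x /=; first by exists [::].
    case/andP=> /existsP[f /and3P[uf /eqP tf /eqP hf]] /IH[s [su st sh]].
    exists (f :: s); rewrite /= tf hf st sh; split=> // g.
    by rewrite inE => /orP[/eqP->|/su].
  exists [set f in e :: s]; split=> [||f]; first last.
  - by rewrite !inE => /orP[/eqP->|/sp].
  - by rewrite !inE eqxx.
  apply: directed_cycle_of_seq => //=.
  - rewrite -/(uniq (origin G w e :: map (origin G w) s)) st plast.
    by move: up; rewrite lastI rcons_uniq.
  - have eqp : forall x q, map (terminus G w) (belast x q) = map (origin G w) q ->
        path (fun x y => terminus G w x == origin G w y) x q.
      by move=> x q; elim: q x => //= y q IH x [<- /IH->]; rewrite eqxx.
    apply: eqp; rewrite belast_rcons map_rcons st plast /= sh.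
    by rewrite -lastI.
  by move=> f; rewrite inE => /orP[/eqP->|/sp]; apply: uG.
pose R := [pred x | connect step (terminus G w e) x].
have : \sum_(v | R v) \sum_f u f * ((origin G w f == v)%:R - (terminus G w f == v)%:R) = 0.
  by rewrite big1.
have in_R x : \sum_(v | R v) (x == v)%:R = (R x)%:R :> rat.
  have [Rx|Rx] := boolP (R x).
    rewrite (bigD1 x) //= eqxx big1 ?addr0 // => y /andP[_].
    by rewrite eq_sym => /negbTE->.
  by rewrite big1 // => y Ry; case: eqP => // xy; rewrite xy Ry in Rx.
rewrite exchange_big /=.
rewrite (eq_bigr (fun f => - (u f * ((R (terminus G w f))%:R - (R (origin G w f))%:R)))); last first.
  by move=> f _; rewrite -mulr_sumr sumrB !in_R; ring.
rewrite sumrN => /eqP; rewrite oppr_eq0 psumr_eq0 => [/allP/(_ e)|f _].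
  rewrite mem_index_enum => /(_ isT) /=; rewrite connect0 (negbTE nconn).
  by rewrite subr0 mulr1 gt_eqF.
have := pos_u f; rewrite le_eqVlt => /orP[/eqP<-|uf]; first by rewrite mul0r.
rewrite mulr_ge0 // subr_ge0 ler_nat.
case: (boolP (R (origin G w f))) => // /= Rt.
rewrite (_ : connect _ _ _ = true) //; apply: connect_trans Rt (connect1 _).
by apply/existsP; exists f; rewrite uf !eqxx.
Qed.

Lemma directed_cycle_supports G w :
  directed_supports (flow G w) (directed_cycle G w).
Proof.
split=> [C dC|u e]; last exact: flow_directed_cycle.
have [u fu uC] := directed_cycle_flow dC; exists u; split=> // [e|].
  by rewrite uC; case: (e \in C); rewrite ?ltr01 ?eqxx.
case/existsP: dC => s /andP[Cs _].
case/and5P: (Cs); case: (bseqval s) Cs => // x s' Cs _ _ _ _ _; exists x.1.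
by rewrite (closed_path_mem _ Cs) inE eqxx.
Qed.

Definition cut_tension G w U e : rat :=
  if e \in edges G then (origin G w e \in U)%:R - (terminus G w e \in U)%:R else 0.

Lemma cut_tensionP G w U : tension G w (cut_tension G w U).
Proof. by exists (fun v => (v \in U)%:R). Qed.

Lemma in_cut G w U e :
  (e \in cut G U) = (e \in edges G) && ((origin G w e \in U) != (terminus G w e \in U)).
Proof.
by rewrite inE /origin /terminus; case: (w e); rewrite // eq_sym.
Qed.

Lemma cut_tension_neq0 G w U e : (cut_tension G w U e != 0) = (e \in cut G U).
Proof.
rewrite (in_cut _ w) /cut_tension; case: (e \in edges G) => //=.
by case: (_ \in U); case: (_ \in U).
Qed.

Lemma cocycle_cut G D : is_cocycle G D ->
  [/\ exists e, e \in D, exists U, D = cut G U &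
   forall U, cut G U != set0 -> cut G U \subset D -> cut G U = D].
Proof.
move/minsetP=> [/andP[/set0Pn D0 /existsP[U /eqP DU]] Dmin]; split=> //.
  by exists U.
move=> U' U0 UD; apply: Dmin => //; rewrite U0; apply/existsP; exists U'.
by rewrite eqxx.
Qed.

Lemma directed_cocycle_tension G w D : directed_cocycle G w D ->
  exists2 u, tension G w u & forall e, u e = (e \in D)%:R.
Proof.
case/andP=> _ /existsP[U /andP[/eqP DU /'forall_implyP out]].
exists (cut_tension G w U) => [|e]; first exact: cut_tensionP.
have [eD|eD] := boolP (e \in D); last first.
  by apply/eqP; rewrite -[_ == _]negbK cut_tension_neq0 -DU.
have tU := out e eD; move: eD; rewrite DU (in_cut _ w) /cut_tension.
by case/andP=> -> /=; rewrite -[endpoint G e (w e)]/(origin G w e) in tU *;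
  rewrite tU; case: (terminus G w e \in U) => //; rewrite subr0.
Qed.

(** Choose [U] with as few cut edges as possible.  A nonempty cut inside it, of
[U2], splits both sides of [U].  The cuts around the two quarters that contain
the ends of [e] are directed and contain [e], so by minimality they are the
whole cut of [U]: all its edges join these two quarters, and the cut of
[U2] contains all of them or none. *)
Lemma minimal_out_cut G w U0 e :
  e \in cut G U0 -> {in cut G U0, forall f, origin G w f \in U0} ->
  exists U, [/\ is_cocycle G (cut G U), e \in cut G U, cut G U \subset cut G U0 &
    {in cut G U, forall f, origin G w f \in U}].
Proof.
move=> eU0 outU0.
pose P U := [&& e \in cut G U, cut G U \subset cut G U0 &
  [forall f in cut G U, origin G w f \in U]].
have P0 : P U0.
  by rewrite /P eU0 subxx; apply/'forall_implyP.
case: (arg_minnP (fun U => #|cut G U|) P0) => U /and3P[eU UU0 /'forall_implyP outU] Umin.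
exists U; split=> //.
have min1 U1 : e \in cut G U1 -> cut G U1 \subset cut G U ->
    (forall f, f \in cut G U1 -> origin G w f \in U1) -> cut G U1 = cut G U.
  move=> e1 U1U out1; apply/eqP; rewrite eqEcard U1U Umin //.
  by rewrite /P e1 (subset_trans U1U UU0); apply/'forall_implyP.
apply/minsetP; split.
  by apply/andP; split; [apply/set0Pn; exists e | apply/existsP; exists U].
move=> D /andP[D0 /existsP[U2 /eqP DU2]] DU; rewrite {}DU2 in D0 DU *.
wlog tU2 : U2 D0 DU / origin G w e \in U2.
  move=> th; have [tU2|tU2] := boolP (origin G w e \in U2); first exact: th.
  have cutC : cut G (~: U2) = cut G U2.
    by apply/setP=> f; rewrite !inE; do 2 case: (_ \in U2).
  by rewrite -cutC; apply: th; rewrite ?cutC // inE.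
apply/eqP; rewrite eqEsubset DU /=.
have out f : f \in edges G -> (origin G w f \in U) != (terminus G w f \in U) ->
    (origin G w f \in U = true) * (terminus G w f \in U = false).
  move=> fG th; have fU : f \in cut G U by rewrite (in_cut _ w) fG.
  by move: (outU f fU) th => ->; case: (terminus G w f \in U).
have sub2 f : f \in edges G -> (origin G w f \in U2) != (terminus G w f \in U2) ->
    (origin G w f \in U) != (terminus G w f \in U).
  move=> fG th; have /(subsetP DU) : f \in cut G U2 by rewrite (in_cut _ w) fG.
  by rewrite (in_cut _ w) => /andP[].
have eG : e \in edges G by move: eU; rewrite inE => /andP[].
have [eUt eUh] : (origin G w e \in U = true) * (terminus G w e \in U = false).
  by apply: out => //; move: eU; rewrite (in_cut _ w) => /andP[].
(* [W] is a quarter or the complement of one, described by a Boolean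
   combination [g] of membership in [U] and [U2] *)
have quad (g : bool -> bool -> bool) (W : {set V}) : (forall x, (x \in W) = g (x \in U) (x \in U2)) ->
    (forall b, g false b = false) \/ (forall b, g true b = true) ->
    g true true != g false (terminus G w e \in U2) -> cut G W = cut G U.
  move=> Wg gP ge.
  have WU f : f \in cut G W ->
      (f \in cut G U) && (g true (origin G w f \in U2) != g false (terminus G w f \in U2)).
    rewrite !(in_cut _ w) !Wg => /andP[fG]; rewrite fG /= => Wf.
    have UU : (origin G w f \in U) != (terminus G w f \in U).
      apply/negP => /eqP same; case/negP: Wf; rewrite same.
      have := sub2 f fG; rewrite same eqxx.
      by case: eqVneq => [->|_ /(_ isT)].
    by rewrite UU; have [eo et] := out f fG UU; rewrite eo et in Wf.
  apply: min1 => [||f /WU/andP[fU]].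
  - by rewrite (in_cut _ w) eG !Wg eUt eUh tU2.
  - by apply/subsetP=> f /WU/andP[].
  have := fU; rewrite (in_cut _ w) => /andP[fG UU]; have [eo et] := out f fG UU.
  by rewrite Wg eo; case: gP => -> //; case: (g _ _).
have quad1 : cut G (U :&: U2) = cut G U.
  by apply: (quad andb) => [x||]; [rewrite inE | left | ].
have inU2 f : f \in cut G U -> origin G w f \in U2.
  move=> fU; move: (fU); rewrite -quad1 !(in_cut _ w) => /andP[fG].
  rewrite !inE; have := out f fG; move: fU; rewrite (in_cut _ w) fG /= => h /(_ h)[-> ->].
  by rewrite /= ; case: (_ \in U2).
have [eh|eh] := boolP (terminus G w e \in U2).
  (* every edge of the cut of U joins two vertices of U2, whose cut is empty *)
  have quad2 : cut G (U :|: ~: U2) = cut G U.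
    by apply: (quad (fun b c => b || ~~ c)) => [x||]; [rewrite !inE | right | rewrite eh].
  case/set0Pn: D0 => f fU2; have := subsetP DU f fU2 => fU.
  have tf := inU2 f fU; move: (fU); rewrite -quad2 !(in_cut _ w) => /andP[fG].
  move: fU2; rewrite (in_cut _ w) fG tf /= => hf.
  have := out f fG; move: fU; rewrite (in_cut _ w) fG /= => h /(_ h)[ft fh].
  by rewrite !inE ft fh (negbTE (_ : terminus G w f \notin U2)) //; case: (_ \in U2) hf.
have quad2 : cut G (U :|: U2) = cut G U.
  by apply: (quad orb) => [x||]; [rewrite inE | right | rewrite (negbTE eh)].
apply/subsetP=> f fU; have tf := inU2 f fU.
move: (fU); rewrite -quad2 !(in_cut _ w) => /andP[fG]; rewrite fG tf /=.
have := out f fG; move: fU; rewrite (in_cut _ w) fG /= => h /(_ h)[ft fh].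
by rewrite !inE ft fh; case: (_ \in U2).
Qed.

End Directed.

Section Fundamental.
Local Open Scope ring_scope.
Variables (d : Order.disp_t) (V : finType) (E : finOrderType d).
Implicit Types (G : multigraph V E) (w : orientation E).
Implicit Types (C D S T A X : {set E}) (U : {set V}) (e f : E) (u : E -> rat).
Implicit Types (F : E -> E -> rat).

(** The vertices whose potential is at least that of the origin of [e] have a cut
in which all edges have positive tension, and a cocycle can be extracted from
it. *)
Lemma tension_directed_cocycle G w u e : tension G w u -> (forall f, 0 <= u f) ->
  0 < u e -> exists D, [/\ directed_cocycle G w D, e \in D & forall f, f \in D -> 0 < u f].
Proof.
move=> [h hE] pos_u ue.
have eG : e \in edges G by move: ue; rewrite hE; case: ifP; rewrite ?ltxx.
pose U0 := [set v | h (origin G w e) <= h v].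
have out0 f : f \in cut G U0 -> (origin G w f \in U0) && (0 < u f).
  rewrite (in_cut _ w) !inE => /andP[fG].
  have := pos_u f; rewrite hE fG.
  case: (leP _ (h (origin G w f))); case: (leP _ (h (terminus G w f))) => //=; lra.
have eU0 : e \in cut G U0.
  by rewrite (in_cut _ w) eG !inE lexx /= -ltNge; move: ue; rewrite hE eG; lra.
have out1 : {in cut G U0, forall f, origin G w f \in U0} by move=> f /out0/andP[].
have [U [coU eU UU0 outU]] := minimal_out_cut eU0 out1.
exists (cut G U); split=> //; last by move=> f /(subsetP UU0)/out0/andP[].
rewrite /directed_cocycle coU; apply/existsP; exists U; rewrite eqxx.
by apply/'forall_implyP.
Qed.

Lemma directed_cocycle_supports G w :
  directed_supports (tension G w) (directed_cocycle G w).
Proof.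
split=> [D dD|u e]; last exact: tension_directed_cocycle.
have [u fu uD] := directed_cocycle_tension dD; exists u; split=> // [e|].
  by rewrite uD; case: (e \in D); rewrite ?ltr01 ?eqxx.
by case/andP: dD => /cocycle_cut[].
Qed.

(** * Fundamental cycles and cocycles *)

(** Undirected statements follow from directed ones after reversing the edges where
the vector is negative. *)
Lemma flip_negative w u f :
  flip (disagree w (reorient [set f | u f < 0] w)) f * u f = `|u f|.
Proof.
rewrite disagree_reorient /flip inE.
have [uf|uf] := ltrP (u f) 0; first by rewrite mulN1r ltr0_norm.
by rewrite mul1r ger0_norm.
Qed.

Lemma flow_cycle G w u e : flow G w u -> u e != 0 ->
  exists C, [/\ is_cycle G C, e \in C & forall f, f \in C -> u f != 0].
Proof.
move=> fu ue; pose w' := reorient [set f | u f < 0] w.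
have [||C [dC eC CP]] := @flow_directed_cycle d V E G w' _ e (flow_disagree w' fu).
- by move=> f; rewrite flip_negative.
- by rewrite flip_negative normr_gt0.
exists C; split=> // [|f /CP]; last by rewrite flip_negative normr_gt0.
by case/existsP: dC => s /andP[Cs _]; apply/existsP; exists s.
Qed.

Lemma tension_cocycle G w u e : tension G w u -> u e != 0 ->
  exists D, [/\ is_cocycle G D, e \in D & forall f, f \in D -> u f != 0].
Proof.
move=> fu ue; pose w' := reorient [set f | u f < 0] w.
have [||D [dD eD DP]] := @tension_directed_cocycle G w' _ e (tension_disagree w' fu).
- by move=> f; rewrite flip_negative.
- by rewrite flip_negative normr_gt0.
exists D; split=> // [|f /DP]; last by rewrite flip_negative normr_gt0.
by case/andP: dD.
Qed.

Lemma cycle_flow G w C : is_cycle G C ->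
  exists u, [/\ flow G w u, (forall e, (u e != 0) = (e \in C)) & exists e, e \in C].
Proof.
case/existsP=> s Cs; have [u [fu uC _]] := closed_path_flow w Cs.
exists u; split=> //; case/and5P: (Cs); case: (bseqval s) Cs => // x s' Cs _ _ _ _ _.
by exists x.1; rewrite (closed_path_mem _ Cs) inE eqxx.
Qed.

Lemma cocycle_tension G w D : is_cocycle G D ->
  exists u, [/\ tension G w u, (forall e, (u e != 0) = (e \in D)) & exists e, e \in D].
Proof.
case/cocycle_cut=> exD [U DU] _; exists (cut_tension G w U); split=> //.
  exact: cut_tensionP.
by move=> e; rewrite cut_tension_neq0 -DU.
Qed.

Definition tree_frame G w T F := frame (edges G) (tension G w) (flow G w) T F.

Definition supp F e := [set f | F e f != 0].

Section Frame.
Variables (G : multigraph V E) (w : orientation E) (T : {set E}).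
Variable (F : E -> E -> rat).
Hypotheses (fr : tree_frame G w T F) (TG : T \subset edges G).

Lemma flow_outside e u : e \in edges G -> e \notin T -> flow G w u ->
  (forall f, u f != 0 -> f \in T :|: [set e]) -> forall f, u f = u e * F e f.
Proof.
move=> eG eT fu uT; apply: (fr_coord fr fu eG eT) => f fG fT fe.
by apply/eqP; apply: contraTT fT => /uT; rewrite !inE (negbTE fe) orbF negbK.
Qed.

Lemma tension_inside b u : b \in T -> tension G w u ->
  (forall f, u f != 0 -> f \in (edges G :\: T) :|: [set b]) ->
  forall f, u f = u b * F b f.
Proof.
move=> bT fu uT; have bG := subsetP TG b bT.
apply: (fr_coord (frameC fr) fu bG); first by rewrite inE bT.
move=> f fG; rewrite inE negbK => fT fb.
by apply/eqP; apply: contraTT fT => /uT; rewrite !inE (negbTE fb) orbF => /andP[].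
Qed.

Lemma flow_fund e : e \in edges G -> e \notin T -> flow G w (F e).
Proof. by move=> eG eT; have := fr_in fr eG; rewrite (negbTE eT). Qed.

Lemma tension_fund b : b \in T -> tension G w (F b).
Proof. by move=> bT; have := fr_in fr (subsetP TG b bT); rewrite bT. Qed.

Lemma supp_sub e : e \in edges G -> e \notin T -> supp F e \subset T :|: [set e].
Proof.
move=> eG eT; apply/subsetP=> f; rewrite !inE => Ff.
have [->|fe] := eqVneq f e; first by rewrite orbT.
by rewrite (fr_side fr eG fe Ff) eT.
Qed.

Lemma cosupp_sub b : b \in T -> supp F b \subset (edges G :\: T) :|: [set b].
Proof.
move=> bT; apply/subsetP=> f; rewrite !inE => Ff; have bG := subsetP TG b bT.
have [->|fb] := eqVneq f b; first by rewrite orbT.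
by rewrite (fr_side fr bG fb Ff) bT (fr_supp fr bG Ff).
Qed.

(** Flows supported in [T] plus [e] are multiples of [F e]. *)
Lemma cycle_eq_supp e C : e \in edges G -> e \notin T -> is_cycle G C ->
  C \subset T :|: [set e] -> C = supp F e.
Proof.
move=> eG eT cC CT; have [u [fu uC [g gC]]] := cycle_flow w cC.
have uE := flow_outside eG eT fu _.
have {}uE f : u f = u e * F e f by apply: uE => h; rewrite uC => /(subsetP CT).
have ue : u e != 0 by apply: contraTneq gC => ue; rewrite -uC uE ue mul0r eqxx.
by apply/setP=> f; rewrite inE -uC uE mulf_eq0 negb_or ue.
Qed.

Lemma cocycle_eq_supp b D : b \in T -> is_cocycle G D ->
  D \subset (edges G :\: T) :|: [set b] -> D = supp F b.
Proof.
move=> bT cD DT; have [u [fu uD [g gD]]] := cocycle_tension w cD.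
have uE := tension_inside bT fu _.
have {}uE f : u f = u b * F b f by apply: uE => h; rewrite uD => /(subsetP DT).
have ub : u b != 0 by apply: contraTneq gD => ub; rewrite -uD uE ub mul0r eqxx.
by apply/setP=> f; rewrite inE -uD uE mulf_eq0 negb_or ub.
Qed.

Lemma supp_cycle e : e \in edges G -> e \notin T -> is_cycle G (supp F e).
Proof.
move=> eG eT; have fe := flow_fund eG eT.
have ee : F e e != 0 by rewrite (fr_diag fr eG) oner_eq0.
have [C [cC eC CF]] := flow_cycle fe ee.
rewrite -(cycle_eq_supp eG eT cC) //.
apply: subset_trans (supp_sub eG eT); apply/subsetP=> f /CF.
by rewrite inE.
Qed.

Lemma supp_cocycle b : b \in T -> is_cocycle G (supp F b).
Proof.
move=> bT; have fb := tension_fund bT.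
have bb : F b b != 0 by rewrite (fr_diag fr) ?oner_eq0 // (subsetP TG).
have [D [cD bD DF]] := tension_cocycle fb bb.
rewrite -(cocycle_eq_supp bT cD) //.
apply: subset_trans (cosupp_sub bT); apply/subsetP=> f /DF.
by rewrite inE.
Qed.

Lemma fund_cycleE e : e \in edges G -> e \notin T -> fund_cycle G T e = supp F e.
Proof.
move=> eG eT; rewrite /fund_cycle; case: pickP => [C /andP[cC CT]|none] /=.
  exact: cycle_eq_supp.
by have := none (supp F e); rewrite supp_cycle // supp_sub.
Qed.

Lemma fund_cocycleE b : b \in T -> fund_cocycle G T b = supp F b.
Proof.
move=> bT; rewrite /fund_cocycle; case: pickP => [D /andP[cD DT]|none] /=.
  exact: cocycle_eq_supp.
by have := none (supp F b); rewrite supp_cocycle // cosupp_sub.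
Qed.

Lemma is_min_supp x m :
  is_min m (supp F x) <-> F x m != 0 /\ forall y, F x y != 0 -> (m <= y)%O.
Proof.
rewrite /is_min inE; split=> [/andP[-> /'forall_implyP h]|[-> h]].
  by split=> // y Fy; apply: h; rewrite inE.
by apply/'forall_implyP=> y; rewrite inE; apply: h.
Qed.

Lemma is_min_active x : x \in edges G -> is_min x (supp F x) = active_in F x.
Proof.
move=> xG; apply/idP/idP => [/is_min_supp[_ h]|/forallP h].
  by apply/forallP=> y; apply/implyP/h.
apply/is_min_supp; split; first by rewrite (fr_diag fr xG) oner_eq0.
by move=> y; apply/implyP.
Qed.

Lemma Int_active : Int G T = [set b in T | active_in F b].
Proof.
apply/setP=> b; rewrite !inE; apply: andb_id2l => bT.
by rewrite fund_cocycleE // is_min_active // (subsetP TG).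
Qed.

Lemma Ext_active : Ext G T = [set e in edges G :\: T | active_in F e].
Proof.
apply/setP=> e; rewrite !inE; apply: andb_id2l => /andP[eT eG].
by rewrite fund_cycleE // is_min_active.
Qed.

(** The relative direction of two edges along a cycle is the sign of the product of
their coordinates in any flow supported by the cycle, all such flows being
proportional. *)
Lemma opposed_cycle e : e \in edges G -> e \notin T ->
  opposite_to_min_cycle G w T e <-> opposed F e.
Proof.
move=> eG eT; rewrite /opposite_to_min_cycle fund_cycleE //.
have fuE C s u : closed_path_along G C s -> flow G w u -> C = supp F e ->
    (forall f, (u f != 0) = (f \in C)) -> forall f, u f = u e * F e f.
  move=> Cs fu CF uC; apply: flow_outside => // f; rewrite uC CF.
  exact/subsetP/supp_sub.
split=> [/existsP[m /andP[/is_min_supp[Fm mP]]]|[m [Fm mP]]].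
  case/existsP=> s /existsP[b /existsP[c /and4P[Cs es ms bc]]].
  have [u [fu uC us]] := closed_path_flow w Cs.
  have uE := fuE _ _ _ Cs fu (erefl _) uC.
  exists m; split=> //; have := uE m; rewrite (us _ _ es) (us _ _ ms).
  by move: bc; case: (b == w e); case: (c == w m) => // _; lra.
have mF : is_min m (supp F e) by apply/is_min_supp; split; rewrite // lt_eqF.
apply/existsP; exists m; rewrite mF /=.
have /existsP[s Cs] := supp_cycle eG eT.
have [u [fu uC us]] := closed_path_flow w Cs.
have uE := fuE _ _ _ Cs fu (erefl _) uC.
have inF f : F e f != 0 -> exists b, (f, b) \in (s : seq (dart E)).
  move=> Ff; have : f \in supp F e by rewrite inE.
  by rewrite (closed_path_mem _ Cs) => /mapP[[g b] gs /= ->]; exists b.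
have [b es] : exists b, (e, b) \in (s : seq (dart E)).
  by apply: inF; rewrite (fr_diag fr eG) oner_eq0.
have [c ms] : exists b, (m, b) \in (s : seq (dart E)) by apply: inF; rewrite lt_eqF.
apply/existsP; exists s; apply/existsP; exists b; apply/existsP; exists c.
apply/and4P; split=> //; have := uE m; rewrite (us _ _ es) (us _ _ ms).
by case: (b == w e); case: (c == w m) => //; lra.
Qed.

(** The two sides of the cut of [U] give a tension proportional to [F b], whose
signs tell in which way the edges cross the cut. *)
Lemma opposed_cocycle b : b \in T ->
  opposite_to_min_cocycle G w T b <-> opposed F b.
Proof.
move=> bT; rewrite /opposite_to_min_cocycle fund_cocycleE //.
have bF : b \in supp F b.
  by rewrite inE (fr_diag fr) ?oner_eq0 // (subsetP TG).
have uE U : supp F b = cut G U ->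
    forall f, cut_tension G w U f = cut_tension G w U b * F b f.
  move=> DU; apply: tension_inside => // [|f]; first exact: cut_tensionP.
  by rewrite cut_tension_neq0 -DU; apply/subsetP/cosupp_sub.
have ct U f : f \in cut G U ->
    cut_tension G w U f = if origin G w f \in U then 1 else -1.
  rewrite (in_cut _ w) /cut_tension => /andP[->].
  by case: (_ \in U); case: (_ \in U) => //= _; lra.
split=> [/existsP[m /andP[/is_min_supp[Fm mP]]]|[m [Fm mP]]].
  case/and4P=> _ _ mF /existsP[U /andP[/eqP DU bm]].
  exists m; split=> //; have := uE U DU m; rewrite !ct -?DU //.
  rewrite -!/(origin G w _) in bm.
  by move: bm; do 2 case: ifP => _ //=; lra.
have mF : is_min m (supp F b) by apply/is_min_supp; split; rewrite // lt_eqF.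
have mF' : m \in supp F b by case/andP: mF.
apply/existsP; exists m; rewrite mF /opposite_in_cocycle bF mF' supp_cocycle //=.
have [_ [U DU] _] := cocycle_cut (supp_cocycle bT).
apply/existsP; exists U; rewrite {1}DU eqxx /= -!/(origin G w _).
have := uE U DU m; rewrite !ct -?DU //.
by do 2 case: ifP => _ //=; lra.
Qed.

End Frame.

(** An element that is the first one of its own vector is not opposed to it, so
this condition forces [p] into the tree when [p] is the smallest edge. *)
Lemma bipolar_criterionP G w T F p : tree_frame G w T F -> T \subset edges G ->
  bipolar_criterion G w p T <->
  (forall x, x \in edges G -> (x \in T -> x != p) -> opposed F x).
Proof.
move=> fr TG; split=> [/andP[/'forall_implyP h1 /'forall_implyP h2] x xG xp|h].
  have [xT|xT] := boolP (x \in T).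
    by apply/(opposed_cocycle fr TG xT)/h1; rewrite !inE xp.
  by apply/(opposed_cycle fr xG xT)/h2; rewrite !inE xT.
apply/andP; split; apply/'forall_implyP => x; rewrite !inE => /andP[x1 x2].
  by apply/(opposed_cocycle fr TG x2)/h => //; apply: (subsetP TG).
by apply/(opposed_cycle fr x2 x1)/h => // x3; rewrite x3 in x1.
Qed.

Lemma cyclic_bipolar_criterionP G w T F p : tree_frame G w T F -> T \subset edges G ->
  cyclic_bipolar_criterion G w p T <->
  (forall x, x \in edges G -> (x \notin T -> x != p) -> opposed F x).
Proof.
move=> fr TG; split=> [/andP[/'forall_implyP h1 /'forall_implyP h2] x xG xp|h].
  have [xT|xT] := boolP (x \in T).
    by apply/(opposed_cocycle fr TG xT)/h1.
  by apply/(opposed_cycle fr xG xT)/h2; rewrite !inE xT xp.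
apply/andP; split; apply/'forall_implyP => x.
  move=> xT; apply/(opposed_cocycle fr TG xT)/h; last by rewrite xT.
  exact: (subsetP TG).
by rewrite !inE => /and3P[x1 x2 x3]; apply/(opposed_cycle fr x3 x2)/h.
Qed.

End Fundamental.

(** * Spanning trees and frames *)

Section Trees.
Local Open Scope ring_scope.
Variables (d : Order.disp_t) (V : finType) (E : finOrderType d).
Implicit Types (G : multigraph V E) (w : orientation E).
Implicit Types (C D S T A X : {set E}) (U : {set V}) (e f : E) (u : E -> rat).
Implicit Types (F : E -> E -> rat).

Lemma adjacent_sym G : symmetric (adjacent G).
Proof.
move=> x y; apply/idP/idP => /existsP[e /andP[eG /existsP[b /andP[xb yb]]]];
  apply/existsP; exists e; rewrite eG; apply/existsP; exists (~~ b);
  by rewrite negbK yb.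
Qed.

Lemma connect_invariant (T : Type) (r : rel V) (h : V -> T) :
  (forall x y, r x y -> h x = h y) -> forall x y, connect r x y -> h x = h y.
Proof.
move=> hr x y /connectP[p]; elim: p x => [|z p IH] x /=; first by move=> _ ->.
by case/andP=> /hr-> /IH h1 /h1.
Qed.

Lemma adjacent_edge G S w e : e \in edges G -> e \in S ->
  adjacent (restrict G S) (origin G w e) (terminus G w e).
Proof.
move=> eG eS; apply/existsP; exists e; rewrite inE eG eS /=.
by apply/existsP; exists (w e); rewrite !eqxx.
Qed.

Lemma adjacentP G S w x y : adjacent (restrict G S) x y -> exists e,
  [/\ e \in edges G, e \in S & (x = origin G w e /\ y = terminus G w e) \/
     (x = terminus G w e /\ y = origin G w e)].
Proof.
case/existsP=> e /andP[]; rewrite inE => /andP[eG eS] /existsP[b /andP[/eqP<- /eqP<-]].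
exists e; split=> //; rewrite /origin /terminus.
by case: b; case: (w e); [left|right|right|left].
Qed.

Lemma restrict_edges G : restrict G (edges G) = G.
Proof. by case: G => eG ep; rewrite /restrict /= setIid. Qed.

(** Its cut avoids [S]: a tension vanishing on [S], which detects disconnection. *)
Definition component G S x := [set y | connect (adjacent (restrict G S)) x y].

Lemma cut_component G S x e : e \in S -> e \notin cut G (component G S x).
Proof.
move=> eS; rewrite (in_cut _ [ffun=> false]); apply/negP => /andP[eG].
set w := [ffun=> false]; have adj := adjacent_edge w eG eS.
rewrite !inE -(same_connect_r _ (connect1 adj)) ?eqxx //.
exact/sym_connect_sym/adjacent_sym.
Qed.

Lemma connect_flow G w S x y : connect (adjacent (restrict G S)) x y ->
  exists u, (forall e, e \notin edges G :&: S -> u e = 0) /\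
   forall v, \sum_e u e * ((origin G w e == v)%:R - (terminus G w e == v)%:R)
      = (x == v)%:R - (y == v)%:R.
Proof.
case/connectP=> p; elim: p x => [|z p IH] x /=.
  move=> _ ->; exists (fun=> 0); split=> // v.
  by rewrite subrr big1 // => e _; rewrite mul0r.
case/andP=> /(adjacentP w)[e [eG eS xz]] /IH{}IH /IH[u [u0 us]].
pose c : rat := if (x == origin G w e) && (z == terminus G w e) then 1 else -1.
have cP v : c * ((origin G w e == v)%:R - (terminus G w e == v)%:R) =
    (x == v)%:R - (z == v)%:R.
  rewrite /c; case: ifPn => [/andP[/eqP<- /eqP<-]|]; first by rewrite mul1r.
  by case: xz => -[-> ->]; rewrite ?eqxx // => _; ring.
exists (fun f => c * (f == e)%:R + u f); split=> [f fS|v].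
  rewrite u0 // addr0; case: eqP => [fe|_]; last by rewrite mulr0.
  by rewrite fe inE eG eS in fS.
transitivity (\sum_f ((f == e)%:R * (c * ((origin G w f == v)%:R - (terminus G w f == v)%:R))
  + u f * ((origin G w f == v)%:R - (terminus G w f == v)%:R))).
  by apply: eq_bigr => f _; ring.
rewrite big_split /= us (bigD1 e) //= eqxx mul1r cP big1 ?addr0; first by ring.
by move=> f /negbTE->; rewrite mul0r.
Qed.

Lemma closing_flow G w S e : e \in edges G -> e \notin S ->
  connect (adjacent (restrict G S)) (terminus G w e) (origin G w e) ->
  exists u, [/\ flow G w u, u e = 1 & forall f, u f != 0 -> f \in S :|: [set e]].
Proof.
move=> eG eS /(connect_flow w)[u [u0 us]].
exists (fun f => (f == e)%:R + u f); split.
- split=> [f fG|v].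
    by rewrite u0 ?inE ?(negbTE fG) // addr0; case: eqP => // fe; rewrite fe eG in fG.
  transitivity (\sum_f ((f == e)%:R * ((origin G w f == v)%:R - (terminus G w f == v)%:R)
    + u f * ((origin G w f == v)%:R - (terminus G w f == v)%:R))).
    by apply: eq_bigr => f _; ring.
  rewrite big_split /= us (bigD1 e) //= eqxx mul1r big1 ?addr0; first by ring.
  by move=> f /negbTE->; rewrite mul0r.
- by rewrite eqxx u0 ?addr0 // inE (negbTE eS) andbF.
move=> f; rewrite !inE; have [->|fe] := eqVneq f e; first by rewrite orbT.
by rewrite orbF; apply: contraNT => fS; rewrite add0r u0 // inE (negbTE fS) andbF.
Qed.

Lemma spanning_tree_sub G T : spanning_tree G T -> T \subset edges G.
Proof. by case/andP=> /andP[]. Qed.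

(** A path of [T] closes [e] into a flow.  For [b] in [T], the component of an end
of [b] in [T] minus [b] has a cut meeting [T] in [b] only, as a path
between both ends would close a cycle inside the tree. *)
Lemma spanning_tree_frame G w T : spanning_tree G T -> exists F, tree_frame G w T F.
Proof.
case/andP=> /andP[TG /forallP noC] /forallP span.
have [F FP] : exists F : E -> E -> rat, forall x, x \in edges G ->
   [/\ if x \in T then tension G w (F x) else flow G w (F x), F x x = 1 &
     forall y, y \in edges G -> y != x -> (x \in T) = (y \in T) -> F x y = 0].
  apply: (fin_all_exists (P := fun x v => x \in edges G ->
   [/\ if x \in T then tension G w v else flow G w v, v x = 1 &
     forall y, y \in edges G -> y != x -> (x \in T) = (y \in T) -> v y = 0])) => x.
  have [xG|xG] := boolP (x \in edges G); last by exists (fun=> 0) => /idPn[].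
  have [xT|xT] := boolP (x \in T).
    pose U := component G (T :\ x) (origin G w x).
    exists (cut_tension G w U) => _; split; first exact: cut_tensionP.
      rewrite /cut_tension xG !inE connect0; case: (boolP (connect _ _ _)) => [con|_].
        rewrite sym_connect_sym in con; last exact: adjacent_sym.
        have [|u [fu ux uS]] := closing_flow xG _ con; first by rewrite !inE eqxx.
        have [|C [cC _ CP]] := flow_cycle fu (e := x); first by rewrite ux oner_eq0.
        have /implyP/(_ cC)/negP[] := noC C.
        by apply/subsetP=> f /CP/uS; rewrite !inE => /orP[/andP[]|/eqP->].
      by rewrite subr0.
    move=> y yG yx /esym yT; apply/eqP; rewrite -[_ == _]negbK cut_tension_neq0.
    by apply: cut_component; rewrite !inE yx.
  have con : connect (adjacent (restrict G T)) (terminus G w x) (origin G w x).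
    have /forallP/(_ (origin G w x))/implyP := span (terminus G w x).
    apply; apply: connect1; rewrite adjacent_sym -[G in adjacent G]restrict_edges.
    exact: adjacent_edge.
  have [u [fu ux uS]] := closing_flow xG xT con; exists u => _; split=> // y yG yx yT.
  apply/eqP; apply: contraFT (esym yT) => /uS.
  by rewrite !inE (negbTE yx) orbF => ->.
exists F; split=> [|x /FP[]//|x /FP[]//|x y xG yG xy]; first exact: graph_dual_pair.
by have [_ _ h] := FP x xG; apply: h; rewrite // eq_sym.
Qed.

(** A flow supported in [T] is zero, hence no cycle lies in [T]; a tension that
vanishes on [T] is zero, hence components of [T] cut no edge. *)
Lemma frame_spanning_tree G w T F : T \subset edges G -> tree_frame G w T F ->
  spanning_tree G T.
Proof.
move=> TG fr; apply/andP; split.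
  rewrite /forest TG; apply/forallP=> C; apply/implyP=> /(cycle_flow w)[u [fu uC [e eC]]].
  apply: contraTN eC => /subsetP CT; rewrite -uC negbK; apply/eqP.
  apply: (fr_coord0 fr fu) => f fG fT; apply/eqP.
  by rewrite -[_ == _]negbK uC; apply: contra fT; apply: CT.
apply/forallP=> x; apply/forallP=> y; apply/implyP.
apply: connect_sub => {}x {}y; rewrite -[G in adjacent G]restrict_edges.
case/(adjacentP w)=> e [eG _ xy].
suff : e \notin cut G (component G T x).
  rewrite (in_cut _ w) eG /= negbK !inE.
  by case: xy => -[-> ->]; rewrite connect0 => /eqP // <-.
rewrite -(cut_tension_neq0 _ w) negbK; apply/eqP.
apply: (fr_coord0 (frameC fr) (cut_tensionP G w _)) => f fG.
rewrite inE negbK => fT; apply/eqP; rewrite -[_ == _]negbK cut_tension_neq0.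
exact: cut_component.
Qed.

Lemma spanning_tree_exists G : exists T, spanning_tree G T.
Proof.
pose w : orientation E := [ffun=> false].
pose P T := (T \subset edges G) && spanning G T.
have PG : P (edges G).
  rewrite /P subxx; apply/forallP=> x; apply/forallP=> y; apply/implyP.
  by rewrite restrict_edges.
case: (arg_minnP (fun T => #|T|) PG) => T /andP[TG span] Tmin; exists T.
rewrite /spanning_tree span andbT /forest TG; apply/forallP=> C; apply/implyP.
move=> /(cycle_flow w)[u [fu uC [e eC]]]; apply/negP => /subsetP CT.
have eT := CT e eC.
suff /Tmin : P (T :\ e) by rewrite [#|T|](cardsD1 e) eT add1n ltnn.
rewrite /P (subset_trans (subsetDl _ _) TG); apply/forallP=> x; apply/forallP=> y.
apply/implyP=> cxy; have /forallP/(_ x)/forallP/(_ y)/implyP/(_ cxy) := span.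
apply: connect_sub => {cxy}x {}y /(adjacentP w)[f [fG fT xy]].
suff : f \notin cut G (component G (T :\ e) x).
  rewrite (in_cut _ w) fG /= negbK !inE.
  by case: xy => -[-> ->]; rewrite connect0 => /eqP // <-.
have [->|fe] := eqVneq f e; last by apply: cut_component; rewrite !inE fe.
rewrite -(cut_tension_neq0 _ w) negbK.
have := tension_flow_orthogonal (cut_tensionP G w (component G (T :\ e) x)) fu.
rewrite (bigD1 e) //= big1 ?addr0 => [/eqP|g ge].
  by rewrite mulf_eq0 -[u e == 0]negbK uC eC orbF.
have [gC|gC] := boolP (g \in C); last first.
  by have /eqP-> : u g == 0 by [rewrite -[_ == _]negbK uC]; rewrite mulr0.
apply/eqP; rewrite mulf_eq0 -[cut_tension _ _ _ _ == 0]negbK cut_tension_neq0.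
by rewrite cut_component // !inE ge CT.
Qed.

(** * Vectors of minors *)

Section Minor.
Variables (G : multigraph V E) (w : orientation E) (F1 F0 : {set E}).
Hypothesis (F01 : F0 \subset F1).
Let G' := contract (restrict G F1) F0.

Lemma minor_edges : edges G' = (edges G :&: F1) :\: F0.
Proof. by []. Qed.

Let r := adjacent (restrict (restrict G F1) F0).

Lemma minor_contracted e : e \in edges G -> e \in F0 ->
  r (origin G w e) (terminus G w e).
Proof.
move=> eG eF; apply: (@adjacent_edge (restrict G F1) F0 w e) => //.
by rewrite inE eG (subsetP F01).
Qed.

Definition minor_part u e : rat := if e \in edges G' then u e else 0.

(** Conservation at a merged vertex is the sum of the conservation laws at the
vertices merged into it, contracted edges contributing nothing. *)
Lemma minor_flow u : flow G w u -> (forall e, e \notin F1 -> u e = 0) ->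
  flow G' w (minor_part u).
Proof.
move=> [u0 us] uF; split=> [e /negbTE eG|v]; first by rewrite /minor_part eG.
have : \sum_(x | fingraph.root r x == v)
   \sum_e u e * ((origin G w e == x)%:R - (terminus G w e == x)%:R) = 0 by rewrite big1.
have in_r y : \sum_(x | fingraph.root r x == v) (y == x)%:R = (fingraph.root r y == v)%:R :> rat.
  have [Ry|Ry] := eqVneq (fingraph.root r y) v.
    rewrite (bigD1 y) ?Ry //= eqxx big1 ?addr0 // => x /andP[_].
    by rewrite eq_sym => /negbTE->.
  rewrite big1 // => x /eqP Rx; case: eqP => // yx.
  by rewrite yx Rx eqxx in Ry.
rewrite exchange_big /= => sum0; rewrite -[RHS]sum0.
apply: eq_bigr => e _; rewrite -mulr_sumr sumrB !in_r /minor_part minor_edges !inE.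
have [eF0|eF0] /= := boolP (e \in F0).
  have [eG|eG] := boolP (e \in edges G); last by rewrite u0 ?mul0r.
  have con := connect1 (minor_contracted eG eF0).
  have rsym : connect_sym r by apply/sym_connect_sym/adjacent_sym.
  by rewrite (fingraph.rootP rsym con) subrr !mulr0.
have [eG|eG] := boolP (e \in edges G); last by rewrite u0 ?mul0r.
by have [eF1|eF1] := boolP (e \in F1); last by rewrite uF ?mul0r.
Qed.

(** A potential without variation along the contracted edges is constant on merged
vertices, and still serves. *)
Lemma minor_tension u : tension G w u -> (forall e, e \in F0 -> u e = 0) ->
  tension G' w (minor_part u).
Proof.
move=> [h hE] uF; exists h => e; rewrite /minor_part; case: ifP => // eG'.
have eG : e \in edges G by move: eG'; rewrite minor_edges !inE => /andP[_ /andP[]].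
rewrite hE eG.
have hr x : h (fingraph.root r x) = h x.
  apply/esym; apply: (connect_invariant _ (connect_root r x)) => a b.
  case/(adjacentP w) => f [fG fF ab].
  have fG' : f \in edges G by move: fG; rewrite inE => /andP[].
  have := uF f fF; rewrite hE fG' => /eqP; rewrite subr_eq0 => /eqP.
  by case: ab => -[-> ->] => [->|<-].
by rewrite -(hr (origin G w e)) -(hr (terminus G w e)).
Qed.

End Minor.
End Trees.

(** * Indexing the active filtration *)

Section SortedFiltration.
Local Open Scope ring_scope.
Variables (d : Order.disp_t) (E : finOrderType d).
Implicit Types (A gr T : {set E}) (a b c e x y : E) (F : E -> E -> rat).
Implicit Types (K L : (E -> rat) -> Prop) (pos : E -> int).

Lemma onth_sort_mem A k a : onth (sort <=%O (enum A)) k = Some a ->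
  a \in A /\ forall c, c \in A ->
    (a < c)%O = if onth (sort <=%O (enum A)) k.+1 is Some b then (b <= c)%O else false.
Proof.
set s := sort _ _ => sk.
have s_sort : sorted <%O s by rewrite sort_lt_sorted enum_uniq.
have mem_s c : (c \in s) = (c \in A) by rewrite mem_sort mem_enum.
have ks : (k < size s)%N by rewrite -onthTE sk.
have ak := onth_nth a _ _ _ sk.
split=> [|c]; first by rewrite -mem_s -ak mem_nth.
rewrite -mem_s => cs; have js : (index c s < size s)%N by rewrite index_mem.
rewrite -{1}ak -[X in (_ < X)%O](nth_index a cs) (lt_sorted_ltn_nth a s_sort) //.
case sk1 : (onth s k.+1) => [b|].
  have ks1 : (k.+1 < size s)%N by rewrite -onthTE sk1.
  by rewrite -(onth_nth a _ _ _ sk1) -[in RHS](nth_index a cs) (lt_sorted_leq_nth a s_sort).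
have : (size s <= k.+1)%N by rewrite -onthNE sk1.
by move=> ks1; apply/negbTE; rewrite -leqNgt -ltnS; apply: leq_trans js ks1.
Qed.

Lemma onth_sort_lt A k : (k < #|A|)%N -> exists a, onth (sort <=%O (enum A)) k = Some a.
Proof.
move=> kA; have : onth (sort <=%O (enum A)) k by rewrite onthTE size_sort -cardE.
by case: onth => // a _; exists a.
Qed.

Lemma onth_sort_index A a : a \in A ->
  exists2 k, (k < #|A|)%N & onth (sort <=%O (enum A)) k = Some a.
Proof.
set s := sort _ _ => aA; have as_ : a \in s by rewrite mem_sort mem_enum.
have ks : (index a s < size s)%N by rewrite index_mem.
exists (index a s); first by move: ks; rewrite size_sort -cardE.
move: ks; rewrite -onthTE; case sk: (onth s _) => [b|] // _.
by rewrite -(onth_nth a _ _ _ sk) nth_index.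
Qed.

(** Levels only take the values of active elements, so the level after that of [a]
is that of the next active element. *)
Lemma next_level gr K L T F pos : frame gr K L T F -> levelling gr T F pos ->
  forall A k a, A = [set x in gr | (x \in T) && active_in F x] ->
  onth (sort <=%O (enum A)) k = Some a -> forall e, e \in gr ->
    (pos a < pos e) = if onth (sort <=%O (enum A)) k.+1 is Some b
                      then pos b <= pos e else false.
Proof.
move=> fr lv A k a AE sk e eg; have [aA next] := onth_sort_mem sk.
have /and3P[ag aT aa] : [&& a \in gr, a \in T & active_in F a].
  by move: aA; rewrite AE inE.
have [c [cg ca _ <-]] := level_active fr lv eg.
have lvl x : x \in A -> [/\ x \in gr, x \in T & active_in F x].
  by rewrite AE inE => /and3P[].
have [cT|cT] := boolP (c \in T); last first.
  have pc : (0 < pos c) = false by rewrite (pos_gt0 lv) // (negbTE cT).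
  have neg x : x \in A -> pos c < pos x.
    move=> /lvl[xg xT xa]; have : 0 < pos x by rewrite (pos_gt0 lv).
    by apply: le_lt_trans; rewrite leNgt pc.
  rewrite ltNge (ltW (neg a aA)) [~~ true]/=; case sk1: (onth (sort <=%O (enum A)) k.+1) => [b|] //.
  by have [bA _] := onth_sort_mem sk1; rewrite leNgt neg.
have cA : c \in A by rewrite AE inE cg cT ca.
have ltac : (pos a < pos c) = (a < c)%O.
  by rewrite ltNge (level_le lv) // aT /= ltNge.
rewrite ltac next //; case sk1: (onth (sort <=%O (enum A)) k.+1) => [b|] //.
have [/lvl[bg bT ba] _] := onth_sort_mem sk1.
by rewrite (level_le lv) // cT.
Qed.

End SortedFiltration.

(** * Orientations coherent with a spanning tree *)

Section Coherent.
Local Open Scope ring_scope.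
Variables (d : Order.disp_t) (V : finType) (E : finOrderType d).
Implicit Types (H : multigraph V E) (C D S A X : {set E}) (a b e f : E).

(** The orientations whose image under [alpha] is [T], described from the side of
the tree ([coherent_alpha]). *)
Record coherent (G : multigraph V E) (w : orientation E) (T : {set E})
    (F : E -> E -> rat) (pos : E -> int) : Prop := Coherent {
  co_sub : T \subset edges G;
  co_frame : tree_frame G w T F;
  co_level : levelling (edges G) T F pos;
  co_fit : fitted (edges G) F pos }.

Section CoherentTree.
Variables (G : multigraph V E) (w : orientation E) (T : {set E}).
Variables (F : E -> E -> rat) (pos : E -> int).
Hypothesis co : coherent G w T F pos.

Let TG := co_sub co.
Let fr := co_frame co.
Let lv := co_level co.
Let fit := co_fit co.
Let gr := edges G.

Lemma coherent_spanning_tree : spanning_tree G T.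
Proof. exact: frame_spanning_tree TG fr. Qed.

Lemma IntE : Int G T = [set x in gr | (x \in T) && active_in F x].
Proof.
rewrite (Int_active fr TG); apply/setP=> x; rewrite !inE.
by have [/(subsetP TG)->|] := boolP (x \in T); rewrite ?andbF.
Qed.

Lemma ExtE : Ext G T = [set x in gr | (x \in ~: T) && active_in F x].
Proof.
rewrite (Ext_active fr); apply/setP=> x; rewrite !inE.
by rewrite andbA [(x \in edges G) && _]andbC.
Qed.

Lemma coherent_dual_active : dual_active G w = Int G T.
Proof.
rewrite IntE; apply/setP=> a; rewrite !inE.
apply/existsP/idP => [[D /andP[dD aD]]|/(directed_is_min fr lv fit
  (directed_cocycle_supports G w) a).2[D dD aD]]; last by exists D; rewrite dD.
by apply/(directed_is_min fr lv fit (directed_cocycle_supports G w) a); exists D.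
Qed.

Let frC := frameC fr.
Let lvC := levellingC fr lv.
Let fitC := fittedC fit.

Lemma coherent_active : active G w = Ext G T.
Proof.
rewrite ExtE; apply/setP=> a; rewrite 2!inE.
apply/existsP/idP => [[D /andP[dD aD]]|/(directed_is_min frC lvC fitC
  (directed_cycle_supports G w) a).2[D dD aD]]; last by exists D; rewrite dD.
by apply/(directed_is_min frC lvC fitC (directed_cycle_supports G w) a); exists D.
Qed.

Definition below k := [set e in gr | pos e < k].
Definition upto k := [set e in gr | pos e <= k].

Lemma cocycles_above a : a \in Int G T ->
  \bigcup_(D | directed_cocycle G w D && min_ge a D) D = [set e in gr | pos a <= pos e].
Proof.
rewrite IntE inE => /and3P[ag aT aa]; apply/setP=> e; rewrite inE.
have cov := directed_cover fr lv fit (directed_cocycle_supports G w) e ag aT aa.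
apply/bigcupP/idP => [[D /andP[dD mD] eD]|/cov[D [dD eD mD]]].
  by apply/cov; exists D.
by exists D; rewrite // dD.
Qed.

Lemma cycles_above a : a \in Ext G T ->
  \bigcup_(C | directed_cycle G w C && min_ge a C) C = upto (pos a).
Proof.
rewrite ExtE inE => /and3P[ag aT aa]; apply/setP=> e; rewrite inE.
have cov := directed_cover frC lvC fitC (directed_cycle_supports G w) e ag aT aa.
rewrite lerN2 in cov.
apply/bigcupP/idP => [[D /andP[dD mD] eD]|/cov[D [dD eD mD]]].
  by apply/cov; exists D.
by exists D; rewrite // dD.
Qed.

Lemma filtration_up_at k a : onth (sort <=%O (enum (dual_active G w))) k = Some a ->
  filtration_up G w k = below (pos a) /\ filtration_up G w k.+1 = upto (pos a).
Proof.
have not_above b : b \in Int G T -> edges G :\: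
    (\bigcup_(D | directed_cocycle G w D && min_ge b D) D) = below (pos b).
  move=> bI; rewrite cocycles_above //; apply/setP=> e; rewrite !inE.
  by rewrite -/gr ltNge; case: (e \in gr); rewrite ?andbF ?andbT.
move=> sk; rewrite /filtration_up sk.
have [aI _] := onth_sort_mem sk; rewrite coherent_dual_active in aI sk *.
split; first exact: not_above.
have next := next_level fr lv IntE sk.
case sk1: onth next => [b|] next.
  have [bI _] := onth_sort_mem sk1; rewrite not_above //.
  apply/setP=> e; rewrite !inE; apply: andb_id2l => eg.
  by rewrite ltNge -next // leNgt.
apply/setP=> e; rewrite inE -/gr; have [eg|] := boolP (e \in gr) => //=.
by rewrite leNgt next.
Qed.

Lemma filtration_down_at k a : onth (sort <=%O (enum (active G w))) k = Some a ->
  filtration_down G w k = upto (pos a) /\ filtration_down G w k.+1 = below (pos a).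
Proof.
move=> sk; rewrite /filtration_down sk.
have [aI _] := onth_sort_mem sk; rewrite coherent_active in aI sk *.
split; first exact: cycles_above.
have next := next_level frC lvC ExtE sk.
case sk1: onth next => [b|] next.
  have [bI _] := onth_sort_mem sk1; rewrite cycles_above //.
  apply/setP=> e; rewrite !inE; apply: andb_id2l => eg.
  by have := next e eg; rewrite ltrN2 lerN2.
apply/setP=> e; rewrite !inE -/gr; have [eg|] := boolP (e \in gr) => //=.
by have := next e eg; rewrite ltrN2.
Qed.

Lemma upto_diff_below k : upto k :\: below k = level_set gr pos k.
Proof.
apply/setP=> e; rewrite !inE; case: (e \in gr); rewrite ?andbF //= -leNgt.
by rewrite andbC eq_le.
Qed.

(** Consecutive sets of the active filtration differ by one level. *)
Lemma active_partitionE :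
  active_partition G w = [set level_set gr pos (pos a) | a in Int G T :|: Ext G T].
Proof.
apply/setP=> X; rewrite inE; apply/orP/imsetP => [[]/imsetP[[k kA] _ ->]|[a]].
- have [a sk] := onth_sort_lt kA; have [-> ->] := filtration_up_at sk.
  have [aI _] := onth_sort_mem sk; rewrite coherent_dual_active in aI.
  by exists a; [rewrite in_setU aI | rewrite upto_diff_below].
- have [a sk] := onth_sort_lt kA; have [-> ->] := filtration_down_at sk.
  have [aI _] := onth_sort_mem sk; rewrite coherent_active in aI.
  by exists a; [rewrite in_setU aI orbT | rewrite upto_diff_below].
rewrite in_setU -coherent_dual_active -coherent_active => /orP[aA ->|aA ->].
  have [k kA sk] := onth_sort_index aA; left; apply/imsetP; exists (Ordinal kA) => //.
  by have [-> ->] := filtration_up_at sk; rewrite upto_diff_below.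
have [k kA sk] := onth_sort_index aA; right; apply/imsetP; exists (Ordinal kA) => //.
by have [-> ->] := filtration_down_at sk; rewrite upto_diff_below.
Qed.

Section LevelMinor.
Variable a : E.
Hypotheses (ag : a \in gr) (aa : active_in F a).
Let G' := contract (restrict G (upto (pos a))) (below (pos a)).
Let X := level_set gr pos (pos a).
Let T' := T :&: X.
Let F' x := cutoff gr pos (pos a) (F x).

Lemma level_minor_edges : edges G' = X.
Proof.
rewrite /= -/gr; apply/setP=> e; rewrite !inE.
by case: (e \in gr); rewrite ?andbF //= -leNgt andbC eq_le.
Qed.

(** Fundamental vectors of elements of the level, cut down to the level, are
vectors of the minor: those of flows live on levels at most that of [a], which
is what the restriction keeps, and those of tensions vanish on the
contracted levels. *)
Lemma level_minor_frame : tree_frame G' w T' F'.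
Proof.
have sub : below (pos a) \subset upto (pos a).
  by apply/subsetP=> e; rewrite !inE => /andP[-> /ltW].
have dpX : dual_pair X (tension G' w) (flow G' w).
  by rewrite -level_minor_edges; apply: graph_dual_pair.
have cutE u : minor_part G (upto (pos a)) (below (pos a)) u =1 cutoff gr pos (pos a) u.
  by move=> e; rewrite /minor_part -/G' level_minor_edges.
rewrite /tree_frame level_minor_edges.
apply: (@frame_eq _ _ _ _ _ T) => [x xX|]; first by rewrite inE xX andbT.
apply: (frame_level fr dpX) => x /level_setP[xg px] xT.
  have Kx := tension_fund fr TG xT.
  apply: (linear_ext (dp_linl dpX) _ (cutE (F x))).
  apply: minor_tension Kx _ => // e; rewrite inE => /andP[eg pe].
  apply/eqP; apply: contraLR pe => Fe; rewrite -leNgt -px.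
  have [->//|ex] := eqVneq e x.
  apply: (lv_le lv) => //.
  by rewrite (fr_side fr xg ex Fe) xT.
have Lx := flow_fund fr xg xT.
apply: (linear_ext (dp_linr dpX) _ (cutE (F x))).
apply: minor_flow Lx _ => // e; rewrite inE => pe.
apply/eqP; apply: contraNT pe => Fe; have eg := fr_supp fr xg Fe.
rewrite eg -px /=; have [->//|ex] := eqVneq e x.
apply: (lv_le lv) => //; first by rewrite (fr_side fr xg ex Fe).
by rewrite (fr_neq0C fr).
Qed.

Let frX := level_minor_frame.
Let aX : a \in X. Proof. by rewrite inE ag eqxx. Qed.
Let XG' : edges G' = X := level_minor_edges.

Lemma level_active_unique x : x \in X -> active_in F x -> x = a.
Proof.
by move=> /level_setP[xg px] xa; apply: (level_inj lv).
Qed.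

Lemma level_min x : x \in X -> (a <= x)%O.
Proof.
move=> /level_setP[xg px]; have [b [bg ba bx pb]] := level_active fr lv xg.
by rewrite -(@level_active_unique b) // inE bg pb px eqxx.
Qed.

Lemma level_minor_opposed x : x \in X -> x != a -> opposed F' x.
Proof.
move=> xX xa; apply: (opposed_level fr lv fit) => //.
by apply: contra xa => /(level_active_unique xX)->.
Qed.

Lemma level_minor_lv : levelling (edges G') T' F' pos.
Proof.
rewrite XG'; apply: (@levelling_eq _ _ _ T) => [x xX|]; first by rewrite inE xX andbT.
exact: levelling_level fr lv.
Qed.

Lemma level_minor_fit : fitted (edges G') F' pos.
Proof. by rewrite XG'; apply: fitted_level fr lv fit. Qed.

Lemma level_minor_active x : x \in X -> active_in F' x -> x = a.
Proof.
by move=> xX; rewrite (active_level fr lv) //; apply: level_active_unique.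
Qed.

Lemma level_minor_bipolar : a \in T -> bipolar G' w a.
Proof.
move=> aT; have aT' : a \in T' by rewrite inE aT aX.
have aG' : a \in edges G' by rewrite XG'.
have aa' : active_in F' a by rewrite (active_level fr lv).
have dir := directed_cocycle_supports G' w.
apply/andP; split.
  apply/'forall_implyP => e eG'; apply/existsP.
  have := directed_cover frX level_minor_lv level_minor_fit dir e aG' aT' aa'.
  rewrite eG'; move: eG'; rewrite XG' => /level_setP[_ ->].
  by rewrite lexx => -[_ /(_ isT)[D [dD eD _]]]; exists D; rewrite dD.
apply/forallP=> D; apply/implyP=> dD.
have [b [bG' bT' ba bD _]] := directed_min frX level_minor_lv level_minor_fit dir dD.
by rewrite -(level_minor_active _ ba) // -XG'.
Qed.

Lemma level_minor_cyclic_bipolar : a \notin T -> cyclic_bipolar G' w a.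
Proof.
move=> aT; have aT' : a \in ~: T' by rewrite !inE (negbTE aT).
have aG' : a \in edges G' by rewrite XG'.
have aa' : active_in F' a by rewrite (active_level fr lv).
have dir := directed_cycle_supports G' w.
have frXC := frameC frX; have lvXC := levellingC frX level_minor_lv.
have fitXC := fittedC level_minor_fit.
apply/andP; split.
  apply/'forall_implyP => e eG'; apply/existsP.
  have := directed_cover frXC lvXC fitXC dir e aG' aT' aa'.
  rewrite eG'; move: eG'; rewrite XG' => /level_setP[_ ->].
  by rewrite lexx => -[_ /(_ isT)[D [dD eD _]]]; exists D; rewrite dD.
apply/forallP=> D; apply/implyP=> dD.
have [b [bG' bT' ba bD _]] := directed_min frXC lvXC fitXC dir dD.
by rewrite -(level_minor_active _ ba) // -XG'.
Qed.

(** In the minor, [a] is the only active element and the smallest edge, so the tree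
induced by [T] satisfies the criterion, and [opposed_frames_eq] shows that no
other tree does. *)
Lemma alpha_level_minor : alpha_bipolar G' w = T'.
Proof.
have T'G' : T' \subset edges G' by rewrite XG' subsetIr.
have minX : is_min a (edges G').
  rewrite XG' /is_min aX; apply/'forall_implyP; exact: level_min.
have opp' x : x \in edges G' -> x != a -> opposed F' x.
  by rewrite XG'; apply: level_minor_opposed.
have excl : bipolar G' w a -> cyclic_bipolar G' w a -> False.
  case/andP=> /'forall_implyP/(_ a) h1 _ /andP[/'forall_implyP/(_ a) h2 _].
  have aG' : a \in edges G' by rewrite XG'.
  have /existsP[D /andP[dD aD]] := h1 aG'; have /existsP[C /andP[dC aC]] := h2 aG'.
  exact: directed_supports_disjoint (graph_dual_pair G' w)
    (directed_cocycle_supports G' w) (directed_cycle_supports G' w) dD dC aD aC.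
rewrite /alpha_bipolar; case: pickP => [T1 /andP[span1]|none] /=; last first.
  have := none T'; rewrite (frame_spanning_tree T'G' frX) /= => /negbT/existsP[].
  exists a; rewrite minX /=; apply/orP.
  have [aT|aT] := boolP (a \in T); [left|right].
    rewrite level_minor_bipolar //; apply/(bipolar_criterionP _ frX T'G') => x xG' xp.
    apply: opp' => //; apply/eqP => xa; move: xp.
    by rewrite xa inE aT aX eqxx => /(_ isT).
  rewrite level_minor_cyclic_bipolar //.
  apply/(cyclic_bipolar_criterionP _ frX T'G') => x xG' xp.
  apply: opp' => //; apply/eqP => xa; move: xp.
  by rewrite xa inE (negbTE aT) eqxx => /(_ isT).
case/existsP=> p /andP[minp crit1].
have pa : p = a.
  case/andP: minp => pG' /'forall_implyP pmin; case/andP: minX => aG' /'forall_implyP amin.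
  by apply/le_anti; rewrite pmin ?amin.
rewrite {p minp}pa in crit1.
have [F1 fr1] := spanning_tree_frame w span1.
have T1G' := spanning_tree_sub span1.
have aG' : a \in edges G' by rewrite XG'.
have not_opp : ~ opposed F1 a.
  move=> [m [Fm mP]].
  have mG' : m \in edges G' by apply: (fr_supp fr1 aG'); rewrite lt_eqF.
  have ma : m = a.
    apply/le_anti; rewrite mP ?(fr_diag fr1) ?oner_eq0 //=.
    by case/andP: minX => _ /'forall_implyP; apply.
  by move: Fm; rewrite ma (fr_diag fr1 aG') ltr10.
have [opp1 aT1] : (forall x, x \in edges G' -> x != a -> opposed F1 x) /\
    (a \in T1) = (a \in T').
  case/orP: crit1 => /andP[bip crit].
    have aT : a \in T.
      by apply: contraT => /level_minor_cyclic_bipolar/(excl bip).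
    have c1 := (bipolar_criterionP a fr1 T1G').1 crit; split=> [x xG' xa|].
      exact: c1.
    rewrite inE aT aX /=; apply: contraT => aT1; case: not_opp.
    by apply: c1 => // aT1'; rewrite aT1' in aT1.
  have aT : a \notin T.
    by apply: contraT => /negPn/level_minor_bipolar/excl/(_ bip).
  have c1 := (cyclic_bipolar_criterionP a fr1 T1G').1 crit; split=> [x xG' xa|].
    exact: c1.
  rewrite inE (negbTE aT) /=; apply/negbTE/negP => aT1; case: not_opp.
  by apply: c1 => //; rewrite aT1.
have delta_opp F0 : (forall x, x \in edges G' -> x != a -> opposed F0 x) ->
    forall f, (f \in edges G') && ((f \in T1) != (f \in T')) -> opposed F0 f.
  move=> opp0 f /andP[fG' fTT]; apply: opp0 => //.
  by apply: contraNneq fTT => ->; rewrite aT1.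
apply/setP=> x; have [xG'|xG'] := boolP (x \in edges G').
  exact: (opposed_frames_eq fr1 frX (delta_opp _ opp1) (delta_opp _ opp') xG').
by rewrite (contraNF (subsetP T1G' x)) // (contraNF (subsetP T'G' x)).
Qed.

End LevelMinor.

Lemma coherent_alpha : alpha G w = T.
Proof.
have lvl a : a \in Int G T :|: Ext G T -> a \in gr /\ active_in F a.
  by rewrite IntE ExtE !inE => /orP[]/and3P[].
apply/setP=> e; rewrite in_setU; apply/orP/idP => [[]/bigcupP[[k kA] _]|eT].
- have [a sk] := onth_sort_lt kA; have [-> ->] := filtration_up_at sk.
  have [aI _] := onth_sort_mem sk; rewrite coherent_dual_active in aI.
  have [|ag aa] := lvl a; first by rewrite in_setU aI.
  by rewrite alpha_level_minor // inE => /andP[].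
- have [a sk] := onth_sort_lt kA; have [-> ->] := filtration_down_at sk.
  have [aI _] := onth_sort_mem sk; rewrite coherent_active in aI.
  have [|ag aa] := lvl a; first by rewrite in_setU aI orbT.
  by rewrite alpha_level_minor // inE => /andP[].
have eg := subsetP TG e eT; have [a [ag aa _ pa]] := level_active fr lv eg.
have [aT|aT] := boolP (a \in T); [left|right].
  have aI : a \in dual_active G w by rewrite coherent_dual_active IntE inE ag aT aa.
  have [k kA sk] := onth_sort_index aI; apply/bigcupP; exists (Ordinal kA) => //.
  have [-> ->] := filtration_up_at sk.
  by rewrite alpha_level_minor // !inE eT eg pa eqxx.
have aI : a \in active G w by rewrite coherent_active ExtE !inE ag aT aa.
have [k kA sk] := onth_sort_index aI; apply/bigcupP; exists (Ordinal kA) => //.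
have [-> ->] := filtration_down_at sk.
by rewrite alpha_level_minor // !inE eT eg pa eqxx.
Qed.

End CoherentTree.
End Coherent.

(** * The refined mapping is a bijection *)

Section Bijection.
Local Open Scope ring_scope.
Variables (d : Order.disp_t) (V : finType) (E : finOrderType d).
Implicit Types (C D S A B T X : {set E}) (a b e f x : E) (w : orientation E).
Implicit Types (F : E -> E -> rat) (pos : E -> int).

Lemma tree_frame_reorient (G : multigraph V E) w A T F : tree_frame G w T F ->
  tree_frame G (reorient A w) T (twist A F).
Proof.
move=> fr; apply: (frame_twist (graph_dual_pair _ _) _ _ fr) => u.
  by move/(tension_disagree (reorient A w)); rewrite disagree_reorient.
by move/(flow_disagree (reorient A w)); rewrite disagree_reorient.
Qed.

Lemma coherent_twist (G : multigraph V E) w A T F pos : coherent G w T F pos ->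
  fitted (edges G) (twist A F) pos ->
  coherent G (reorient A w) T (twist A F) pos.
Proof.
move=> [TG fr lv _] fitA; split=> //; last exact: levelling_twist.
exact: tree_frame_reorient.
Qed.

(** Only products of signs within one level matter, and both factors change
together. *)
Lemma coherent_reverse_levels (G : multigraph V E) w A T F pos :
  coherent G w T F pos ->
  {in edges G &, forall x y, pos x = pos y -> (x \in A) = (y \in A)} ->
  coherent G (reorient A w) T (twist A F) pos.
Proof.
move=> co Alev; apply: (coherent_twist co); case: (co) => TG fr lv fit.
move=> x xg; rewrite active_twist => xa.
have [m [mg mx mT [Fm pm mP]]] := fitted_min fr fit xg xa.
exists m; split=> //; last by move=> y; rewrite twist_neq0; apply: mP.
by rewrite /twist /flip (Alev x m) // -/(flip A m) flip_mulxx mul1r.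
Qed.

Lemma coherent_exists (G : multigraph V E) w T S : spanning_tree G T ->
  exists w', (exists F pos, coherent G w' T F pos) /\
    {in Int G T :|: Ext G T, forall x, (w' x != w x) = (x \in S)}.
Proof.
move=> tT; have TG := spanning_tree_sub tT.
have [F fr] := spanning_tree_frame w tT.
have [pos lv] := levelling_exists fr.
have [A [fitA AS]] := fitted_exists S fr lv.
exists (reorient A w); split.
  exists (twist A F), pos; split=> //; last exact: levelling_twist.
  exact: tree_frame_reorient.
move=> x; rewrite in_setU (Int_active fr TG) (Ext_active fr) !inE => xA.
rewrite ffunE -AS; first by case: (w x); case: (x \in A).
  by case/orP: xA => /andP[]; [move/(subsetP TG)|case/andP].
by case/orP: xA => /andP[].
Qed.

Section Refined.
Variables (G : multigraph V E) (w0 : orientation E).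
Hypothesis EG : edges G = [set: E].

Lemma in_edges x : x \in edges G. Proof. by rewrite EG inE. Qed.

(** The refined mapping, as a function of the orientation rather than of the set of
reversed edges. *)
Definition phi w := alpha_refined G w0 (disagree w0 w).

Lemma reorient_disagree w w' : reorient (disagree w w') w = w'.
Proof.
by apply/ffunP=> x; rewrite ffunE inE; case: (w x); case: (w' x).
Qed.

Lemma phi_reorient A : phi (reorient A w0) = alpha_refined G w0 A.
Proof. by rewrite /phi disagree_reorient. Qed.

Definition activities T := Int G T :|: Ext G T.

Lemma Int_sub_tree T x : x \in Int G T -> x \in T.
Proof. by rewrite inE => /andP[]. Qed.

Lemma Ext_notin_tree T x : x \in Ext G T -> x \notin T.
Proof. by rewrite !inE => /andP[/andP[]]. Qed.

(** The coordinate of an orientation inside its activity class. *)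
Definition switched w := [set x in activities (alpha G w) | w x != w0 x].

Definition symdiff A B := (A :\: B) :|: (B :\: A).

Lemma in_symdiff A B x : (x \in symdiff A B) = ((x \in A) != (x \in B)).
Proof. by rewrite !inE; case: (x \in A); case: (x \in B). Qed.

Lemma symdiffK A B : symdiff A (symdiff A B) = B.
Proof. by apply/setP=> x; rewrite !in_symdiff; case: (x \in A); case: (x \in B). Qed.

Lemma coherent_phi w T F pos : coherent G w T F pos -> phi w = symdiff T (switched w).
Proof.
move=> co; apply/setP=> x; rewrite in_symdiff /switched /phi /alpha_refined reorient_disagree.
rewrite (coherent_alpha co) (coherent_active co) (coherent_dual_active co).
rewrite [in RHS]in_set /activities !(in_setU, in_setI, in_setD).
have -> : (x \in disagree w0 w) = (w x != w0 x) by rewrite inE eq_sym.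
have := @Int_sub_tree T x; have := @Ext_notin_tree T x.
by case: (x \in T); case: (x \in Int G T); case: (x \in Ext G T);
  case: (w x != w0 x) => // h1 h2; first [by have := h1 isT | by have := h2 isT].
Qed.

Lemma coherent_switched T S : spanning_tree G T -> S \subset activities T ->
  exists w, [/\ exists F pos, coherent G w T F pos, alpha G w = T & switched w = S].
Proof.
move=> tT SA; have [w [[F [pos co]] wS]] := coherent_exists w0 S tT.
have aT := coherent_alpha co; exists w; split=> //; first by exists F, pos.
apply/setP=> x; rewrite inE aT; apply/andP/idP => [[xA]|xS]; first by rewrite wS.
by have xA := subsetP SA x xS; rewrite wS.
Qed.

(** For [B] in the interval of [T], choose the directions of the active elements of
[T] according to [B] and let the others follow. *)
Lemma phi_surjective B : exists w, (exists T F pos, coherent G w T F pos) /\ phi w = B.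
Proof.
have [T0 tT0] := spanning_tree_exists G.
have [F0 fr0] := spanning_tree_frame w0 tT0.
have [T [F [fr TG near]]] := frame_near B fr0 (spanning_tree_sub tT0).
have tT := frame_spanning_tree TG fr.
have [|w [[F1 [pos co]] aT sw]] := @coherent_switched T (symdiff T B) tT.
  apply/subsetP=> x; rewrite in_symdiff => /(near x (in_edges x)) xa.
  rewrite /activities in_setU (Int_active fr TG) (Ext_active fr) !inE xa in_edges.
  by case: (x \in T).
by exists w; split; [exists T, F1, pos | rewrite (coherent_phi co) sw symdiffK].
Qed.

Lemma card_orientation : #|{set E}| = #|orientation E|.
Proof. by rewrite -cardsT -powersetT card_powerset cardsT card_ffun card_bool. Qed.

(** There are as many orientations as subsets. *)
Lemma phi_inj : injective phi.
Proof.
have phiT : phi @: [set: orientation E] = [set: {set E}].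
  apply/setP=> B; rewrite inE; apply/imsetP.
  by have [w [_ <-]] := phi_surjective B; exists w.
have : #|phi @: [set: orientation E]| == #|[set: orientation E]|.
  by rewrite phiT !cardsT card_orientation.
by move/imset_injP => inj w w'; apply: inj; rewrite inE.
Qed.

Lemma phi_bijective : bijective phi.
Proof. by apply: inj_card_bij phi_inj _; rewrite card_orientation. Qed.

(** By injectivity, the coherent orientations found in [phi_surjective] are all the
orientations.  This also settles the existence of the tree in the definition
of [alpha] on bipolar and cyclic-bipolar digraphs. *)
Lemma all_coherent w : exists F pos, coherent G w (alpha G w) F pos.
Proof.
have [w' [[T [F [pos co]]] /phi_inj <-]] := phi_surjective (phi w).
by exists F, pos; rewrite (coherent_alpha co).
Qed.

Lemma alpha_tree w : spanning_tree G (alpha G w).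
Proof. by have [F [pos co]] := all_coherent w; apply: coherent_spanning_tree co. Qed.

Lemma activeE w : active G w = Ext G (alpha G w).
Proof. by have [F [pos co]] := all_coherent w; apply: coherent_active co. Qed.

Lemma dual_activeE w : dual_active G w = Int G (alpha G w).
Proof. by have [F [pos co]] := all_coherent w; apply: coherent_dual_active co. Qed.

Lemma phiE w : phi w = symdiff (alpha G w) (switched w).
Proof. by have [F [pos co]] := all_coherent w; apply: coherent_phi co. Qed.

Lemma alpha_switched_inj w w' : alpha G w = alpha G w' -> switched w = switched w' -> w = w'.
Proof. by move=> aa ss; apply: phi_inj; rewrite !phiE aa ss. Qed.

Lemma in_interval T B : (B \in tree_interval G T) = (symdiff T B \subset activities T).
Proof.
rewrite inE; apply/andP/subsetP => [[/subsetP h1 /subsetP h2] x|h].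
  rewrite in_symdiff /activities in_setU; have := h1 x; have := h2 x.
  rewrite in_setU in_setD.
  case: (x \in Int G T); case: (x \in Ext G T); case: (x \in T); case: (x \in B) => //=;
    by move=> h1' h2'; first [by have := h1' isT | by have := h2' isT].
split; apply/subsetP => x; have := h x; rewrite in_symdiff /activities !in_setU ?in_setD;
  have := @Int_sub_tree T x; have := @Ext_notin_tree T x.
  case: (x \in Int G T); case: (x \in Ext G T); case: (x \in T); case: (x \in B) => //=;
    by move=> h1 h2 h3 _; first [by have := h1 isT | by have := h2 isT | by have := h3 isT].
case: (x \in Int G T); case: (x \in Ext G T); case: (x \in T); case: (x \in B) => //=;
    by move=> h1 h2 h3 _; first [by have := h1 isT | by have := h2 isT | by have := h3 isT].
Qed.

Lemma switched_sub w : switched w \subset activities (alpha G w).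
Proof. by apply/subsetP=> x; rewrite inE => /andP[]. Qed.

Lemma phi_in_interval w T : spanning_tree G T ->
  (phi w \in tree_interval G T) = (alpha G w == T).
Proof.
move=> tT; rewrite in_interval; apply/idP/eqP => [sub|<-]; last first.
  by rewrite phiE symdiffK switched_sub.
have [w' [_ aT sw]] := coherent_switched tT sub.
suff -> : w = w' by [].
by apply: phi_inj; rewrite [RHS]phiE aT sw symdiffK.
Qed.

Lemma tree_of_phi w : tree_of G (phi w) = alpha G w.
Proof.
rewrite /tree_of; case: pickP => [T /andP[tT]|none] /=.
  by rewrite phi_in_interval // => /eqP.
by have := none (alpha G w); rewrite alpha_tree phi_in_interval ?alpha_tree // eqxx.
Qed.

Lemma mem_level_cover pos (Z : {set {set E}}) T x :
  Z \subset [set level_set (edges G) pos (pos a) | a in activities T] ->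
  (x \in cover Z) = (level_set (edges G) pos (pos x) \in Z).
Proof.
move/subsetP=> ZP; apply/bigcupP/idP => [[X XZ xX]|xZ].
  have /imsetP[a _ XE] := ZP X XZ.
  by move: xX XZ; rewrite {}XE inE => /andP[_ /eqP <-].
by exists (level_set (edges G) pos (pos x)); rewrite // inE in_edges eqxx.
Qed.

(** Reversing parts keeps the orientation coherent with the same tree.  Conversely,
reversing the parts of the active elements where [w] and [w'] disagree yields
an orientation with the tree and the switched elements of [w'], hence [w']
itself. *)
Lemma activity_classE w : activity_class G w = [set w' | alpha G w' == alpha G w].
Proof.
have [F [pos co]] := all_coherent w.
have partE := active_partitionE co; rewrite -/(activities _) in partE.
apply/setP=> w'; rewrite inE; apply/imsetP/eqP => [[Z]|aa].
  rewrite inE partE => ZP ->.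
  have cov x := mem_level_cover x ZP.
  apply: coherent_alpha (coherent_reverse_levels co _) => x y _ _ pxy.
  by rewrite !cov pxy.
pose Z := [set level_set (edges G) pos (pos a) | a in
  [set a in activities (alpha G w) | w' a != w a]].
have ZP : Z \subset [set level_set (edges G) pos (pos a) | a in activities (alpha G w)].
  by apply: imsetS; apply/subsetP=> a; rewrite inE => /andP[].
have cov x := mem_level_cover x ZP.
exists Z; first by rewrite inE partE.
have co' : coherent G (reorient (cover Z) w) (alpha G w) (twist (cover Z) F) pos.
  by apply: coherent_reverse_levels co _ => x y _ _ pxy; rewrite !cov pxy.
have aa' := coherent_alpha co'.
apply: alpha_switched_inj; rewrite ?aa' // /switched aa aa'.
apply/setP=> x; rewrite [in LHS]inE [in RHS]inE; apply: andb_id2l => xA.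
suff -> : reorient (cover Z) w x = w' x by [].
rewrite ffunE cov.
suff -> : (level_set (edges G) pos (pos x) \in Z) = (w' x != w x).
  by case: (w x); case: (w' x).
apply/imsetP/idP => [[a]|w'x]; last by exists x; rewrite // inE xA.
rewrite inE => /andP[aA w'a] lev.
suff -> : x = a by [].
have lvl b : b \in activities (alpha G w) -> active_in F b.
  by rewrite /activities in_setU (IntE co) (ExtE co) !inE => /orP[]/and3P[].
apply: (level_inj (co_level co)); rewrite ?in_edges ?lvl //.
have : x \in level_set (edges G) pos (pos x) by rewrite inE in_edges eqxx.
by rewrite lev inE => /andP[_ /eqP].
Qed.

Lemma active_fixedE w' w : active_fixed G w' w =
  [forall x in Ext G (alpha G w), w x == w' x].
Proof. by rewrite /active_fixed activeE. Qed.

Lemma dual_active_fixedE w' w : dual_active_fixed G w' w =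
  [forall x in Int G (alpha G w), w x == w' x].
Proof. by rewrite /dual_active_fixed dual_activeE. Qed.

Lemma fixedP w : active_fixed G w0 w && dual_active_fixed G w0 w = (switched w == set0).
Proof.
rewrite active_fixedE dual_active_fixedE; apply/andP/eqP => [[]|sw].
  move=> /'forall_implyP h1 /'forall_implyP h2; apply/setP=> x; rewrite in_set0 in_set.
  apply/negP => /andP[]; rewrite in_setU.
  by case/orP=> [/h2->|/h1->].
split; apply/'forall_implyP => x xA; rewrite -[_ == _]negbK; apply/negP => wx;
  have : x \in switched w by rewrite in_set /activities in_setU xA ?orbT.
  by rewrite sw inE.
by rewrite sw inE.
Qed.

End Refined.
End Bijection.

(** * Evaluations of the Tutte polynomial *)

Section Tutte.
Local Open Scope ring_scope.
Variables (d : Order.disp_t) (V : finType) (E : finOrderType d).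

Lemma tutte_atE (G : multigraph V E) x y : tutte_at G x y =
  (\sum_(T : {set E} | spanning_tree G T) x ^ #|Int G T| * y ^ #|Ext G T|)%N.
Proof.
pose N := #|E|.
rewrite (partition_big (fun T => inord #|Int G T| : 'I_N.+1) xpredT) //=.
rewrite /tutte_at /tutte !horner_sum; apply: eq_bigr => i _.
rewrite (partition_big (fun T => inord #|Ext G T| : 'I_N.+1) xpredT) //=.
rewrite !horner_sum; apply: eq_bigr => j _.
rewrite hornerCM hornerXn -rmorphXn /= hornerM hornerC hornerMn hornerXn.
have -> : y ^+ j *+ tutte_coef G i j * x ^+ i = (tutte_coef G i j * (x ^ i * y ^ j))%N.
  by rewrite -mulr_natl natn -mulrA [_ * x ^+ i]mulrC.
have ordE (k : 'I_N.+1) S : (inord #|S : {set E}| == k) = (#|S| == k :> nat).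
  by rewrite -val_eqE /= inordK // ltnS max_card.
rewrite (eq_bigr (fun=> x ^ i * y ^ j)%N) => [|T /andP[/andP[_]]]; last first.
  by rewrite !ordE => /eqP-> /eqP->.
rewrite sum_nat_const; congr (_ * _)%N.
by apply: eq_card => T; rewrite !inE unfold_in /= !ordE andbA.
Qed.

End Tutte.

(** * Activity classes, intervals and types of orientations *)

Section Consequences.
Variables (d : Order.disp_t) (V : finType) (E : finOrderType d).
Implicit Types (C D S A B T X : {set E}) (a b e f x : E) (w : orientation E).
Variables (G : multigraph V E) (w0 : orientation E).
Hypothesis EG : edges G = [set: E].

Local Notation phi := (phi G w0).
Local Notation switched := (switched G w0).
Local Notation activities := (activities G).

Lemma representativeP w : alpha G (representative G w0 w) = alpha G w /\
  switched (representative G w0 w) = set0.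
Proof.
rewrite /representative; case: pickP => [r|none] /=.
  by rewrite activity_classE // inE (fixedP w0 EG) => /andP[/eqP-> /eqP->].
have [|r [_ ar sr]] := @coherent_switched _ _ _ G w0 _ set0 (alpha_tree w0 EG w).
  exact: sub0set.
by have := none r; rewrite activity_classE // inE (fixedP w0 EG) ar sr !eqxx.
Qed.

(** Two orientations of one class differ on a whole part or nowhere on it, so the
smallest element of the part decides; there the representative agrees with
the reference orientation. *)
Lemma class_codeE w : class_code G w0 w = switched w.
Proof.
have [F [pos co]] := all_coherent w0 EG w.
have partE := active_partitionE co; rewrite -/(activities _) in partE.
have [ar sr] := representativeP w; set r := representative G w0 w in ar sr *.
have lvl b : b \in activities (alpha G w) -> b \in edges G /\ active_in F b.
  by rewrite /activities in_setU (IntE co) (ExtE co) !inE => /orP[]/and3P[].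
have same e f : e \in edges G -> f \in edges G -> pos e = pos f ->
    (w e != r e) = (w f != r f).
  have : r \in activity_class G w by rewrite activity_classE // inE ar.
  case/imsetP=> Z; rewrite inE partE => ZP rE eg fg pef.
  have cov := mem_level_cover EG _ ZP.
  have dif g : (w g != r g) = (g \in cover Z).
    by rewrite rE ffunE; case: (w g); case: (g \in cover Z).
  by rewrite !dif !cov pef.
have ra a : a \in activities (alpha G w) -> r a = w0 a.
  move=> aA; apply/eqP; rewrite -[_ == _]negbK; apply/negP => rwa.
  have : a \in switched r by rewrite in_set ar aA.
  by rewrite sr inE.
apply/setP=> a; rewrite [in LHS]in_set [in RHS]in_set.
apply/existsP/andP => [[X /and3P[XP aX /existsP[e /andP[eX we]]]]|[aA wa]].
  move: XP; rewrite partE => /imsetP[b bA XE].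
  have [bg ba] := lvl b bA.
  have ab : a = b.
    case/andP: aX => aX /'forall_implyP amin; apply/le_anti; rewrite amin ?XE.
      by rewrite (level_min co bg ba) // -XE.
    by rewrite inE bg eqxx.
  rewrite ab bA -(ra b bA); split=> //.
  by move: eX; rewrite XE => /level_setP[eg pe]; rewrite (same b e).
have [ag aa] := lvl a aA.
exists (level_set (edges G) pos (pos a)); apply/and3P; split.
- by rewrite partE; apply/imsetP; exists a.
- apply/andP; split; first by rewrite inE ag eqxx.
  by apply/'forall_implyP => e; apply: (level_min co ag aa).
by apply/existsP; exists a; rewrite inE ag eqxx ra.
Qed.

Lemma interval_codeE w : P_sub G (phi w) :|: Q_sub G (phi w) = switched w.
Proof.
rewrite /P_sub /Q_sub (tree_of_phi w0 EG) (phiE w0 EG).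
set T := alpha G w; have sub := subsetP (switched_sub G w0 w).
apply/setP=> x; rewrite in_setU in_setD in_setI !in_symdiff.
have := sub x; have := @Int_sub_tree _ _ _ G T x; have := @Ext_notin_tree _ _ _ G T x.
rewrite /activities -/T in_setU.
case: (x \in Int G T); case: (x \in Ext G T); case: (x \in T);
  case: (x \in switched w) => //= h1 h2 h3;
  first [by have := h1 isT | by have := h2 isT | by have := h3 isT].
Qed.

Lemma phi_image_class w : phi @: activity_class G w = tree_interval G (alpha G w).
Proof.
have tT := alpha_tree w0 EG w.
apply/setP=> B; apply/imsetP/idP => [[w' w'C ->]|].
  by rewrite (phi_in_interval _ EG) //; move: w'C; rewrite activity_classE // inE.
have [w' [_ <-]] := phi_surjective w0 EG B; rewrite (phi_in_interval _ EG) // => aa.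
by exists w'; rewrite // activity_classE // inE.
Qed.

Lemma phi_order_isomorphism w : order_isomorphism phi (activity_class G w)
  (class_le G w0) (tree_interval G (alpha G w)) (interval_le G).
Proof.
split; first by move=> ? ? _ _; apply: (phi_inj EG).
  exact: phi_image_class.
move=> w1 w2 _ _; rewrite /class_le /interval_le (class_codeE w1) (class_codeE w2).
exact: (f_equal2 (fun X Y : {set E} => X \subset Y)
  (esym (interval_codeE w1)) (esym (interval_codeE w2))).
Qed.

(** An orientation amounts to its tree and an arbitrary set of switched active
elements, whose internal and external parts may be constrained separately. *)
Lemma card_switched_condition (f g : rel {set E}) (x y : nat) :
  (forall I, #|[set P in powerset I | f I P]| = x ^ #|I|) ->
  (forall I, #|[set P in powerset I | g I P]| = y ^ #|I|) ->
  #|[set w | f (Int G (alpha G w)) (switched w :&: Int G (alpha G w)) &&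
             g (Ext G (alpha G w)) (switched w :&: Ext G (alpha G w))]|
  = tutte_at G x y.
Proof.
move=> cf cg; rewrite tutte_atE -sum1_card (partition_big (alpha G) (spanning_tree G)) /=;
  last by move=> w _; apply: alpha_tree.
apply: eq_bigr => T tT; rewrite sum1_card -cf -cg -cardsX.
pose h w := (switched w :&: Int G T, switched w :&: Ext G T).
have disj : [disjoint Int G T & Ext G T].
  rewrite disjoint_subset; apply/subsetP=> z /Int_sub_tree zT.
  by rewrite inE; apply: contraL zT => /Ext_notin_tree.
rewrite -(card_in_imset (f := h) (D := [pred w | (w \in [set w |
   f (Int G (alpha G w)) (switched w :&: Int G (alpha G w)) &&
   g (Ext G (alpha G w)) (switched w :&: Ext G (alpha G w))]) && (alpha G w == T)])).
  apply: eq_card => -[P Q]; rewrite in_setX !inE /=; apply/imsetP/idP => /=.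
    case=> w; rewrite !inE => /andP[/andP[fP gP] /eqP aT] [-> ->].
    by rewrite !subsetIr -aT fP gP.
  case/andP=> /andP[PI fP] /andP[QE gQ].
  have [|w [_ aT sw]] := @coherent_switched _ _ _ G w0 T (P :|: Q) tT.
    by rewrite /activities setUSS.
  have sP : switched w :&: Int G T = P.
    rewrite sw setIUl (setIidPl PI) (_ : Q :&: _ = set0) ?setU0 //.
    apply/eqP; rewrite setI_eq0 disjoint_sym; exact: disjointWr QE disj.
  have sQ : switched w :&: Ext G T = Q.
    rewrite sw setIUl (setIidPl QE) (_ : P :&: _ = set0) ?set0U //.
    apply/eqP; rewrite setI_eq0; exact: disjointWl PI disj.
  by exists w; rewrite ?inE ?aT /h ?sP ?sQ ?fP ?gQ ?eqxx.
move=> w w'; rewrite !inE => /andP[_ /eqP aT] /andP[_ /eqP aT'] [sI sE].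
apply: (alpha_switched_inj EG (w0 := w0)); first by rewrite aT.
have split_sw v : alpha G v = T -> switched v =
    (switched v :&: Int G T) :|: (switched v :&: Ext G T).
  move=> av; rewrite -setIUr; apply/esym/setIidPl.
  by have := switched_sub G w0 v; rewrite av.
by rewrite (split_sw w) // (split_sw w') // sI sE.
Qed.

Lemma card_any I : #|[set P in powerset I | true]| = 2 ^ #|I : {set E}|.
Proof. by rewrite -card_powerset; apply: eq_card => P; rewrite !inE andbT. Qed.

Lemma card_none I : #|[set P in powerset I | I == set0]| = 0 ^ #|I : {set E}|.
Proof.
have [->|I0] := eqVneq I set0.
  rewrite cards0 expn0 -[RHS](cards1 (set0 : {set E})); apply: eq_card => P.
  by rewrite !inE andbT subset0.
have : (0 < #|I|)%N by rewrite card_gt0.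
case: #|I| => // n _; rewrite exp0n //; apply: eq_card0 => P.
by rewrite !inE andbF.
Qed.

Lemma card_bottom I : #|[set P in powerset I | P == set0]| = 1 ^ #|I : {set E}|.
Proof.
rewrite exp1n -[RHS](cards1 (set0 : {set E})); apply: eq_card => P; rewrite !inE.
by case: eqP => [->|]; rewrite ?sub0set ?andbF.
Qed.

Lemma card_top I : #|[set P in powerset I | P == I]| = 1 ^ #|I : {set E}|.
Proof.
rewrite exp1n -[RHS](cards1 I); apply: eq_card => P; rewrite !inE.
by case: eqP => [->|]; rewrite ?subxx ?andbF.
Qed.

Lemma phi_restricts (X : {set orientation E}) (Y : {set {set E}}) n :
  (forall w, (w \in X) = (phi w \in Y)) -> #|X| = n ->
  restricts_to_bijection phi X Y n.
Proof.
move=> XY cX; have inj := phi_inj (w0 := w0) EG.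
have im : phi @: X = Y.
  apply/setP=> B; apply/imsetP/idP => [[w wX ->]|]; first by rewrite -XY.
  by have [w [_ <-]] := phi_surjective w0 EG B; rewrite -XY; exists w.
by split=> //; [move=> ? ? _ _; apply: inj | rewrite -im card_imset].
Qed.

Lemma acyclicE w : acyclic G w = (Ext G (alpha G w) == set0).
Proof.
rewrite -(activeE w0 EG); apply/forallP/eqP => [ac|act0 C].
  apply/setP=> e; rewrite !inE; apply/existsP => -[C /andP[dC _]].
  by have := ac C; rewrite dC.
apply/negP => dC; have [u [_ _ [e eC]]] := (directed_cycle_supports G w).1 C dC.
have [m [mC mP]] : exists m, m \in C /\ forall y, y \in C -> (m <= y)%O :=
  min_exists eC.
have : m \in active G w; last by rewrite act0 inE.
rewrite inE; apply/existsP; exists C; rewrite dC /is_min mC /=.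
by apply/'forall_implyP.
Qed.

Lemma strongly_connectedE w : strongly_connected G w = (Int G (alpha G w) == set0).
Proof.
rewrite -(dual_activeE w0 EG).
apply/'forall_implyP/eqP => [sc|dual0 e eG].
  apply/setP=> e; rewrite !inE; apply/existsP => -[D /andP[dD /andP[eD _]]].
  have /existsP[C /andP[dC eC]] := sc e (in_edges EG e).
  exact: (directed_supports_disjoint (graph_dual_pair G w)
    (directed_cocycle_supports G w) (directed_cycle_supports G w) dD dC eD eC).
have [F [pos co]] := all_coherent w0 EG w.
have fr := frameC (co_frame co); have lv := levellingC (co_frame co) (co_level co).
have [a [ag aa ae pa]] := level_active (co_frame co) (co_level co) eG.
have aT : a \in ~: alpha G w.
  rewrite inE; apply/negP => aT; have : a \in dual_active G w; last by rewrite dual0 inE.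
  by rewrite (dual_activeE w0 EG) (IntE co) inE ag aT aa.
have above : (e \in edges G) && (- pos a <= - pos e)%R by rewrite eG pa lexx.
have [C [dC eC _]] := (directed_cover fr lv (fittedC (co_fit co))
  (directed_cycle_supports G w) e ag aT aa).2 above.
by apply/existsP; exists C; rewrite dC.
Qed.

Lemma dual_fixed_switched w :
  dual_active_fixed G w0 w = (switched w :&: Int G (alpha G w) == set0).
Proof.
rewrite (dual_active_fixedE w0 EG); apply/'forall_implyP/eqP => [fx|sw x xI].
  apply/setP=> x; rewrite in_setI in_set0 in_set; apply/negP => /andP[/andP[_ wx] /fx].
  exact/negP.
rewrite -[_ == _]negbK; apply/negP => wx.
suff : x \in set0 by rewrite inE.
by rewrite -sw in_setI in_set /activities in_setU xI wx.
Qed.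

Lemma fixed_switched w :
  active_fixed G w0 w = (switched w :&: Ext G (alpha G w) == set0).
Proof.
rewrite (active_fixedE w0 EG); apply/'forall_implyP/eqP => [fx|sw x xI].
  apply/setP=> x; rewrite in_setI in_set0 in_set; apply/negP => /andP[/andP[_ wx] /fx].
  exact/negP.
rewrite -[_ == _]negbK; apply/negP => wx.
suff : x \in set0 by rewrite inE.
by rewrite -sw in_setI in_set /activities in_setU xI wx orbT.
Qed.

Lemma reverse_allE (w : orientation E) x y : (y == reorient [set: E] w x) = (y != w x).
Proof. by rewrite ffunE inE; case: y; case: (w x). Qed.

Lemma dual_fixed_reverse w : dual_active_fixed G (reorient [set: E] w0) w =
  (switched w :&: Int G (alpha G w) == Int G (alpha G w)).
Proof.
rewrite (dual_active_fixedE w0 EG); apply/'forall_implyP/eqP => [fx|sw x xI].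
  apply/setIidPr/subsetP => x xI; rewrite in_set /activities in_setU xI /=.
  by have := fx x xI; rewrite reverse_allE.
by rewrite reverse_allE; move: xI; rewrite -sw in_setI in_set => /andP[/andP[]].
Qed.

Lemma fixed_reverse w : active_fixed G (reorient [set: E] w0) w =
  (switched w :&: Ext G (alpha G w) == Ext G (alpha G w)).
Proof.
rewrite (active_fixedE w0 EG); apply/'forall_implyP/eqP => [fx|sw x xI].
  apply/setIidPr/subsetP => x xI; rewrite in_set /activities in_setU xI orbT /=.
  by have := fx x xI; rewrite reverse_allE.
by rewrite reverse_allE; move: xI; rewrite -sw in_setI in_set => /andP[/andP[]].
Qed.

Lemma mem_phi w x : (x \in phi w) = ((x \in alpha G w) != (x \in switched w)).
Proof. by rewrite (phiE w0 EG) in_symdiff. Qed.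

Lemma phi_sub_tree w : (switched w :&: Ext G (alpha G w) == set0) ->
  phi w \subset alpha G w.
Proof.
move=> /eqP sw; apply/subsetP=> x; rewrite mem_phi; apply: contraLR => xT.
rewrite (negbTE xT) negbK eq_sym eqbF_neg; apply/negP => xs.
have := subsetP (switched_sub G w0 w) x xs; rewrite in_setU => /orP[/Int_sub_tree|xE].
  exact/negP.
have : x \in set0; last by rewrite inE.
by rewrite -sw in_setI xs.
Qed.

Lemma tree_sub_phi w : (switched w :&: Int G (alpha G w) == set0) ->
  alpha G w \subset phi w.
Proof.
move=> /eqP sw; apply/subsetP=> x xT; rewrite mem_phi xT eq_sym eqb_id.
apply/negP => xs.
have := subsetP (switched_sub G w0 w) x xs; rewrite in_setU => /orP[xI|/Ext_notin_tree].
  have : x \in set0; last by rewrite inE.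
  by rewrite -sw in_setI xs.
by rewrite xT.
Qed.

(** An element [x] of the fundamental cycle of [e] other than [e] is passive, its
vector containing the smaller [e]; so [x] stays in every subset of the
interval. *)
Lemma ext_cycle w e : e \in Ext G (alpha G w) -> exists C,
  [/\ is_cycle G C, is_min e C & C :\ e \subset phi w].
Proof.
move=> eE; have [F [pos co]] := all_coherent w0 EG w; have fr := co_frame co.
have := eE; rewrite (ExtE co) inE => /and3P[eg]; rewrite inE => eT ea.
exists (supp F e); split; first exact: (supp_cycle fr eg eT).
  by rewrite (is_min_active fr eg).
apply/subsetP=> x; rewrite in_setD1 in_set => /andP[xe Fx]; have xg := in_edges EG x.
have xT : x \in alpha G w by rewrite (fr_side fr eg xe Fx) eT.
rewrite mem_phi xT eq_sym eqb_id; apply/negP => /(subsetP (switched_sub G w0 w)).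
rewrite in_setU (IntE co) (ExtE co) in_set [in X in _ || X]in_set xg xT [x \in ~: _]inE xT /= orbF.
move/forallP/(_ e)/implyP; rewrite (fr_neq0C fr) // => /(_ Fx).
move/forallP: ea => /(_ x)/implyP/(_ Fx) ex xe'.
by case/negP: xe; apply/eqP/le_anti; rewrite xe' ex.
Qed.

(** Dual to [ext_cycle]. *)
Lemma int_cocycle w b : b \in Int G (alpha G w) -> exists D,
  [/\ is_cocycle G D, is_min b D & [disjoint D :\ b & phi w]].
Proof.
move=> bI; have [F [pos co]] := all_coherent w0 EG w; have fr := co_frame co.
have := bI; rewrite (IntE co) inE => /and3P[bg bT ba].
exists (supp F b); split; first exact: (supp_cocycle fr (co_sub co) bT).
  by rewrite (is_min_active fr bg).
rewrite -setI_eq0; apply/eqP/setP=> x; rewrite in_setI in_setD1 in_set in_set0.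
apply/negP => /andP[/andP[xb Fx]]; have xg := in_edges EG x.
have xT : x \notin alpha G w by rewrite (fr_side fr bg xb Fx) bT.
rewrite mem_phi (negbTE xT) eq_sym eqbF_neg negbK.
move/(subsetP (switched_sub G w0 w)).
rewrite in_setU (IntE co) (ExtE co) in_set [in X in _ || X]in_set xg (negbTE xT) [x \in ~: _]inE xT /=.
move/forallP/(_ b)/implyP; rewrite (fr_neq0C fr) // => /(_ Fx).
move/forallP: ba => /(_ x)/implyP/(_ Fx) bx xb'.
by case/negP: xb; apply/eqP/le_anti; rewrite xb' bx.
Qed.

Lemma nbc_ext w : no_broken_circuit G (phi w) -> Ext G (alpha G w) == set0.
Proof.
move=> /forallP nbc; apply/eqP/setP=> e; rewrite in_set0; apply/negP => eE.
have [C [cC eC sub]] := ext_cycle eE.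
by have /forallP/(_ e)/implyP := nbc C; rewrite cC eC sub => /(_ isT).
Qed.

Lemma internal_nbc T B : internal_tree G T -> B \subset T -> no_broken_circuit G B.
Proof.
case/andP=> tT /eqP eT BT; apply/forallP=> C; apply/forallP=> m.
apply/implyP=> /andP[cC mC]; apply/negP => /subset_trans/(_ BT) CT.
have [F fr] := spanning_tree_frame w0 tT.
have [mT|mT] := boolP (m \in T).
  have /negP[] : ~~ (C \subset T).
    by case/andP: tT => /andP[_ /forallP/(_ C)/implyP/(_ cC)].
  apply/subsetP=> x xC; have [->//|xm] := eqVneq x m.
  by apply: (subsetP CT); rewrite !inE xm.
have CE : C = supp F m.
  apply: (cycle_eq_supp fr (in_edges EG m) mT cC); apply/subsetP=> x xC.
  rewrite !inE; have [->|xm] := eqVneq x m; first by rewrite orbT.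
  by rewrite (subsetP CT) // !inE xm.
have : m \in Ext G T; last by rewrite eT inE.
rewrite (Ext_active fr) !inE mT in_edges //=.
by rewrite -(is_min_active fr (in_edges EG m)) -CE.
Qed.

(** The fundamental cocycle of [b] minus [b] is disjoint from [phi w], hence from
[T].  If [b] is in [T], it is also a fundamental cocycle of [T] and [b] is
internally active in [T]; otherwise it is a cocycle missing the spanning tree
[T]. *)
Lemma external_no_int T w : external_tree G T -> T \subset phi w ->
  Int G (alpha G w) == set0.
Proof.
case/andP=> tT /eqP iT TB; apply/eqP/setP=> b; rewrite in_set0; apply/negP => bI.
have [D [cD bD]] := int_cocycle bI; rewrite disjoint_sym => /(disjointWl TB) dis.
have [F fr] := spanning_tree_frame w0 tT; have TG := spanning_tree_sub tT.
have DT x : x \in D -> x != b -> x \notin T.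
  move=> xD xb; apply/negP => xT; have := disjointFr dis xT.
  by rewrite !inE xb xD.
have [bT|bT] := boolP (b \in T).
  have DE : D = supp F b.
    apply: (cocycle_eq_supp fr TG bT cD); apply/subsetP=> x xD.
    rewrite !inE; have [->|xb] := eqVneq x b; first by rewrite orbT.
    by rewrite DT // in_edges.
  have : b \in Int G T; last by rewrite iT inE.
  rewrite (Int_active fr TG) !inE bT /=.
  by rewrite -(is_min_active fr (in_edges EG b)) -DE.
have [u [fu uD [e eD]]] := cocycle_tension w0 cD.
move: eD; rewrite -uD => /negP[]; apply/eqP.
apply: (fr_coord0 (frameC fr) fu) => x xg; rewrite inE negbK => xT.
apply/eqP; rewrite -[_ == _]negbK uD; apply: contraL xT => xD.
by have [->//|xb] := eqVneq x b; apply: DT.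
Qed.

Lemma sub_tree_forest T B : spanning_tree G T -> B \subset T -> forest G B.
Proof.
case/andP=> /andP[TG /forallP noC] _ BT; rewrite /forest (subset_trans BT TG).
apply/forallP=> C; apply/implyP => /(implyP (noC C)).
by apply: contra => /subset_trans; apply.
Qed.

Lemma forest_not_switched w : forest G (phi w) -> switched w :&: Ext G (alpha G w) == set0.
Proof.
case/andP=> _ /forallP noC; apply/eqP/setP=> e; rewrite in_set0 in_setI; apply/negP.
case/andP=> es eE; have [C [cC _ sub]] := ext_cycle eE.
have /implyP/(_ cC)/negP[] := noC C; apply/subsetP=> x xC.
have [->|xe] := eqVneq x e; last by apply: (subsetP sub); rewrite !inE xe.
by rewrite mem_phi es (negbTE (Ext_notin_tree eE)).
Qed.

Lemma tree_sub_spanning T B : spanning_tree G T -> T \subset B -> spanning G B.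
Proof.
case/andP=> _ /forallP sp TB; apply/forallP=> x; apply/forallP=> y; apply/implyP=> cxy.
have /forallP/(_ y)/implyP/(_ cxy) := sp x.
apply: connect_sub => {cxy}x {}y /(adjacentP w0)[e [eG eT xy]]; apply: connect1.
have := adjacent_edge w0 eG (subsetP TB e eT).
by case: xy => -[-> ->] //; rewrite adjacent_sym.
Qed.

(** A switched internal [b] leaves its fundamental cocycle without edge in
[phi w]. *)
Lemma spanning_not_switched w : spanning G (phi w) ->
  switched w :&: Int G (alpha G w) == set0.
Proof.
move=> /forallP sp; apply/eqP/setP=> b; rewrite in_set0 in_setI; apply/negP.
case/andP=> bs bI; have [D [cD bD dis]] := int_cocycle bI.
have bphi : b \notin phi w by rewrite mem_phi bs (Int_sub_tree bI).
have [_ [U DU] _] := cocycle_cut cD.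
have Dphi x : x \in D -> x \notin phi w.
  move=> xD; have [->//|xb] := eqVneq x b.
  by rewrite (disjointFr dis) // !inE xb.
have {bD} : b \in cut G U by rewrite -DU; case/andP: bD.
rewrite (in_cut _ w0) in_edges //= => /eqP[].
apply: (connect_invariant (r := adjacent (restrict G (phi w)))
  (h := fun v => v \in U)) => [x y /(adjacentP w0)[e [eG eB xy]]|].
  have : e \notin cut G U by rewrite -DU; apply: contraL eB; apply: Dphi.
  rewrite (in_cut _ w0) eG negbK => /eqP.
  by case: xy => -[-> ->].
have /forallP/(_ (terminus G w0 b))/implyP := sp (origin G w0 b); apply.
apply: connect1; rewrite -[G in adjacent G]restrict_edges.
by apply: adjacent_edge; rewrite in_edges.
Qed.

Lemma phi_fixed w : (phi w == alpha G w) = (switched w == set0).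
Proof.
apply/eqP/eqP => [pT|sw]; last by apply/setP=> x; rewrite mem_phi sw in_set0; case: (_ \in _).
by rewrite -(symdiffK (alpha G w) (switched w)) -(phiE w0 EG) pT; apply/setP=> x;
  rewrite in_symdiff in_set0 eqxx.
Qed.

(** A tree [phi w] lies in its own interval, hence is [alpha G w]. *)
Lemma phi_tree w : spanning_tree G (phi w) = (switched w == set0).
Proof.
rewrite -phi_fixed; apply/idP/eqP => [tT|->]; last exact: (alpha_tree w0 EG).
apply/eqP; rewrite eq_sym -(phi_in_interval w0 EG w tT) in_interval.
by apply/subsetP=> x; rewrite in_symdiff eqxx.
Qed.

Lemma switched_eq0 w : (switched w == set0) =
  (switched w :&: Int G (alpha G w) == set0) && (switched w :&: Ext G (alpha G w) == set0).
Proof.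
by rewrite -setU_eq0 -setIUr (setIidPl _) // switched_sub.
Qed.

Lemma minset_interval T B : minset (mem (tree_interval G T)) B = (B == T :\: Int G T).
Proof.
have bot : T :\: Int G T \in tree_interval G T.
  by rewrite inE subxx /= (subset_trans (subsetDl _ _)) // subsetUl.
apply/idP/eqP => [/minsetP[BT minB]|->].
  have : B \in tree_interval G T := BT.
  by rewrite inE => /andP[TB _]; rewrite (minB _ bot TB).
apply/minsetP; split=> // B' B'T BT; have : B' \in tree_interval G T := B'T.
rewrite inE => /andP[TB _].
by apply/eqP; rewrite eqEsubset BT.
Qed.

Lemma maxset_interval T B : maxset (mem (tree_interval G T)) B = (B == T :|: Ext G T).
Proof.
have top : T :|: Ext G T \in tree_interval G T.
  by rewrite inE subxx andbT (subset_trans (subsetDl _ _)) // subsetUl.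
apply/idP/eqP => [/maxsetP[TB maxB]|->].
  have : B \in tree_interval G T := TB.
  by rewrite inE => /andP[_ BT]; rewrite (maxB _ top BT).
apply/maxsetP; split=> // B' B'T TB; have : B' \in tree_interval G T := B'T.
rewrite inE => /andP[_ BT].
by apply/eqP; rewrite eqEsubset BT.
Qed.

Lemma phi_bottom w : (phi w == alpha G w :\: Int G (alpha G w)) =
  (switched w == Int G (alpha G w)).
Proof.
set T := alpha G w.
have -> : T :\: Int G T = symdiff T (Int G T).
  apply/setP=> x; rewrite in_symdiff in_setD; have := @Int_sub_tree _ _ _ G T x.
  by case: (x \in Int G T); case: (x \in T) => // /(_ isT).
rewrite (phiE w0 EG) -/T; apply/eqP/eqP => [|->//].
by move/(congr1 (symdiff T)); rewrite !symdiffK.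
Qed.

Lemma phi_top w : (phi w == alpha G w :|: Ext G (alpha G w)) =
  (switched w == Ext G (alpha G w)).
Proof.
set T := alpha G w.
have -> : T :|: Ext G T = symdiff T (Ext G T).
  apply/setP=> x; rewrite in_symdiff in_setU; have := @Ext_notin_tree _ _ _ G T x.
  by case: (x \in Ext G T); case: (x \in T) => // /(_ isT).
rewrite (phiE w0 EG) -/T; apply/eqP/eqP => [|->//].
by move/(congr1 (symdiff T)); rewrite !symdiffK.
Qed.

Lemma phi_sub_internal w :
  [exists T, internal_tree G T && (phi w \subset T)] = (Ext G (alpha G w) == set0).
Proof.
apply/existsP/idP => [[T /andP[iT sub]]|e0].
  exact: nbc_ext (internal_nbc iT sub).
exists (alpha G w); rewrite /internal_tree (alpha_tree w0 EG) e0 phi_sub_tree //.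
by rewrite (eqP e0) setI0.
Qed.

Lemma phi_nbc w : no_broken_circuit G (phi w) = (Ext G (alpha G w) == set0).
Proof.
apply/idP/idP; first exact: nbc_ext.
by rewrite -phi_sub_internal => /existsP[T /andP[iT sub]]; apply: internal_nbc iT sub.
Qed.

Lemma phi_sup_external w :
  [exists T, external_tree G T && (T \subset phi w)] = (Int G (alpha G w) == set0).
Proof.
apply/existsP/idP => [[T /andP[eT sub]]|i0]; first exact: external_no_int eT sub.
exists (alpha G w); rewrite /external_tree (alpha_tree w0 EG) i0 tree_sub_phi //.
by rewrite (eqP i0) setI0.
Qed.

Lemma phi_forest w : forest G (phi w) = (switched w :&: Ext G (alpha G w) == set0).
Proof.
apply/idP/idP; first exact: forest_not_switched.
by move/phi_sub_tree/(sub_tree_forest (alpha_tree w0 EG w)).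
Qed.

Lemma phi_sub_spanning_tree w :
  [exists T, spanning_tree G T && (phi w \subset T)] = forest G (phi w).
Proof.
apply/existsP/idP => [[T /andP[tT sub]]|]; first exact: sub_tree_forest tT sub.
by rewrite phi_forest => /phi_sub_tree sub; exists (alpha G w); rewrite (alpha_tree w0 EG).
Qed.

Lemma phi_spanning w : spanning G (phi w) = (switched w :&: Int G (alpha G w) == set0).
Proof.
apply/idP/idP; first exact: spanning_not_switched.
by move/tree_sub_phi/(tree_sub_spanning (alpha_tree w0 EG w)).
Qed.

Lemma phi_sup_spanning_tree w :
  [exists T, spanning_tree G T && (T \subset phi w)] = spanning G (phi w).
Proof.
apply/existsP/idP => [[T /andP[tT sub]]|]; first exact: tree_sub_spanning tT sub.
by rewrite phi_spanning => /tree_sub_phi sub; exists (alpha G w); rewrite (alpha_tree w0 EG).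
Qed.

Lemma phi_internal_tree w : internal_tree G (phi w) =
  (switched w :&: Int G (alpha G w) == set0) && (Ext G (alpha G w) == set0).
Proof.
rewrite /internal_tree phi_tree switched_eq0.
apply/andP/andP => [[s0 e0]|[s0 e0]].
  have /eqP pa : phi w == alpha G w by rewrite phi_fixed switched_eq0.
  by rewrite pa in e0; case/andP: s0.
have sw0 : switched w == set0 by rewrite switched_eq0 s0 (eqP e0) setI0 /=.
by rewrite s0 {1}(eqP e0) setI0 eqxx; move: sw0; rewrite -phi_fixed => /eqP->.
Qed.

Lemma phi_external_tree w : external_tree G (phi w) =
  (Int G (alpha G w) == set0) && (switched w :&: Ext G (alpha G w) == set0).
Proof.
rewrite /external_tree phi_tree switched_eq0.
apply/andP/andP => [[s0 i0]|[i0 s0]].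
  have /eqP pa : phi w == alpha G w by rewrite phi_fixed switched_eq0.
  by rewrite pa in i0; case/andP: s0.
have sw0 : switched w == set0 by rewrite switched_eq0 s0 (eqP i0) setI0 eqxx.
by rewrite s0 {1}(eqP i0) setI0 eqxx; move: sw0; rewrite -phi_fixed => /eqP->.
Qed.

Lemma phi_internal_bottom w :
  [exists T, internal_tree G T && minset (mem (tree_interval G T)) (phi w)] =
  (switched w :&: Int G (alpha G w) == Int G (alpha G w)) && (Ext G (alpha G w) == set0).
Proof.
apply/existsP/andP => [[T /andP[/andP[tT e0] mT]]|[/eqP sw e0]].
  have /eqP aT : alpha G w == T.
    by rewrite -(phi_in_interval w0 EG) //; case/minsetP: mT.
  move: mT; rewrite minset_interval -aT phi_bottom => /eqP->.
  by rewrite setIid eqxx aT.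
exists (alpha G w); rewrite /internal_tree (alpha_tree w0 EG) e0 minset_interval phi_bottom.
rewrite -[X in X == _](setIidPl (switched_sub G w0 w)) /activities (eqP e0) setU0.
by rewrite sw eqxx.
Qed.

Lemma phi_external_top w :
  [exists T, external_tree G T && maxset (mem (tree_interval G T)) (phi w)] =
  (Int G (alpha G w) == set0) && (switched w :&: Ext G (alpha G w) == Ext G (alpha G w)).
Proof.
apply/existsP/andP => [[T /andP[/andP[tT i0] mT]]|[i0 /eqP sw]].
  have /eqP aT : alpha G w == T.
    by rewrite -(phi_in_interval w0 EG) //; case/maxsetP: mT.
  move: mT; rewrite maxset_interval -aT phi_top => /eqP->.
  by rewrite setIid eqxx aT.
exists (alpha G w); rewrite /external_tree (alpha_tree w0 EG) i0 maxset_interval phi_top.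
rewrite -[X in X == _](setIidPl (switched_sub G w0 w)) /activities (eqP i0) set0U.
by rewrite sw eqxx.
Qed.

End Consequences.

(** * The refined active bijection *)

Theorem theorem4p16 (d : Order.disp_t) (V : finType) (E : finOrderType d)
    (G : multigraph V E) (w : orientation E) :
  edges G = [set: E] -> connected_graph G ->
  exists phi : orientation E -> {set E},
  (forall A : {set E}, phi (reorient A w) = alpha_refined G w A) /\
  (* (1) *)
  [/\ bijective phi,
      (forall H : orientation E, exists2 T : {set E}, spanning_tree G T &
         order_isomorphism phi
           (activity_class G H) (class_le G w) (tree_interval G T) (interval_le G))
    & (forall T : {set E}, spanning_tree G T ->
         exists H : orientation E, phi @: activity_class G H = tree_interval G T)] /\
  (* (2) *)
  (forall A : {set E},
     let H := reorient A w in
     let T := alpha G H in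
     let P := A :&: Int G T in
     let Q := A :&: Ext G T in
     let B := alpha_refined G w A in
     [/\ P = A :&: dual_active G H, Q = A :&: active G H & B = (T :\: P) :|: Q] /\
     [/\ [/\ Int_sub G B = Int G T :\: P,
             Int G T :\: P = dual_active G H :\: P
           & dual_active G H :\: P = Theta_star G w A],
         P_sub G B = P /\ P = Theta_star_bar G w A,
         [/\ Ext_sub G B = Ext G T :\: Q,
             Ext G T :\: Q = active G H :\: Q
           & active G H :\: Q = Theta G w A]
       & Q_sub G B = Q /\ Q = Theta_bar G w A]) /\
  (* (3) *)
  (forall A : {set E},
     alpha_refined G w A = alpha G (reorient A w) <->
     active_fixed G w (reorient A w) /\ dual_active_fixed G w (reorient A w)) /\
  let wE := reorient [set: E] w in
  let subsets_of (P : pred {set E}) :=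
    [set B : {set E} | [exists T, P T && (B \subset T)]] in
  let supersets_of (P : pred {set E}) :=
    [set B : {set E} | [exists T, P T && (T \subset B)]] in
  let internal_subsets := subsets_of (internal_tree G) in
  let forests := subsets_of (spanning_tree G) in
  let connected_spanning := supersets_of (spanning_tree G) in
  restricts_to_bijection phi [set: orientation E] [set: {set E}]
    (tutte_at G 2 2) /\
  (restricts_to_bijection phi [set H | acyclic G H] internal_subsets
     (tutte_at G 2 0) /\
   internal_subsets = [set B | no_broken_circuit G B]) /\
  restricts_to_bijection phi [set H | strongly_connected G H]
    (supersets_of (external_tree G)) (tutte_at G 0 2) /\
  restricts_to_bijection phi
    [set H | acyclic G H && dual_active_fixed G w H]
    [set T | internal_tree G T] (tutte_at G 1 0) /\
  restricts_to_bijection phi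
    [set H | acyclic G H && dual_active_fixed G wE H]
    [set B | [exists T, internal_tree G T && minset (mem (tree_interval G T)) B]]
    (tutte_at G 1 0) /\
  restricts_to_bijection phi
    [set H | strongly_connected G H && active_fixed G w H]
    [set T | external_tree G T] (tutte_at G 0 1) /\
  restricts_to_bijection phi
    [set H | strongly_connected G H && active_fixed G wE H]
    [set B | [exists T, external_tree G T && maxset (mem (tree_interval G T)) B]]
    (tutte_at G 0 1) /\
  (restricts_to_bijection phi [set H | active_fixed G w H] forests
     (tutte_at G 2 1) /\
   forests = [set B | forest G B]) /\
  (restricts_to_bijection phi [set H | dual_active_fixed G w H]
     connected_spanning (tutte_at G 1 2) /\
   connected_spanning = [set B | spanning G B]) /\
  restricts_to_bijection phi
    [set H | active_fixed G w H && dual_active_fixed G w H]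
    [set T | spanning_tree G T] (tutte_at G 1 1).
Proof.
move=> EG _; exists (phi G w); split; first exact: phi_reorient.
split.
  split.
  - exact: phi_bijective.
  - move=> H; exists (alpha G H); first exact: alpha_tree w EG H.
    exact: phi_order_isomorphism.
  - move=> T tT.
    have [H [_ aT _]] := coherent_switched w tT (sub0set _).
    by exists H; rewrite phi_image_class // aT.
split.
  move=> A H T P Q B.
  have BE : B = phi G w H by rewrite phi_reorient.
  have dA : dual_active G H = Int G T := dual_activeE w EG H.
  have aA : active G H = Ext G T := activeE w EG H.
  have tB : tree_of G B = T by rewrite BE (tree_of_phi w EG).
  have BPQ : B = (T :\: P) :|: Q by rewrite /B /alpha_refined -/H -/T dA aA.
  have memB x : (x \in B) = (x \in T) && ~~ (x \in P) || (x \in Q).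
    by rewrite BPQ in_setU in_setD andbC.
  split; first by rewrite dA aA.
  rewrite /Theta_star /Theta_star_bar /Theta /Theta_bar -/H dA aA.
  rewrite /Int_sub /P_sub /Ext_sub /Q_sub tB.
  have IT x := @Int_sub_tree _ _ _ G T x; have ET x := @Ext_notin_tree _ _ _ G T x.
  split; split; try split; apply/setP=> x; rewrite ?(in_setI, in_setD) ?memB /P /Q ?in_setI;
    have := IT x; have := ET x;
    case: (x \in Int G T); case: (x \in Ext G T); case: (x \in T); case: (x \in A) => //= h1 h2;
    first [by have := h1 isT | by have := h2 isT].
split.
  move=> A; rewrite -phi_reorient.
  split=> [/eqP|[af daf]]; first by rewrite phi_fixed // -fixedP // => /andP.
  by apply/eqP; rewrite phi_fixed // -fixedP // af daf.
move=> wE subsets_of supersets_of internal_subsets forests connected_spanning.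
have onto B : exists H, phi G w H = B.
  by have [H [_ <-]] := phi_surjective w EG B; exists H.
have tree H := alpha_tree w EG H.
have count f g x y cf cg := @card_switched_condition _ _ _ G w EG f g x y cf cg.
split.
  apply: (phi_restricts EG) => [H|]; first by rewrite !in_setT.
  by rewrite -(count _ _ _ _ (@card_any d E) (@card_any d E)); apply: eq_card => H; rewrite !in_setT.
split.
  split.
    apply: (phi_restricts EG) => [H|].
      by rewrite !in_set (acyclicE w EG) phi_sub_internal.
    rewrite -(count _ _ _ _ (@card_any d E) (@card_none d E)); apply: eq_card => H.
    by rewrite !in_set (acyclicE w EG).
  apply/setP=> B; have [H <-] := onto B.
  by rewrite !in_set phi_sub_internal // phi_nbc.
split.
  apply: (phi_restricts EG) => [H|].
    by rewrite !in_set (strongly_connectedE w EG) phi_sup_external.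
  rewrite -(count _ _ _ _ (@card_none d E) (@card_any d E)); apply: eq_card => H.
  by rewrite !in_set (strongly_connectedE w EG) andbT.
split.
  apply: (phi_restricts EG) => [H|].
    by rewrite !in_set (acyclicE w EG) dual_fixed_switched // phi_internal_tree // andbC.
  rewrite -(count _ _ _ _ (@card_bottom d E) (@card_none d E)); apply: eq_card => H.
  by rewrite !in_set (acyclicE w EG) dual_fixed_switched // andbC.
split.
  apply: (phi_restricts EG) => [H|].
    by rewrite !in_set (acyclicE w EG) dual_fixed_reverse // phi_internal_bottom // andbC.
  rewrite -(count _ _ _ _ (@card_top d E) (@card_none d E)); apply: eq_card => H.
  by rewrite !in_set (acyclicE w EG) dual_fixed_reverse // andbC.
split.
  apply: (phi_restricts EG) => [H|].
    by rewrite !in_set (strongly_connectedE w EG) fixed_switched // phi_external_tree.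
  rewrite -(count _ _ _ _ (@card_none d E) (@card_bottom d E)); apply: eq_card => H.
  by rewrite !in_set (strongly_connectedE w EG) fixed_switched.
split.
  apply: (phi_restricts EG) => [H|].
    by rewrite !in_set (strongly_connectedE w EG) fixed_reverse // phi_external_top.
  rewrite -(count _ _ _ _ (@card_none d E) (@card_top d E)); apply: eq_card => H.
  by rewrite !in_set (strongly_connectedE w EG) fixed_reverse.
split.
  split.
    apply: (phi_restricts EG) => [H|].
      by rewrite !in_set fixed_switched // phi_sub_spanning_tree // phi_forest.
    rewrite -(count _ _ _ _ (@card_any d E) (@card_bottom d E)); apply: eq_card => H.
    by rewrite !in_set fixed_switched.
  apply/setP=> B; have [H <-] := onto B.
  by rewrite !in_set phi_sub_spanning_tree.
split.
  split.
    apply: (phi_restricts EG) => [H|].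
      by rewrite !in_set dual_fixed_switched // phi_sup_spanning_tree // phi_spanning.
    rewrite -(count _ _ _ _ (@card_bottom d E) (@card_any d E)); apply: eq_card => H.
    by rewrite !in_set dual_fixed_switched // andbT.
  apply/setP=> B; have [H <-] := onto B.
  by rewrite !in_set phi_sup_spanning_tree.
apply: (phi_restricts EG) => [H|].
  by rewrite !in_set fixedP // phi_tree.
rewrite -(count _ _ _ _ (@card_bottom d E) (@card_bottom d E)); apply: eq_card => H.
by rewrite !in_set fixedP // switched_eq0.
Qed.
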